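(* Let $(M,N)$ be a weighted manifold pair with an order $r$ weighting, with corresponding filtration $\nu(M,N)=F_{-r}\supseteq\cdots\supseteq F_{-1}\supseteq F_0=0$ of the normal bundle. There is a canonical identification of graded vector bundles over $N$, $$\nu_{\mathcal W}(M,N)_{\mathrm{lin}}=\mathrm{gr}(\nu(M,N)),$$ where $\nu_{\mathcal W}(M,N)_{\mathrm{lin}}$ is the linear approximation of the graded bundle $\nu_{\mathcal W}(M,N)$ and $\mathrm{gr}(\nu(M,N))=\bigoplus_i F_{-i}/F_{-i+1}$.
   Context: Weightings. A weight sequence of order $r$ is a sequence of integers $0\le w_1\le\dots\le w_n\le r$. For a chart $U$ with coordinates $x_1,\dots,x_n$, let $C^\infty(U)_{(i)}$ be the ideal generated by monomials $x^s$ with $\sum_a s_aw_a\ge i$. An order $r$ weighting on an $n$-dimensional manifold $M$ is a filtration $C^\infty_M=C^\infty_{M,(0)}\supseteq C^\infty_{M,(1)}\supseteq\cdots$ of the structure sheaf by ideal sheaves such that every point has an open neighborhood $U$ with coordinates $x_a$ (weighted coordinates) in which the filtration of $C^\infty(U)$ is given by this local model for a weight sequence of order $r$ (which may depend on the connected component of $N$). $C^\infty_{M,(1)}$ is the vanishing ideal $\mathcal I$ of a closed submanifold $N$; $(M,N)$ is then a weighted manifold pair. Global sections are denoted $C^\infty(M)_{(i)}$. Filtration of the normal bundle $\nu(M,N)=TM|_N/TN$: identify $\mathcal I/\mathcal I^2$ with the sheaf of sections of $\nu(M,N)^*$ via $f\mapsto df|_N$. The subbundles $F_{-i}$, $0\le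 i\le r$, are determined by the condition that for $i\ge1$ the image of $C^\infty_{M,(i)}$ in $\mathcal I/\mathcal I^2$ is the sheaf of sections of $\mathrm{ann}(F_{-i+1})$ (with $F_{-i}=\nu(M,N)$ for $i\ge r$). The component $F_{-i}/F_{-i+1}$ of $\mathrm{gr}(\nu(M,N))$ has degree $-i$. Graded bundles. A graded bundle is a manifold $E$ with a smooth action $t\mapsto\kappa_t$ of the monoid $(\mathbb{R},\cdot)$; it is a fiber bundle over $N=\kappa_0(E)$. Its linear approximation is the graded vector bundle $E_{\mathrm{lin}}=\nu(E,N)=\bigoplus_{i\ge1}E_{\mathrm{lin}}^{-i}$, where $E_{\mathrm{lin}}^{-i}$ is the subbundle on which $\nu(\kappa_t)$ (the map on the normal bundle induced by $\kappa_t$) is multiplication by $t^i$. Weighted normal bundle. $\nu_{\mathcal W}(M,N)=\mathrm{Hom}_{\mathrm{alg}}(\mathrm{gr}(C^\infty(M)),\mathbb{R})$ with $\mathrm{gr}(C^\infty(M))=\bigoplus_iC^\infty(M)_{(i)}/C^\infty(M)_{(i+1)}$; it is a graded bundle over $N$ of dimension $\dim M$ whose graded algebra of polynomial functions (sums of functions $f$ homogeneous of some degree $k$, $\kappa_t^*f=t^kf$) is $\mathrm{gr}(C^\infty(M))$. *)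

(* Defs.v *)
From HB Require Import structures.
From mathcomp Require Import all_boot all_order all_algebra.
From mathcomp Require Import all_classical all_reals all_analysis.
Set Implicit Arguments.
Unset Strict Implicit.
Unset Printing Implicit Defensive.
Import Order.TTheory GRing.Theory Num.Theory.
Import numFieldNormedType.Exports.
Local Open Scope classical_set_scope.
Local Open Scope quotient_scope.
Local Open Scope ring_scope.

Record subspace (R : pzRingType) (V : lmodType R) := Subspace {
  smem :> {pred V};
  smemP : GRing.submod_closed smem }.

Section SubspaceType.
Context (R : pzRingType) (V : lmodType R) (A : subspace V).

HB.instance Definition _ := GRing.isSubmodClosed.Build R V (smem A) (smemP A).

Definition sub_of := {x : V | x \in smem A}.

HB.instance Definition _ := SubType.on sub_of.
HB.instance Definition _ := [Choice of sub_of by <:].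
HB.instance Definition _ := [SubChoice_isSubLmodule of sub_of by <:].

End SubspaceType.

Lemma restr_subproof (R : pzRingType) (V : lmodType R) (A B : subspace V) :
  GRing.submod_closed [pred x : sub_of A | val x \in smem B].
Proof.
split=> [|a x y]; rewrite !inE.
  by rewrite GRing.val0; apply: rpred0.
by move=> Bx By; rewrite linearP; apply: rpredD => //; apply: rpredZ.
Qed.

Definition restr (R : pzRingType) (V : lmodType R) (A B : subspace V) :
  subspace (sub_of A) := Subspace (restr_subproof A B).

Section Quotient.
Context (R : pzRingType) (V : lmodType R) (W : subspace V).

Definition quo_rel (x y : V) := x - y \in smem W.

Lemma quo_rel_equiv : equiv_class_of quo_rel.
Proof.
split=> [x|x y|y x z]; rewrite /quo_rel.
- by rewrite subrr rpred0.
- by rewrite -opprB rpredN.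
- by move=> xy yz; rewrite -(subrKA y) rpredD.
Qed.

Canonical quo_equiv := EquivRelPack quo_rel_equiv.

Definition quo := {eq_quot quo_equiv}.

HB.instance Definition _ := Choice.on quo.
HB.instance Definition _ := Quotient.on quo.

Definition cls (x : V) : quo := \pi_quo x.

Lemma clsP x y : (cls x = cls y) <-> (x - y \in smem W).
Proof. by split=> [/eqquotP|xy] //; apply/eqquotP. Qed.

Lemma cls_repr (u : quo) : cls (repr u) = u.
Proof. exact: reprK. Qed.

Lemma repr_cls x : repr (cls x) - x \in smem W.
Proof. by apply/clsP; rewrite cls_repr. Qed.

Definition quo_zero : quo := cls 0.
Definition quo_add (u v : quo) : quo := cls (repr u + repr v).
Definition quo_opp (u : quo) : quo := cls (- repr u).
Definition quo_scale (a : R) (u : quo) : quo := cls (a *: repr u).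

Lemma cls_add x y : quo_add (cls x) (cls y) = cls (x + y).
Proof. by apply/clsP; rewrite opprD addrACA rpredD // repr_cls. Qed.

Lemma cls_opp x : quo_opp (cls x) = cls (- x).
Proof. by apply/clsP; rewrite -opprD rpredN repr_cls. Qed.

Lemma cls_scale a x : quo_scale a (cls x) = cls (a *: x).
Proof. by apply/clsP; rewrite -scalerBr rpredZ // repr_cls. Qed.

Lemma quoW (P : quo -> Prop) : (forall x, P (cls x)) -> forall u, P u.
Proof. by move=> h u; rewrite -(cls_repr u). Qed.

Lemma quo_addA : associative quo_add.
Proof.
by elim/quoW=> x; elim/quoW=> y; elim/quoW=> z; rewrite !cls_add addrA.
Qed.

Lemma quo_addC : commutative quo_add.
Proof. by elim/quoW=> x; elim/quoW=> y; rewrite !cls_add addrC. Qed.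

Lemma quo_add0 : left_id quo_zero quo_add.
Proof. by elim/quoW=> x; rewrite cls_add add0r. Qed.

Lemma quo_addN : left_inverse quo_zero quo_opp quo_add.
Proof. by elim/quoW=> x; rewrite cls_opp cls_add addNr. Qed.

HB.instance Definition _ :=
  GRing.isZmodule.Build quo quo_addA quo_addC quo_add0 quo_addN.

Lemma quo_scaleA a b u : quo_scale a (quo_scale b u) = quo_scale (a * b) u.
Proof. by elim/quoW: u => x; rewrite !cls_scale scalerA. Qed.

Lemma quo_scale1 : left_id 1 quo_scale.
Proof. by elim/quoW=> x; rewrite cls_scale scale1r. Qed.

Let clsD x y : cls x + cls y = cls (x + y) := cls_add x y.

Lemma quo_scaleDr : right_distributive quo_scale +%R.
Proof.
move=> a; elim/quoW=> x; elim/quoW=> y.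
by rewrite clsD !cls_scale clsD scalerDr.
Qed.

Lemma quo_scaleDl u : {morph quo_scale^~ u : a b / a + b}.
Proof. by move=> a b; elim/quoW: u => x; rewrite !cls_scale clsD scalerDl. Qed.

HB.instance Definition _ := GRing.Zmodule_isLmodule.Build R quo
  quo_scaleA quo_scale1 quo_scaleDr quo_scaleDl.

Lemma clsZD a x y : cls (a *: x + y) = a *: cls x + cls y.
Proof.
apply/esym.
by rewrite -[LHS]/(quo_add (quo_scale a (cls x)) (cls y)) cls_scale cls_add.
Qed.

End Quotient.

Arguments cls {R V} W x.

Notation subquo A B := (quo (restr A B)).

Section Product.
Context (R : pzRingType) (I : Type) (V : I -> lmodType R).

Definition dprod := forall i, V i.

HB.instance Definition _ := gen_eqMixin dprod.
HB.instance Definition _ := gen_choiceMixin dprod.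

Definition dprod_add (x y : dprod) : dprod := fun i => x i + y i.
Definition dprod_opp (x : dprod) : dprod := fun i => - x i.
Definition dprod_scale (a : R) (x : dprod) : dprod := fun i => a *: x i.

Lemma dprod_addA : associative dprod_add.
Proof. by move=> x y z; apply: functional_extensionality_dep => i; apply: addrA. Qed.
Lemma dprod_addC : commutative dprod_add.
Proof. by move=> x y; apply: functional_extensionality_dep => i; apply: addrC. Qed.
Lemma dprod_add0 : left_id (fun i => 0 : V i) dprod_add.
Proof. by move=> x; apply: functional_extensionality_dep => i; apply: add0r. Qed.
Lemma dprod_addN : left_inverse (fun i => 0 : V i) dprod_opp dprod_add.
Proof. by move=> x; apply: functional_extensionality_dep => i; apply: addNr. Qed.

HB.instance Definition _ :=
  GRing.isZmodule.Build dprod dprod_addA dprod_addC dprod_add0 dprod_addN.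

Lemma dprod_scaleA a b x : dprod_scale a (dprod_scale b x) = dprod_scale (a * b) x.
Proof. by apply: functional_extensionality_dep => i; apply: scalerA. Qed.
Lemma dprod_scale1 : left_id 1 dprod_scale.
Proof. by move=> x; apply: functional_extensionality_dep => i; apply: scale1r. Qed.
Lemma dprod_scaleDr : right_distributive dprod_scale +%R.
Proof. by move=> a x y; apply: functional_extensionality_dep => i; apply: scalerDr. Qed.
Lemma dprod_scaleDl x : {morph dprod_scale^~ x : a b / a + b}.
Proof. by move=> a b; apply: functional_extensionality_dep => i; apply: scalerDl. Qed.

HB.instance Definition _ := GRing.Zmodule_isLmodule.Build R dprod
  dprod_scaleA dprod_scale1 dprod_scaleDr dprod_scaleDl.

End Product.

Section Smooth.
Context (R : realType).

Fixpoint Ck (k n : nat) (U : set 'rV[R]_n) (f : 'rV[R]_n -> R) : Prop :=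
  (forall y, U y -> {for y, continuous f}) /\
  if k is k'.+1 then
    forall j : 'I_n, (forall y, U y -> derivable f y (delta_mx 0 j)) /\
      Ck k' U (fun y => 'D_(delta_mx 0 j) f y)
  else True.

Definition smooth_euclid n (U : set 'rV[R]_n) (f : 'rV[R]_n -> R) :=
  forall k, Ck k U f.

Lemma Ck_cst k n (U : set 'rV[R]_n) (a : R) : Ck k U (fun=> a).
Proof.
elim: k a => [|k IHk] a /=; split=> //; try by move=> y _; exact: cst_continuous.
move=> j; split=> [y _|]; first exact: derivable_cst.
suff -> : (fun y : 'rV[R]_n => 'D_(delta_mx 0 j) (fun=> a) y) = (fun=> 0).
  exact: IHk.
by apply: funext => y; apply: derive_cst.
Qed.

Record chart (M : topologicalType) (n : nat) := Chart {
  cdom : set M;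
  cmap : M -> 'rV[R]_n;
  cinv : 'rV[R]_n -> M;
  cdom_open : open cdom;
  cimg_open : open (cmap @` cdom);
  cmapK : forall p, cdom p -> cinv (cmap p) = p;
  cmap_cont : {within cdom, continuous cmap};
  cinv_cont : {within cmap @` cdom, continuous cinv} }.

Definition smooth_change (M : topologicalType) n (c d : chart M n) :=
  forall a : 'I_n, smooth_euclid (cmap c @` (cdom c `&` cdom d))
    (fun y => cmap d (cinv c y) 0 a).

Record manifold (n : nat) := Manifold {
  mpoint :> topologicalType;
  matlas : set (chart mpoint n);
  mhausdorff : hausdorff_space mpoint;
  mcountable : @second_countable mpoint;
  mcover : forall p : mpoint, exists2 c, matlas c & cdom c p;
  mcompat : forall c d, matlas c -> matlas d -> smooth_change c d }.

Arguments matlas {n} m.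

Section ManifoldTheory.
Context (n : nat) (M : manifold n).

Definition coordinates (c : chart M n) :=
  forall d, matlas M d -> smooth_change c d /\ smooth_change d c.

Definition smooth_on (U : set M) (f : M -> R) := forall c, matlas M c ->
  smooth_euclid (cmap c @` (cdom c `&` U)) (fun y => f (cinv c y)).

Lemma smooth_on_cst U a : smooth_on U (fun=> a).
Proof. by move=> c _ k; apply: Ck_cst. Qed.

Definition closed_submanifold (N : set M) :=
  closed N /\
  forall p, N p -> exists c : chart M n, exists k : nat,
    [/\ coordinates c, cdom c p &
      cdom c `&` N =
      [set q | cdom c q /\ forall a : 'I_n, (a < k)%N -> cmap c q 0 a = 0]].

Definition monomial (c : chart M n) (s : 'I_n -> nat) (q : M) : R :=
  \prod_a cmap c q 0 a ^+ s a.

Definition local_model (c : chart M n) (w : 'I_n -> nat) (i : nat)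
    (f : M -> R) :=
  exists (m : nat) (s : 'I_m -> 'I_n -> nat) (h : 'I_m -> M -> R),
    [/\ forall k, (i <= \sum_a s k a * w a)%N,
        forall k, smooth_on (cdom c) (h k) &
        forall q, cdom c q -> f q = \sum_k h k q * monomial c (s k) q].

Definition weight_sequence (r : nat) (w : 'I_n -> nat) :=
  (forall a b : 'I_n, (a <= b)%N -> (w a <= w b)%N) /\
  (forall a, (w a <= r)%N).

(** [filt i U] is the ideal of degree [i] over the open set [U].  Functions on
    [U] are represented by total functions on [M], of which only the restriction
    to [U] matters.  The weight sequence is local: it is determined by the
    filtration near points of the zero locus of degree [1], hence constant on
    each of its components. *)
Record weighting (r : nat) := Weighting {
  filt : nat -> set M -> set (M -> R);
  filt_ext : forall i U f g, open U -> (forall q, U q -> f q = g q) ->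
    filt i U f -> filt i U g;
  filt_restrict : forall i U V f, open U -> open V -> V `<=` U ->
    filt i U f -> filt i V f;
  filt_glue : forall i U f, open U ->
    (forall p, U p -> exists V, [/\ open V, V p, V `<=` U & filt i V f]) ->
    filt i U f;
  filt0 : forall U, open U -> filt 0 U = smooth_on U;
  filt_decr : forall i U f, open U -> filt i.+1 U f -> filt i U f;
  filt_zero : forall i U, open U -> filt i U (fun=> 0);
  filt_add : forall i U f g, open U -> filt i U f -> filt i U g ->
    filt i U (fun q => f q + g q);
  filt_mul : forall i U h f, open U -> smooth_on U h -> filt i U f ->
    filt i U (fun q => h q * f q);
  filt_local : forall p, exists (c : chart M n) (w : 'I_n -> nat),
    [/\ coordinates c, cdom c p, weight_sequence r w &
        forall i f, filt i (cdom c) f <-> local_model c w i f] }.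

End ManifoldTheory.

Record weighted_pair (n r : nat) := WeightedPair {
  wM : manifold n;
  wW : weighting wM r;
  wN : set wM;
  wN_submanifold : closed_submanifold wN;
  wN_ideal : forall U f, open U ->
    (filt wW 1 U f <-> smooth_on U f /\ (forall q, U q -> wN q -> f q = 0)) }.

Arguments wM {n r} w.
Arguments wW {n r} w.
Arguments wN {n r} w.

(** A smooth manifold is considered here as a set [X] with its set [C] of
    smooth functions.  A linear map on [C] is represented by its extension by
    zero to all functions. *)

Section Normal.
Context (X : Type) (C : set (X -> R)).

Definition is_derivation (p : X) (v : (X -> R) -> R) :=
  [/\ forall f, ~ C f -> v f = 0,
      forall a f g, C f -> C g ->
        v (fun x => a * f x + g x) = a * v f + v g &
      forall f g, C f -> C g ->
        v (fun x => f x * g x) = f p * v g + v f * g p].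

Lemma tangent_subproof p :
  GRing.submod_closed [pred v : (X -> R) -> R | `[< is_derivation p v >]].
Proof.
split=> [|a u v]; rewrite !inE.
  split=> [//|b f g _ _|f g _ _].
    by rewrite -![0 _]/(0 : R) mulr0 addr0.
  by rewrite -![0 _]/(0 : R) mulr0 mul0r addr0.
move=> [u0 uD uM] [v0 vD vM].
have E f : (a *: u + v) f = a * u f + v f by [].
split=> [f Cf|b f g Cf Cg|f g Cf Cg]; rewrite !E.
- by rewrite u0 // v0 // mulr0 addr0.
- rewrite uD // vD // !mulrDr addrACA; congr (_ + _ + _).
  by rewrite !mulrA (mulrC a).
- rewrite uM // vM // !mulrDr mulrDl addrACA; congr (_ + _ + (_ + _)).
    by rewrite !mulrA (mulrC a).
  by rewrite mulrA.
Qed.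

Definition tangent (p : X) : subspace ((X -> R) -> R) :=
  Subspace (tangent_subproof p).

Lemma tangent_sub_subproof (S : set X) p :
  GRing.submod_closed [pred v : sub_of (tangent p) |
    `[< forall f, C f -> (forall x, S x -> f x = 0) -> val v f = 0 >]].
Proof.
split=> [|a u v]; rewrite !inE //.
move=> hu hv f Cf Sf.
rewrite linearP /= -[LHS]/(a * val u f + val v f).
by rewrite hu // hv // mulr0 addr0.
Qed.

(** For a submanifold [S] and [p] in [S], the image of [T_p S] in [T_p X]. *)
Definition tangent_sub (S : set X) p : subspace (sub_of (tangent p)) :=
  Subspace (tangent_sub_subproof S p).

Definition nu (S : set X) p := quo (tangent_sub S p).

(** [df|_S] as a linear form on [nu S p], for [f] vanishing on [S]. *)
Definition conormal (S : set X) p (f : X -> R) (x : nu S p) : R :=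
  val (repr x) f.

Lemma conormalE (S : set X) p f v : C f -> (forall x, S x -> f x = 0) ->
  conormal f (cls (tangent_sub S p) v) = val v f.
Proof.
move=> Cf Sf; have := repr_cls (tangent_sub S p) v.
rewrite inE => /(_ f Cf Sf); rewrite raddfB.
by move/eqP; rewrite subr_eq0 => /eqP.
Qed.

Lemma conormal_linear (S : set X) p f : C f -> (forall x, S x -> f x = 0) ->
  forall a (x y : nu S p),
    conormal f (a *: x + y) = a * conormal f x + conormal f y.
Proof.
move=> Cf Sf a x y; rewrite -(cls_repr x) -(cls_repr y) -clsZD !conormalE //.
Qed.

End Normal.

(** For [F : X -> X] smooth with [F p = q] and [F S `<=` S], the graph of
    [nu(F)], from [nu S p] to [nu S q]. *)
Definition nu_map (X : Type) (C : set (X -> R)) (S : set X) (F : X -> X) p q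
    (x : nu C S p) (y : nu C S q) :=
  exists (u : sub_of (tangent C p)) (v : sub_of (tangent C q)),
    [/\ cls _ u = x, cls _ v = y &
        forall f, C f -> val v f = val u (fun z => f (F z))].

(** A vector bundle is given by its fibres and its smooth sections; [gdeg k b]
    is the component of degree [-k] of the fibre at [b]. *)
Record gr_bundle (B : Type) := GrBundle {
  gfib : B -> lmodType R;
  gsec : set (forall b, gfib b);
  gdeg : nat -> forall b, set (gfib b) }.

Arguments gsec {B} g.
Arguments gdeg {B} g k b.

Definition gr_iso (B : Type) (V W : gr_bundle B)
    (Phi : forall b, gfib V b -> gfib W b) :=
  [/\ forall b a (x y : gfib V b),
        Phi b (a *: x + y) = a *: Phi b x + Phi b y,
      forall b, bijective (Phi b),
      forall k b (x : gfib V b), gdeg V k b x <-> gdeg W k b (Phi b x) &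
      forall s, gsec V s <-> gsec W (fun b => Phi b (s b))].

Section WeightedPair.
Context (n r : nat) (P : weighted_pair n r).
Let M : manifold n := wM P.
Let N : set M := wN P.

Definition smoothM : set (M -> R) := smooth_on [set: M].

Lemma filtT_subproof i :
  GRing.submod_closed [pred f : M -> R | `[< filt (wW P) i setT f >]].
Proof.
split=> [|a f g]; rewrite !inE; first exact/filt_zero/openT.
move=> hf hg.
apply: (@filt_add _ _ _ (wW P) i setT (fun q => a * f q) g) => //.
  exact: openT.
apply: (@filt_mul _ _ _ (wW P) i setT (fun=> a) f) => //; first exact: openT.
exact: smooth_on_cst.
Qed.

(** [C^oo(M)_(i)] *)
Definition filtT (i : nat) : subspace (M -> R) := Subspace (filtT_subproof i).

Lemma filtTP i f : (f \in smem (filtT i)) <-> filt (wW P) i setT f.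
Proof. by rewrite inE. Qed.

Lemma filtT0 f : (f \in smem (filtT 0)) <-> smoothM f.
Proof.
by rewrite filtTP filt0 //; exact: openT.
Qed.

Lemma filtT_le i j f : (i <= j)%N -> f \in smem (filtT j) ->
  f \in smem (filtT i).
Proof.
elim: j => [|j IHj]; first by rewrite leqn0 => /eqP ->.
rewrite leq_eqVlt => /predU1P[-> //|ij] /filtTP hf.
by apply: IHj => //; apply/filtTP/filt_decr => //; exact: openT.
Qed.

Lemma filtT_vanish i f : f \in smem (filtT i.+1) -> forall q, N q -> f q = 0.
Proof.
move=> /(@filtT_le 1 i.+1 _ isT)/filtTP/(wN_ideal _ openT) [_ h] q.
exact: h.
Qed.

Definition nuM (p : N) : lmodType R := nu smoothM N (val p).

Lemma Fnu_subproof j p : GRing.submod_closed [pred x : nuM p |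
  `[< forall f, f \in smem (filtT j.+1) -> conormal f x = 0 >]].
Proof.
have L f : f \in smem (filtT j.+1) -> forall a (x y : nuM p),
    conormal f (a *: x + y) = a * conormal f x + conormal f y.
  move=> hf; apply: conormal_linear; last exact: filtT_vanish hf.
  by apply/filtT0; apply: filtT_le hf.
split=> [|a x y]; rewrite !inE.
  move=> f /L /(_ (-1) 0 0).
  by rewrite scaler0 addr0 mulN1r addNr.
move=> hx hy f hf.
by rewrite L // hx // hy // mulr0 addr0.
Qed.

(** [F_{-j}]: the subbundle whose annihilator is the image in the conormal
    bundle of the functions of filtration degree [j + 1]. *)
Definition Fnu (j : nat) (p : N) : subspace (nuM p) :=
  Subspace (Fnu_subproof j p).

Definition smoothN (h : N -> R) := forall p : N, exists g U,
  [/\ smoothM g, open U, U (val p) & forall q : N, U (val q) -> h q = g (val q)].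

(** Smooth sections of quotient bundles are those which locally lift to smooth
    sections. *)
Definition nuM_sec (s : forall p, nuM p) := forall p : N,
  exists (U : set M) (t : forall q : N, sub_of (tangent smoothM (val q))),
    [/\ open U, U (val p),
        forall f, smoothM f -> smoothN (fun q => val (t q) f) &
        forall q, U (val q) -> cls _ (t q) = s q].

(** [F_{-i-1} / F_{-i}] *)
Definition grF (i : nat) (p : N) : lmodType R := subquo (Fnu i.+1 p) (Fnu i p).

Definition grF_sec i (s : forall p, grF i p) := forall p : N,
  exists (U : set M) (t : forall q : N, nuM q),
    [/\ open U, U (val p), nuM_sec t &
        forall q, U (val q) -> exists y : sub_of (Fnu i.+1 q),
          val y = t q /\ cls _ y = s q].

Definition gr_nu : gr_bundle N := @GrBundle N
  (fun p => dprod (fun i : 'I_r => grF i p))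
  [set s | forall i : 'I_r, grF_sec (fun p => s p i)]
  (fun k p => [set y | forall i : 'I_r, i.+1 != k -> y i = 0]).

(** The homogeneous component of degree [i] of [gr(C^oo(M))]. *)
Definition gr (i : nat) : lmodType R := subquo (filtT i) (filtT i.+1).

(** The class in [gr i] of a function of filtration degree [i]. *)
Definition symb (i : nat) (f : M -> R) : gr i := cls _ (insubd 0 f).

(** Algebra morphisms from the direct sum of the [gr i] to [R], given by their
    restrictions to the summands. *)
Record nuW := NuW {
  wchar : forall i, gr i -> R;
  wchar_linear : forall i a (x y : gr i),
    wchar (a *: x + y) = a * wchar x + wchar y;
  wchar_mul : forall i j f g, f \in smem (filtT i) -> g \in smem (filtT j) ->
    wchar (symb (i + j) (fun q => f q * g q)) =
    wchar (symb i f) * wchar (symb j g);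
  wchar_one : wchar (symb 0 (fun=> 1)) = 1 }.

(** The function on [nuW] defined by the class of [f] in [gr i]. *)
Definition homog (i : nat) (f : M -> R) (phi : nuW) : R := wchar phi (symb i f).

(** The manifold structure of [nuW] is the one generated by the [homog i f]:
    for weighted coordinates [x_a] on [M] of weights [w_a], the functions
    [homog w_a x_a] are local coordinates. *)
Definition smoothW (g : nuW -> R) := forall phi : nuW,
  exists (m : nat) (d : 'I_m -> nat) (f : 'I_m -> M -> R)
    (G : 'rV[R]_m -> R) (e : R),
    [/\ forall k, f k \in smem (filtT (d k)), smooth_euclid setT G, 0 < e &
        forall psi : nuW,
          (forall k, `|homog (d k) (f k) psi - homog (d k) (f k) phi| < e) ->
          g psi = G (\row_k homog (d k) (f k) psi)].

Section Kappa.
Context (t : R) (phi : nuW).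

Definition kappa_char i (x : gr i) : R := t ^+ i * wchar phi x.

Lemma kappa_linear i a (x y : gr i) :
  kappa_char (a *: x + y) = a * kappa_char x + kappa_char y.
Proof. by rewrite /kappa_char wchar_linear mulrDr !mulrA (mulrC a). Qed.

Lemma kappa_mul i j f g : f \in smem (filtT i) -> g \in smem (filtT j) ->
  kappa_char (symb (i + j) (fun q => f q * g q)) =
  kappa_char (symb i f) * kappa_char (symb j g).
Proof. by move=> hf hg; rewrite /kappa_char wchar_mul // exprD mulrACA. Qed.

Lemma kappa_one : kappa_char (symb 0 (fun=> 1)) = 1.
Proof. by rewrite /kappa_char wchar_one mul1r. Qed.

Definition kappa : nuW := NuW kappa_linear kappa_mul kappa_one.

End Kappa.

Section ZeroSection.
Context (p : N).

Definition zero_char i : gr i -> R :=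
  if i is 0 return gr i -> R then fun x => val (repr x) (val p) else fun=> 0.

Lemma zero_cls (x : sub_of (filtT 0)) : zero_char (cls _ x : gr 0) = val x (val p).
Proof.
have := repr_cls (restr (filtT 0) (filtT 1)) x.
move/filtT_vanish/(_ _ (set_valP p)); rewrite raddfB.
by move/eqP; rewrite subr_eq0 => /eqP.
Qed.

Lemma zero_linear i a (x y : gr i) :
  zero_char (a *: x + y) = a * zero_char x + zero_char y.
Proof.
case: i x y => [|i] x y; last by rewrite /= mulr0 addr0.
by rewrite -(cls_repr x) -(cls_repr y) -clsZD !zero_cls linearP.
Qed.

Lemma zero_symb f : f \in smem (filtT 0) -> zero_char (symb 0 f) = f (val p).
Proof. by move=> hf; rewrite zero_cls insubdK. Qed.

Lemma zero_mul i j f g : f \in smem (filtT i) -> g \in smem (filtT j) ->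
  zero_char (symb (i + j) (fun q => f q * g q)) =
  zero_char (symb i f) * zero_char (symb j g).
Proof.
case: i j => [|i] [|j] hf hg; try by rewrite /= ?mulr0 ?mul0r.
rewrite -[(0 + 0)%N]/0%N.
rewrite !zero_symb //; apply/filtTP.
apply: (@filt_mul _ _ _ (wW P) 0 setT f g openT); first by apply/filtT0.
exact/filtTP.
Qed.

Lemma zero_one : zero_char (symb 0 (fun=> 1)) = 1.
Proof. by rewrite zero_symb //; apply/filtT0; apply: smooth_on_cst. Qed.

(** The inclusion of [N] in [nuW] as [kappa 0 @` nuW]. *)
Definition zero_sec : nuW := NuW zero_linear zero_mul zero_one.

End ZeroSection.

Definition baseW : set nuW := range (kappa 0).

Definition nuE (p : N) : lmodType R := nu smoothW baseW (zero_sec p).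

Definition nuE_sec (s : forall p, nuE p) := forall p : N,
  exists (U : set M) (t : forall q : N, sub_of (tangent smoothW (zero_sec q))),
    [/\ open U, U (val p),
        forall g, smoothW g -> smoothN (fun q => val (t q) g) &
        forall q, U (val q) -> cls _ (t q) = s q].

Definition nuW_lin : gr_bundle N := @GrBundle N nuE nuE_sec
  (fun k p => [set x | forall t : R, nu_map (kappa t) x (t ^+ k *: x)]).

(** The linear form on [F_{-i-1} / F_{-i}] induced by [df|_N], for [f] of
    filtration degree [i + 1]. *)
Definition grF_pair i p (f : M -> R) (y : grF i p) : R :=
  conormal f (val (repr y)).

(** In every degree, the map is dual to sending [df|_N] to [d(f^[i+1])|_N], for
    [f] of filtration degree [i + 1]. *)
Definition canonical_map (Phi : forall p, gfib nuW_lin p -> gfib gr_nu p) :=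
  forall (p : N) (x : nuE p) (i : 'I_r) f, f \in smem (filtT i.+1) ->
    grF_pair f (Phi p x i) = conormal (homog i.+1 f) x.

End WeightedPair.
End Smooth.

Arguments matlas {R n} m.
Arguments wM {R n r} w.
Arguments wW {R n r} w.
Arguments wN {R n r} w.
Arguments smoothM {R n r} P.
Arguments smoothW {R n r} P.
Arguments gsec {R B} g.
Arguments gdeg {R B} g k b.

(* Main.v *)
Require Import Defs.
From HB Require Import structures.
From mathcomp Require Import all_boot all_order all_algebra.
From mathcomp Require Import all_classical all_reals all_analysis.
From mathcomp Require Import ring.

(** Both bundles are described by pairing with functions [f] of filtration
    degree [i]: a tangent vector of [M] in [F_{-i}] gives the linear form
    [f |-> df], and a tangent vector of the weighted normal bundle at a point of
    the zero section gives [f |-> d(f^[i])].  Either form is linear over smooth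
    functions evaluated at the point and kills products of functions of positive
    degrees, hence is determined by its values on the weighted coordinates of
    weight at least [i], and even of weight [i] since it kills functions of
    degree [i + 1].  All values on those coordinates occur: on [M] for the
    combinations of the partial derivatives, and on the weighted normal bundle
    for the velocities of the curves of characters
    [f |-> lim_(t -> 0) t^-i f (t . (e y))], where [t .] is the weighted
    dilation.  A vector of the weighted normal bundle all of whose forms vanish
    is tangent to the zero section, because a smooth function there is locally
    [G (f_1^[d_1], ..., f_m^[d_m])] with [G] smooth, and Hadamard's lemma gives
    the chain rule for derivations on such functions.  Smooth sections match
    since these correspondences are given by universal formulas in the values of
    the vectors on fixed functions. *)

Set Implicit Arguments.
Unset Strict Implicit.
Unset Printing Implicit Defensive.
Import Order.TTheory GRing.Theory Num.Theory.
Import numFieldNormedType.Exports.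
Local Open Scope classical_set_scope.
Local Open Scope ring_scope.

(** * Differential calculus on open subsets of Euclidean spaces *)

(** No charts of the weighted normal bundle are built: its points are arbitrary characters, of which
    only the zero section and the curves of [weighted_char] are ever evaluated, and its tangent
    vectors are algebraic derivations. A derivation can be applied to the quotients in Hadamard's
    lemma only if these are smooth, which is why differentiation under the integral sign and
    stability of [Ck] under composition come first. Weighted coordinates exist only on a chart,
    while [gr] consists of classes of global functions, so every coordinate is multiplied by a bump
    function and every argument takes place where that function equals 1. Degrees above [r] carry no
    linear form because no coordinate has weight above [r]. Degree 0 is subtler: the degree 0 terms
    in the chain rule are reassembled into one function on [M], which vanishes on [N] near the
    point; cut off, it has filtration degree 1, so its symbol of degree 0 is zero. The pairing of
    [grF i] with functions of degree [i.+1] is nondegenerate by the definition of [Fnu]; this gives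
    uniqueness of the map and makes the choices in its construction harmless. *)

Lemma cvg_sumr (R : realType) (T I : Type) (F : set_system T) (FF : Filter F)
    (r : seq I) (P : pred I) (f : I -> T -> R) (a : I -> R) :
  (forall i, P i -> f i x @[x --> F] --> a i) ->
  \sum_(i <- r | P i) f i x @[x --> F] --> \sum_(i <- r | P i) a i.
Proof. by move=> fa; apply: cvg_big fa; exact: add_continuous. Qed.

Lemma coord_le_norm (R : realType) m k (v : 'M[R]_(m, k)) i j : `|v i j| <= `|v|.
Proof.
rewrite [leRHS]/Num.Def.normr /= mx_normrE.
exact: (le_bigmax _ (fun i : 'I_m * 'I_k => `|v i.1 i.2|) (i, j)).
Qed.

Lemma norm_leP (R : realType) m k (v : 'M[R]_(m, k)) (e : R) : 0 <= e ->
  (forall i j, `|v i j| <= e) -> `|v| <= e.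
Proof.
move=> e0 h; rewrite [leLHS]/Num.Def.normr /= mx_normrE.
by apply: bigmax_le => // -[i j] _; exact: h.
Qed.

Section LinForm.
Context (R : realType) (n : nat) (c : 'I_n -> R).

Definition lin_form (v : 'rV[R]_n) : R := \sum_j v 0 j * c j.

Lemma lin_form_is_linear : linear lin_form.
Proof.
move=> a u v; rewrite /lin_form scaler_sumr -big_split /=; apply: eq_bigr => j _.
by rewrite !mxE mulrDl -mulrA.
Qed.

HB.instance Definition _ :=
  GRing.isLinear.Build R 'rV[R]_n R _ lin_form lin_form_is_linear.

Lemma lin_form_continuous : continuous lin_form.
Proof.
move=> v; apply: (@cvg_sumr _ _ _ (nbhs v)) => j _.
apply: (@cvgM _ _ (nbhs v) _ (fun w : 'rV[R]_n => w 0 j) (fun=> c j)); last exact: cvg_cst.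
exact: coord_continuous.
Qed.
End LinForm.

Lemma derive_line (R : numFieldType) (V W : normedModType R) (f : V -> W) x v :
  'D_v f x = 'D_1 (fun h : R => f (h *: v + x)) 0.
Proof.
rewrite /derive; set g1 := fun h => h^-1 *: _; set g2 := fun h => h^-1 *: _.
suff -> : g1 = g2 by [].
by rewrite funeqE /g1 /g2 => h /=; rewrite addr0 scale0r add0r [_%:A]mulr1.
Qed.

Section MVTline.
Context (R : realType) (n : nat).
Implicit Types (f : 'rV[R]_n -> R) (x v : 'rV[R]_n).

Lemma is_derive_line f x v (t : R) : derivable f (x + t *: v) v ->
  is_derive t (1 : R) (fun s : R => f (x + s *: v)) ('D_v f (x + t *: v)).
Proof.
move=> d; have E : (fun h : R => h^-1 *: (((fun s : R => f (x + s *: v)) \o shift t)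
     (h *: 1) - f (x + t *: v))) =
   (fun h : R => h^-1 *: ((f \o shift (x + t *: v)) (h *: v) - f (x + t *: v))).
  apply/funext => h /=; rewrite [h *: 1]mulr1 scalerDl.
  by congr (_ *: (f _ - _)); rewrite addrCA.
by split; rewrite /derivable /derive E.
Qed.

Lemma mvt_line f x v (t : R) :
  (forall s : R, `|s| <= `|t| -> derivable f (x + s *: v) v) ->
  exists2 s : R, `|s| <= `|t| & f (x + t *: v) - f x = t * 'D_v f (x + s *: v).
Proof.
move=> d; pose g (s : R) := f (x + s *: v); pose dg (s : R) : R := 'D_v f (x + s *: v).
have dgP (s : R) : `|s| <= `|t| -> is_derive s (1 : R) g (dg s).
  by move=> /d; exact: is_derive_line.
have -> : f x = g 0 by rewrite /g scale0r addr0.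
have cg (s : R) : `|s| <= `|t| -> {for s, continuous g}.
  move=> /dgP dgs; apply/differentiable_continuous/derivable1_diffP.
  exact: ex_derive.
have [t0|t0] := leP 0 t.
  have H s : s \in `[0, t] -> `|s| <= `|t|.
    by rewrite in_itv /= => /andP[s0 st]; rewrite !ger0_norm.
  have [||s sI E] := @MVT_segment R g dg 0 t t0.
  - by move=> s /subset_itv_oo_cc sI; exact/dgP/H.
  - by apply: continuous_in_subspaceT => s /set_mem sI; exact/cg/H.
  - by exists s; [exact: H|rewrite -[LHS]/(g t - g 0) E subr0 mulrC].
have H s : s \in `[t, 0] -> `|s| <= `|t|.
  by rewrite in_itv /= => /andP[st s0]; rewrite !ler0_norm ?lerN2// ltW.
have [||s sI E] := @MVT_segment R g dg t 0 (ltW t0).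
- by move=> s /subset_itv_oo_cc sI; exact/dgP/H.
- by apply: continuous_in_subspaceT => s /set_mem sI; exact/cg/H.
- by exists s; [exact: H|rewrite -[LHS]/(g t - g 0) -opprB E sub0r mulrN opprK mulrC].
Qed.
End MVTline.

Section Partials.
Context (R : realType) (n : nat).
Implicit Types (f : 'rV[R]_n -> R) (x v : 'rV[R]_n).

(* Telescoping along the coordinate directions and using the mean value theorem
   in each of them. *)
Lemma partials_estimate f x (e d : R) : 0 < e -> 0 < d ->
  (forall j z, `|z - x| < d -> derivable f z (delta_mx 0 j) /\
     `|'D_(delta_mx 0 j) f z - 'D_(delta_mx 0 j) f x| <= e) ->
  forall h, `|h| < d ->
  `|f (h + x) - f x - lin_form (fun j => 'D_(delta_mx 0 j) f x) h|
    <= n%:R * e * `|h|.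
Proof.
move=> e0 d0 H h hd.
pose p (k : nat) : 'rV[R]_n := \row_i (x 0 i + (i < k)%:R * h 0 i).
have p0 : p 0%N = x by apply/rowP => i; rewrite !mxE ltn0 mul0r addr0.
have pn : p n = h + x.
  by apply/rowP => i; rewrite !mxE ltn_ord mul1r addrC.
have pS (j : 'I_n) : p j.+1 = p j + h 0 j *: delta_mx 0 j.
  apply/rowP => i; rewrite !mxE /= ltnS leq_eqVlt -addrA; congr (_ + _).
  have [->|ij] := eqVneq i j; first by rewrite eqxx ltnn /= mul0r add0r mulr1 mul1r.
  by rewrite (_ : (i == j :> nat) = false) /= ?mulr0 ?addr0 //; apply/negbTE.
have step (j : 'I_n) : `|f (p j.+1) - f (p j) - h 0 j * 'D_(delta_mx 0 j) f x|
    <= e * `|h|.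
  (* The norm is the maximum of the coordinates, and each intermediate point differs from [x] by at
     most [|h|] in each of them. *)
  have near_x s : `|s| <= `|h 0 j| -> `|p j + s *: delta_mx 0 j - x| < d.
    move=> hs; apply: le_lt_trans hd; apply: norm_leP => // i' i.
    rewrite !mxE (ord1 i') /=.
    have [->|ij] := eqVneq i j.
      rewrite ltnn mul0r addr0 mulr1 addrAC subrr add0r.
      exact: le_trans hs (coord_le_norm _ _ _).
    rewrite mulr0 addr0 addrAC subrr add0r; case: ltnP => _.
      by rewrite mul1r; exact: coord_le_norm.
    by rewrite mul0r normr0.
  rewrite pS; have [|s hs ->] := @mvt_line R n f (p j) (delta_mx 0 j) (h 0 j).
    by move=> s /near_x /(H j) [].
  rewrite -mulrBr normrM mulrC; apply: ler_pM => //.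
    by have [_] := H j _ (near_x _ hs).
  exact: coord_le_norm.
have -> : f (h + x) - f x = \sum_(j < n) (f (p j.+1) - f (p j)).
  by rewrite -pn -[in f x]p0 -(telescope_sumr (fun k => f (p k)) (leq0n n)) big_mkord.
rewrite /lin_form -sumrB (le_trans (ler_norm_sum _ _ _)) //.
apply: le_trans (ler_sum _ (fun j _ => step j)) _.
by rewrite sumr_const card_ord -mulrA mulr_natl.
Qed.

Lemma partials_differentiable f x :
  (forall j, \forall z \near x, derivable f z (delta_mx 0 j)) ->
  (forall j, {for x, continuous (fun z => 'D_(delta_mx 0 j) f z)}) ->
  differentiable f x.
Proof.
move=> df cf.
apply/diffP => /=.
apply: (@getPex _ (fun (df : {linear 'rV[R]_n -> R}) => continuous df /\
  forall y, f y = f (lim (nbhs x)) + df (y - lim (nbhs x))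
                  +o_(y \near x) (y - lim (nbhs x)))).
exists (lin_form (fun j => 'D_(delta_mx 0 j) f x) : {linear 'rV[R]_n -> R}).
split.
  exact: lin_form_continuous.
rewrite lim_id //.
suff E : f = (fun y => f x + lin_form (fun j => 'D_(delta_mx 0 j) f x) (y - x))
    +o_x (fun y => y - x).
  by move=> y; rewrite {1}E.
apply/eqaddoP => _/posnumP[e].
(* [partials_estimate] loses a factor [n]; dividing by [n.+1] compensates it and stays meaningful
   for [n = 0]. *)
pose e' := e%:num / n.+1%:R.
have e'0 : 0 < e' by rewrite divr_gt0.
have [d /= d0 Hd] : exists2 d : R, 0 < d & forall z, `|z - x| < d ->
    forall j : 'I_n, derivable f z (delta_mx 0 j) /\
     `|'D_(delta_mx 0 j) f z - 'D_(delta_mx 0 j) f x| <= e'.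
  have : \forall z \near x, forall j : 'I_n, derivable f z (delta_mx 0 j) /\
     `|'D_(delta_mx 0 j) f z - 'D_(delta_mx 0 j) f x| <= e'.
    apply: (@filter_forall _ 'I_n (fun j z => derivable f z (delta_mx 0 j) /\
      `|'D_(delta_mx 0 j) f z - 'D_(delta_mx 0 j) f x| <= e') (nbhs x)) => j.
    apply: filterI; first exact: df.
    have /cvgrPdist_le/(_ _ e'0) := cf j.
    by apply: filterS => z; rewrite distrC.
  move=> /nbhs_ballP[d d0 H]; exists d => // z zx.
  by apply: (H z); rewrite -ball_normE /= distrC.
near=> y.
have yd : `|y - x| < d.
  by rewrite distrC; near: y; apply: cvgr_dist_lt => //; exact: cvg_id.
have := partials_estimate e'0 d0 (fun j z h => Hd z h j) yd.
rewrite subrK => /le_trans h.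
rewrite [X in `|X|](_ : _ = f y - f x -
    lin_form (fun j => 'D_(delta_mx 0 j) f x) (y - x)); last first.
  by rewrite -addrA -opprD.
apply: h; rewrite ler_wpM2r // /e' mulrCA ger_pMr //.
by rewrite ler_pdivrMr // mul1r ler_nat.
Unshelve. all: by end_near. Qed.

Lemma derive_partials f x v : differentiable f x ->
  'D_v f x = \sum_j v 0 j * 'D_(delta_mx 0 j) f x.
Proof.
move=> df; rewrite deriveE // {1}(row_sum_delta v) linear_sum.
by apply: eq_bigr => j _; rewrite linearZ /= deriveE.
Qed.

End Partials.

Lemma near_eq_continuous (T U : topologicalType) (f g : T -> U) (y : T) :
  (\near y, f y = g y) -> {for y, continuous f} -> {for y, continuous g}.
Proof.
move=> fg cf; rewrite /prop_for /continuous_at -(nbhs_singleton fg).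
by apply: cvg_trans cf; apply: near_eq_cvg; apply: filterS fg => z ->.
Qed.

Section CkTheory.
Context (R : realType) (n : nat).
Implicit Types (U V : set 'rV[R]_n) (f g : 'rV[R]_n -> R).

Lemma Ck_cont k U f : Ck k U f -> forall y, U y -> {for y, continuous f}.
Proof. by case: k => [|k] []. Qed.

Lemma Ck_sub k U V f : V `<=` U -> Ck k U f -> Ck k V f.
Proof.
move=> VU; elim: k f => [|k IHk] f [cf]; first by move=> _; split=> // y /VU/cf.
move=> df; split=> [y /VU/cf //|j]; have [dfj Cj] := df j.
by split=> [y /VU/dfj //|]; exact: IHk.
Qed.

Lemma CkW k U f : Ck k.+1 U f -> Ck k U f.
Proof.
elim: k f => [|k IHk] f [cf df]; first by split.
by split=> // j; have [dfj Cj] := df j; split=> //; exact: IHk.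
Qed.

Lemma near_open U f g : open U -> (forall y, U y -> f y = g y) ->
  forall y, U y -> \near y, f y = g y.
Proof. by move=> oU fg y Uy; apply: filterS (open_nbhs_nbhs (conj oU Uy)). Qed.

Lemma Ck_ext k U f g : open U -> (forall y, U y -> f y = g y) ->
  Ck k U f -> Ck k U g.
Proof.
move=> oU; elim: k f g => [|k IHk] f g fg [cf df].
  split=> // y Uy; have fgy := near_open oU fg Uy.
  exact: near_eq_continuous fgy (cf y Uy).
split=> [y Uy|j].
  have fgy := near_open oU fg Uy.
  exact: near_eq_continuous fgy (cf y Uy).
have [dfj Cj] := df j; split.
  move=> y Uy; exact: near_eq_derivable (near_open oU fg Uy) (dfj y Uy).
apply: IHk Cj => y Uy; exact: near_eq_derive (near_open oU fg Uy).
Qed.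

Lemma CkD k U f g : open U -> Ck k U f -> Ck k U g -> Ck k U (fun y => f y + g y).
Proof.
move=> oU; elim: k f g => [|k IHk] f g [cf df] [cg dg]; split=> //.
- by move=> y Uy; apply: continuousD; [exact: cf|exact: cg].
- by move=> y Uy; apply: continuousD; [exact: cf|exact: cg].
move=> j; have [dfj Cfj] := df j; have [dgj Cgj] := dg j; split.
  by move=> y Uy; apply: derivableD; [exact: dfj|exact: dgj].
apply: Ck_ext (IHk _ _ Cfj Cgj) => // y Uy.
by rewrite -deriveD //; [exact: dfj|exact: dgj].
Qed.

Lemma CkM k U f g : open U -> Ck k U f -> Ck k U g -> Ck k U (fun y => f y * g y).
Proof.
move=> oU; elim: k f g => [|k IHk] f g [cf df] [cg dg]; split=> //.
- by move=> y Uy; apply: continuousM; [exact: cf|exact: cg].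
- by move=> y Uy; apply: continuousM; [exact: cf|exact: cg].
move=> j; have [dfj Cfj] := df j; have [dgj Cgj] := dg j; split.
  by move=> y Uy; apply: derivableM; [exact: dfj|exact: dgj].
have Cf : Ck k U f by apply: CkW; split.
have Cg : Ck k U g by apply: CkW; split.
apply: Ck_ext (CkD oU (IHk _ _ Cf Cgj) (IHk _ _ Cg Cfj)) => // y Uy.
by rewrite -deriveM //; [exact: dfj|exact: dgj].
Qed.

Lemma Ck_sum k U I (r : seq I) (P : pred I) (F : I -> 'rV[R]_n -> R) : open U ->
  (forall i, P i -> Ck k U (F i)) -> Ck k U (fun y => \sum_(i <- r | P i) F i y).
Proof.
move=> oU CF; elim: r => [|i r IHr].
  by apply: Ck_ext (Ck_cst k U 0) => // y _; rewrite big_nil.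
case: (boolP (P i)) => Pi.
  by apply: Ck_ext (CkD oU (CF i Pi) IHr) => // y _; rewrite big_cons Pi.
by apply: Ck_ext IHr => // y _; rewrite big_cons (negbTE Pi).
Qed.

(** The derivative of [1/f] is a polynomial in [1/f] and the derivative of [f], so the induction on
    [k] closes. *)
Lemma Ck_inv k U f : open U -> (forall y, U y -> f y != 0) -> Ck k U f ->
  Ck k U (fun y => (f y)^-1).
Proof.
move=> oU f0; elim: k => [|k IHk] [cf df].
  by split=> // y Uy; apply: continuousV; [exact: f0|exact: cf].
split=> [y Uy|j]; first by apply: continuousV; [exact: f0|exact: cf].
have [dfj Cfj] := df j; split.
  by move=> y Uy; apply: derivableV; [exact: f0|exact: dfj].
have Cf : Ck k U (fun y => (f y)^-1) by apply: IHk; apply: CkW; split.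
apply: (@Ck_ext k U (fun y => -1 * ((f y)^-1 * (f y)^-1) * 'D_(delta_mx 0 j) f y)) => //.
  move=> y Uy; rewrite deriveV; [|exact: f0|exact: dfj].
  by rewrite mulN1r -invfM -expr2.
by do !apply: CkM => //; exact: Ck_cst.
Qed.

Lemma derivable_coord (j : 'I_n) y v : derivable (fun y : 'rV[R]_n => y 0 j) y v.
Proof. exact/diff_derivable/differentiable_coord. Qed.

Lemma derive_coord (j : 'I_n) y v : 'D_v (fun y : 'rV[R]_n => y 0 j) y = v 0 j.
Proof.
have := @derive_mx R _ 1 n id y v (@derivable_id _ _ y v).
by rewrite derive_id => /matrixP/(_ 0 j); rewrite mxE.
Qed.

Lemma Ck_coord k U (j : 'I_n) : Ck k U (fun y => y 0 j).
Proof.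
case: k => [|k]; first by split=> // y _; exact: coord_continuous.
split=> [y _|i]; first exact: coord_continuous.
split=> [y _|]; first exact: derivable_coord.
rewrite (_ : (fun y => _) = fun=> (delta_mx 0 i : 'rV[R]_n) 0 j).
  exact: Ck_cst.
by apply/funext => y; rewrite derive_coord.
Qed.

Lemma Ck1_differentiable U f : open U -> Ck 1 U f ->
  forall y, U y -> differentiable f y.
Proof.
move=> oU [cf df] y Uy; apply: partials_differentiable => j.
  apply: filterS (open_nbhs_nbhs (conj oU Uy)).
  by have [dfj _] := df j.
by have [_ [cj _]] := df j; exact: cj.
Qed.

End CkTheory.

Section Composition.
Context (R : realType) (m n : nat).
Implicit Types (U : set 'rV[R]_n) (V : set 'rV[R]_m).

Lemma row_continuous (T : topologicalType) (g : 'I_m -> T -> R) (y : T) :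
  (forall j, {for y, continuous (g j)}) ->
  {for y, continuous (fun z => \row_j g j z : 'rV[R]_m)}.
Proof.
move=> cg; apply/cvgrPdist_le => e e0; near=> z.
apply: norm_leP => [|i j]; first exact: ltW.
rewrite !mxE; move: j; near: z.
apply: (@filter_forall _ 'I_m (fun j z => `|g j y - g j z| <= e) (nbhs y)).
by move=> j; have /cvgrPdist_le := cg j; exact.
Unshelve. all: by end_near. Qed.

(** Restriction to the line through [y] along [v] turns the inner map into a curve, to which
    composition of differentials applies. [W] is general because the inner functions live on a
    Euclidean space in [Ck_comp] and on [R] for curves of characters. *)
Lemma derive_comp_row (W : normedModType R) (f : 'rV[R]_m -> R)
    (g : 'I_m -> W -> R) (y v : W) :
  differentiable f (\row_j g j y) -> (forall j, derivable (g j) y v) ->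
  is_derive y v (fun z => f (\row_j g j z))
    (\sum_j 'D_v (g j) y * 'D_(delta_mx 0 j) f (\row_j g j y)).
Proof.
move=> df dg; set h := fun s : R => \row_j g j (s *: v + y) : 'rV[R]_m.
have h0 : h 0 = \row_j g j y.
  by apply/rowP => j; rewrite !mxE scale0r add0r.
have dh : derivable h 0 1.
  apply/derivable_mxP => i j.
  rewrite (_ : (fun x => _) = fun s : R => g j (s *: v + y)).
    exact: (derivable1P (g j) y v).1 (dg j).
  by apply/funext => s; rewrite mxE.
have dh1 : 'D_1 h 0 = \row_j 'D_v (g j) y.
  rewrite derive_mx //; apply/rowP => j; rewrite !mxE.
  rewrite (_ : (fun t => _) = fun s : R => g j (s *: v + y)); last first.
    by apply/funext => s; rewrite mxE.
  by rewrite -derive_line.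
have dfh : differentiable (f \o h) 0.
  by apply: differentiable_comp; [exact/derivable1_diffP|rewrite h0].
have dD : derivable (fun z => f (\row_j g j z)) y v.
  apply: (derivable1P (fun z => f (\row_j g j z)) y v).2.
  exact/derivable1_diffP.
apply: DeriveDef => //.
rewrite derive_line -[fun _ => _]/(f \o h).
rewrite deriveE // diff_comp; [|exact/derivable1_diffP|by rewrite h0].
rewrite /= -(@deriveE _ _ _ h); last exact/derivable1_diffP.
rewrite dh1 h0 -deriveE // derive_partials //.
by apply: eq_bigr => j _; rewrite mxE.
Qed.

(** By the chain rule the partial derivatives are sums of products of a derivative of some [g j]
    with a composition of the same kind, one order lower. *)
Lemma Ck_comp k U V (f : 'rV[R]_m -> R) (g : 'I_m -> 'rV[R]_n -> R) :
  open U -> open V -> (forall y, U y -> V (\row_j g j y)) ->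
  Ck k V f -> (forall j, Ck k U (g j)) -> Ck k U (fun y => f (\row_j g j y)).
Proof.
move=> oU oV UV; elim: k f g UV => [|k IHk] f g UV Cf Cg.
  split=> // y Uy; apply: (@continuous_comp _ _ _ (fun y => \row_j g j y) f).
    by apply: row_continuous => j; exact: Ck_cont (Cg j) _ Uy.
  exact: Ck_cont Cf _ (UV _ Uy).
split=> [y Uy|i].
  apply: (@continuous_comp _ _ _ (fun y => \row_j g j y) f).
    by apply: row_continuous => j; exact: Ck_cont (Cg j) _ Uy.
  exact: Ck_cont Cf _ (UV _ Uy).
have Cf1 : Ck 1 V f.
  by case: Cf => cf df; split=> // j; have [? /Ck_cont c] := df j; split.
have dfg y : U y -> is_derive y (delta_mx 0 i) (fun z => f (\row_j g j z))
    (\sum_j 'D_(delta_mx 0 i) (g j) y * 'D_(delta_mx 0 j) f (\row_j g j y)).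
  move=> Uy; apply: derive_comp_row.
    exact: Ck1_differentiable Cf1 _ (UV _ Uy).
  by move=> j; case: (Cg j) => _ /(_ i)[+ _]; exact.
split=> [y Uy|]; first by have := dfg y Uy => -[].
apply: (@Ck_ext _ _ k U (fun y =>
   \sum_j 'D_(delta_mx 0 i) (g j) y * 'D_(delta_mx 0 j) f (\row_j g j y))) => //.
  by move=> y Uy; have := dfg y Uy => /@derive_val ->.
apply: Ck_sum => // j _; apply: CkM => //.
  by case: (Cg j) => _ /(_ i)[_].
apply: (IHk (fun y => 'D_(delta_mx 0 j) f y) g UV) => [|j'].
  by case: Cf => _ /(_ j)[_].
exact/CkW/Cg.
Qed.

End Composition.

Section SmoothEuclid.
Context (R : realType) (n : nat).
Implicit Types (U V : set 'rV[R]_n) (f g : 'rV[R]_n -> R).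

Lemma smooth_euclid_ext U f g : open U -> (forall y, U y -> f y = g y) ->
  smooth_euclid U f -> smooth_euclid U g.
Proof. by move=> oU fg Cf k; apply: Ck_ext (Cf k). Qed.

Lemma smooth_euclid_sub U V f : V `<=` U -> smooth_euclid U f -> smooth_euclid V f.
Proof. by move=> VU Cf k; apply: Ck_sub (Cf k). Qed.

Lemma smooth_euclid_cst U a : smooth_euclid U (fun=> a).
Proof. by move=> k; exact: Ck_cst. Qed.

Lemma smooth_euclid_coord U j : smooth_euclid U (fun y => y 0 j).
Proof. by move=> k; exact: Ck_coord. Qed.

Lemma smooth_euclidD U f g : open U -> smooth_euclid U f -> smooth_euclid U g ->
  smooth_euclid U (fun y => f y + g y).
Proof. by move=> oU Cf Cg k; exact: CkD. Qed.

Lemma smooth_euclidM U f g : open U -> smooth_euclid U f -> smooth_euclid U g ->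
  smooth_euclid U (fun y => f y * g y).
Proof. by move=> oU Cf Cg k; exact: CkM. Qed.

Lemma smooth_euclid_sum U I (r : seq I) (P : pred I) (F : I -> 'rV[R]_n -> R) :
  open U -> (forall i, P i -> smooth_euclid U (F i)) ->
  smooth_euclid U (fun y => \sum_(i <- r | P i) F i y).
Proof. by move=> oU CF k; apply: Ck_sum => // i /CF. Qed.

Lemma smooth_euclid_inv U f : open U -> (forall y, U y -> f y != 0) ->
  smooth_euclid U f -> smooth_euclid U (fun y => (f y)^-1).
Proof. by move=> oU f0 Cf k; exact: Ck_inv. Qed.

Lemma smooth_euclid_derive U f j : smooth_euclid U f ->
  smooth_euclid U (fun y => 'D_(delta_mx 0 j) f y).
Proof. by move=> Cf k; have [_ /(_ j)[]] := Cf k.+1. Qed.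

Lemma smooth_euclid_derivable U f j y : smooth_euclid U f -> U y ->
  derivable f y (delta_mx 0 j).
Proof. by move=> /(_ 1%N)[_ /(_ j)[+ _]]; exact. Qed.

Lemma smooth_euclid_cont U f y : smooth_euclid U f -> U y -> {for y, continuous f}.
Proof. by move=> /(_ 0%N)[+ _]; exact. Qed.

Lemma smooth_euclid_differentiable U f y : open U -> smooth_euclid U f -> U y ->
  differentiable f y.
Proof. by move=> oU /(_ 1%N) Cf; exact: Ck1_differentiable. Qed.

Lemma smooth_euclid_comp m U (V : set 'rV[R]_m) (f : 'rV[R]_m -> R)
    (g : 'I_m -> 'rV[R]_n -> R) :
  open U -> open V -> (forall y, U y -> V (\row_j g j y)) ->
  smooth_euclid V f -> (forall j, smooth_euclid U (g j)) ->
  smooth_euclid U (fun y => f (\row_j g j y)).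
Proof. by move=> oU oV UV Cf Cg k; apply: Ck_comp oV UV (Cf k) _ => // j; exact: Cg. Qed.

End SmoothEuclid.

(** * The flat functions built from exp(-1/x) *)

Section Flat.
Context (R : realType).
Implicit Types x : R.

(** The factor [x ^- m] makes the family stable under differentiation: the derivative of [flat m] is
    [flat m.+2 - m * flat m.+1], so all members are smooth by one induction. *)
Definition flat (m : nat) x : R :=
  if 0 < x then x ^- m * expR (- x^-1) else 0.

Lemma flat_gt0 m x : 0 < x -> 0 < flat m x.
Proof. by move=> x0; rewrite /flat x0 mulr_gt0 ?expR_gt0 // invr_gt0 exprn_gt0. Qed.

Lemma flat_eq0 m x : x <= 0 -> flat m x = 0.
Proof. by rewrite /flat ltNge => ->. Qed.

Lemma flat_ge0 m x : 0 <= flat m x.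
Proof. by case: (lerP x 0) => [/flat_eq0 -> //|/flat_gt0 /ltW]. Qed.

(** The exponential at [1/x] dominates the term of degree [m.+2] of its series. The resulting
    quadratic bound makes the difference quotient at 0 tend to 0. *)
Lemma flat_le m x : flat m x <= (m.+2)`!%:R * x ^+ 2.
Proof.
have [x0|x0] := lerP x 0.
  by rewrite flat_eq0 // mulr_ge0 // sqr_ge0.
rewrite /flat x0 expRN.
have ix : 0 <= x^-1 by rewrite invr_ge0 ltW.
have h := expR_ge1Dxn m.+1 ix.
have h' : x^-1 ^+ m.+2 / m.+2`!%:R <= expR x^-1.
  by apply: le_trans h; rewrite lerDr.
have f0 : 0 < m.+2`!%:R :> R by rewrite ltr0n fact_gt0.
rewrite ler_pdivrMr ?expR_gt0 //.
have -> : x ^- m = m.+2`!%:R * x ^+ 2 * (x^-1 ^+ m.+2 / m.+2`!%:R).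
  have xn0 : x != 0 by rewrite gt_eqF.
  rewrite [_ * x ^+ 2]mulrC -mulrA [m.+2`!%:R * _]mulrC divfK ?gt_eqF //.
  by rewrite -(addn2 m) exprD mulrCA -exprMn mulfV // expr1n mulr1 exprVn.
by rewrite ler_wpM2l // mulr_ge0 ?sqr_ge0.
Qed.

Lemma flat_is_derive m x :
  is_derive x 1 (flat m) (flat m.+2 x - m%:R * flat m.+1 x).
Proof.
have [x0|x0|->] := ltgtP x 0.
- rewrite !flat_eq0 ?(ltW x0) // mulr0 subr0.
  apply: (@near_eq_is_derive R R R (cst 0) (flat m) x 1 0).
  by near=> z; rewrite /cst flat_eq0 // ltW //; near: z; exact: lt_nbhsl.
- pose g (z : R) := z ^- m * expR (- z^-1).
  have xn0 : x != 0 by rewrite gt_eqF.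
  apply: (@near_eq_is_derive R R R g).
    near=> z; rewrite /g /flat; case: ifP => // /negP[].
    by near: z; exact: lt_nbhsr.
  have d1 : is_derive x 1 (fun z : R => z^-1) (- x ^- 2).
    apply: DeriveDef; first exact: (@derivableV _ _ id).
    by rewrite (@deriveV _ _ id) // derive_id [_ *: 1]mulr1.
  have d2 : is_derive x 1 (fun z : R => z ^- m) (- m%:R * x ^- m.+1).
    have dX : derivable (fun z : R => z ^+ m) x 1 by exact: exprn_derivable.
    apply: DeriveDef; first by apply: derivableV => //; rewrite expf_neq0.
    rewrite deriveV ?expf_neq0 // exp_derive [_ *: 1]mulr1 /=.
    case: (m) => [|k]; first by rewrite scale0r scaler0 oppr0 mul0r.
    rewrite scaleNr mulNr; congr (- _); rewrite -![_ *: _]/(_ * _) mulrCA.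
    congr (_ * _); rewrite /= -exprM (_ : k.+1 * 2 = k + k.+2)%N; last first.
      by rewrite muln2 -addnn addSn !addnS.
    by rewrite exprD invfM mulrAC mulVf ?mul1r // expf_neq0.
  have d3 : is_derive x 1 (fun z : R => expR (- z^-1)) (x ^- 2 * expR (- x^-1)).
    have d4 : is_derive x 1 (fun z : R => - z^-1) (x ^- 2).
      by rewrite -[x ^- 2]opprK; exact: is_deriveN.
    have := @is_derive1_comp _ expR (fun z : R => - z^-1) x _ _ _ d4.
    move=> /(_ _ (is_derive_expR _)) h.
    by apply: is_derive_eq; rewrite mulrC.
  refine (is_derive_eq (is_deriveM d2 d3) _).
  rewrite /flat x0 -![_ *: _]/(_ * _) mulrA -invfM -exprD addn2; congr (_ + _).
  by rewrite mulrC !mulNr mulrA.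
- rewrite !flat_eq0 // mulr0 subr0.
  have C0 : 0 < (m.+2)`!%:R :> R by rewrite ltr0n fact_gt0.
  have L : (fun h => h^-1 *: ((flat m \o shift 0) (h *: 1) - flat m 0)) @ 0^' --> (0 : R).
    apply/cvgrPdist_le => e e0; near=> h.
    rewrite /= (flat_eq0 m (lexx 0)) subr0 addr0 sub0r normrN [h *: 1]mulr1.
    rewrite normrM normfV ger0_norm ?flat_ge0 //.
    have h0 : 0 < `|h| by rewrite normr_gt0; near: h; exact: nbhs_dnbhs_neq.
    rewrite ler_pdivrMl // (le_trans (flat_le _ _)) //.
    rewrite -[h ^+ 2]real_normK ?num_real // expr2 mulrA mulrC ler_pM2l //.
    rewrite -ler_pdivlMl //.
    near: h; apply: nbhs_dnbhs; apply/nbhs_ballP.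
    exists ((m.+2)`!%:R^-1 * e); first by rewrite /= mulr_gt0 // invr_gt0.
    by move=> z; rewrite -ball_normE /= sub0r normrN => /ltW.
  by apply: DeriveDef; [apply/cvg_ex; exists 0|exact/cvg_lim].
Unshelve. all: by end_near. Qed.

Lemma flat_smooth m : smooth_euclid [set: 'rV[R]_1] (fun y => flat m (y 0 0)).
Proof.
move=> k; elim: k m => [|k IHk] m.
  split=> // y _; apply: (@continuous_comp _ _ _ (fun y : 'rV[R]_1 => y 0 0) (flat m)).
    exact: coord_continuous.
  apply/differentiable_continuous/derivable1_diffP.
  by have := flat_is_derive m (y 0 0) => -[].
have dflat (y : 'rV[R]_1) : differentiable (fun y : 'rV[R]_1 => flat m (y 0 0)) y.
  apply: (@differentiable_comp _ _ _ _ (fun y : 'rV[R]_1 => y 0 0) (flat m)).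
    exact: differentiable_coord.
  apply/derivable1_diffP.
  by have := flat_is_derive m (y 0 0) => -[].
split=> [y _|j]; first exact: differentiable_continuous.
split=> [y _|]; first exact: diff_derivable.
apply: (@Ck_ext _ _ k _ (fun y => flat m.+2 (y 0 0) + - m%:R * flat m.+1 (y 0 0))).
- exact: openT.
- move=> y _; apply/esym.
  rewrite deriveE // (@diff_comp _ _ _ _ (fun y : 'rV[R]_1 => y 0 0) (flat m)).
  + rewrite /= -(@deriveE _ _ _ (fun y : 'rV[R]_1 => y 0 0)); last exact: differentiable_coord.
    have d := flat_is_derive m (y 0 0).
    rewrite derive_coord (ord1 j) !mxE -deriveE ?derive_val ?mulNr //.
    by apply/derivable1_diffP; case: d.
  + exact: differentiable_coord.
  + by apply/derivable1_diffP; have := flat_is_derive m (y 0 0) => -[].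
- apply: CkD; [exact: openT|exact: IHk|].
  by apply: CkM; [exact: openT|exact: Ck_cst|exact: IHk].
Qed.

End Flat.

(** * Bump functions and the Hadamard lemma *)

Section Bump.
Context (R : realType) (n : nat).

(** The bump is [A / (A + B)] for two flat functions of the squared distance to [z]. *)
Lemma bump_euclid (z : 'rV[R]_n) (d : R) : 0 < d -> exists b : 'rV[R]_n -> R,
  [/\ smooth_euclid setT b, \forall y \near z, b y = 1 &
      forall y, b y != 0 -> `|y - z| <= d].
Proof.
(* The squared Euclidean distance is smooth, unlike the maximum norm, and bounds the square of each
   coordinate of [y - z]. *)
move=> d0; pose rho (y : 'rV[R]_n) : R := \sum_(a < n) (y 0 a - z 0 a) * (y 0 a - z 0 a).
have smooth_rho : smooth_euclid setT rho.
  apply: smooth_euclid_sum => [|a _]; first exact: openT.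
  by apply: smooth_euclidM; do ?[exact: openT|apply: smooth_euclidD];
    [exact: smooth_euclid_coord|exact: smooth_euclid_cst|
     exact: smooth_euclid_coord|exact: smooth_euclid_cst].
have smooth_flat (h : 'rV[R]_n -> R) : smooth_euclid setT h ->
    smooth_euclid setT (fun y => flat 0 (h y)).
  move=> sh; apply: (@smooth_euclid_ext _ _ _ (fun y => (fun x : 'rV[R]_1 =>
      flat 0 (x 0 0)) (\row_j h y))); first exact: openT.
    by move=> y _; rewrite mxE.
  exact: (smooth_euclid_comp (g := fun _ : 'I_1 => h) openT openT (fun _ _ => I)
    (@flat_smooth R 0)).
have d2 : 0 < d ^+ 2 by rewrite exprn_gt0.
(* [A] vanishes exactly for [rho >= d^2] and [B] exactly for [rho <= d^2 / 4]. As [d^2 / 4 < d^2]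
   they never vanish together, and the quotient is 1 wherever [B] is 0. *)
pose A y := flat 0 (d ^+ 2 - rho y); pose B y := flat 0 (rho y - d ^+ 2 / 4).
have sA : smooth_euclid setT A.
  apply: smooth_flat; apply: (@smooth_euclid_ext _ _ _ (fun y => d ^+ 2 + -1 * rho y)).
  - exact: openT.
  - by move=> y _; rewrite mulN1r.
  apply: smooth_euclidD; [exact: openT|exact: smooth_euclid_cst|].
  by apply: smooth_euclidM; [exact: openT|exact: smooth_euclid_cst|].
have sB : smooth_euclid setT B.
  apply: smooth_flat; apply: smooth_euclidD => //; first exact: openT.
  exact: smooth_euclid_cst.
have AB0 y : 0 < A y + B y.
  have [h|h] := ltP (rho y) (d ^+ 2).
    by apply: ltr_pwDl; [apply: flat_gt0; rewrite subr_gt0|exact: flat_ge0].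
  apply: ltr_wpDl; [exact: flat_ge0|apply: flat_gt0; rewrite subr_gt0].
  by apply: lt_le_trans h; rewrite ltr_pdivrMr // ltr_pMr // ltr1n.
exists (fun y => A y * (A y + B y)^-1); split.
- apply: smooth_euclidM => //; first exact: openT.
  apply: smooth_euclid_inv; first exact: openT.
    by move=> y _; rewrite gt_eqF.
  by apply: smooth_euclidD => //; exact: openT.
- have cr : {for z, continuous rho} := smooth_euclid_cont smooth_rho I.
  have rz : rho z = 0 by rewrite /rho big1 // => a _; rewrite subrr mul0r.
  near=> y.
  suff B0 : B y = 0.
    by have := AB0 y; rewrite B0 addr0 => A0; rewrite mulfV // gt_eqF.
  apply: flat_eq0; rewrite subr_le0 ltW //.
  near: y; apply: (cvgr_lt (rho z)) => //.
  by rewrite rz divr_gt0.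
- move=> y; rewrite mulf_eq0 negb_or => /andP[Ay _].
  have ry : rho y < d ^+ 2.
    by rewrite ltNge; apply: contraNN Ay => h; rewrite /A flat_eq0 // subr_le0.
  apply: norm_leP => [|i j]; first exact: ltW.
  rewrite (ord1 i) !mxE -(@ler_pXn2r _ 2) ?nnegrE ?(ltW d0) //.
  rewrite real_normK ?num_real // (le_trans _ (ltW ry)) // /rho.
  rewrite (bigD1 j) //= -expr2 lerDl sumr_ge0 // => a _.
  by rewrite -expr2 sqr_ge0.
Unshelve. all: by end_near. Qed.

End Bump.

(** * Averages over the unit interval *)

Section UnitIntegral.
Context (R : realType).
Implicit Types (h : R -> R).

Local Notation mu := (@lebesgue_measure R).
Local Notation I01 := (`[0, 1]%classic : set R).

Definition avg h : R := (\int[mu]_(t in `[0, 1]) h t)%R.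

Lemma integrable01 h : continuous h -> mu.-integrable I01 (EFin \o h).
Proof.
move=> ch; apply: continuous_compact_integrable; first exact: segment_compact.
exact: continuous_subspaceT.
Qed.

Lemma measurable01 : measurable I01.
Proof. exact: measurable_itv. Qed.

Lemma avg_cst a : avg (fun=> a) = a.
Proof.
rewrite /avg Rintegral_cst; last exact: measurable01.
rewrite [X in fine X](_ : _ = 1%E) ?mulr1 //.
by apply: etrans (lebesgue_measure_itv `[0, 1]) _; rewrite /= lte_fin ltr01 oppr0 adde0.
Qed.

Lemma avgD h k : continuous h -> continuous k ->
  avg (fun t => h t + k t) = avg h + avg k.
Proof. by move=> ch ck; apply: RintegralD; [exact: measurable01|exact: integrable01..]. Qed.

Lemma avgB h k : continuous h -> continuous k ->
  avg (fun t => h t - k t) = avg h - avg k.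
Proof. by move=> ch ck; apply: RintegralB; [exact: measurable01|exact: integrable01..]. Qed.

Lemma avgZ a h : continuous h -> avg (fun t => a * h t) = a * avg h.
Proof. by move=> ch; apply: RintegralZl; [exact: measurable01|exact: integrable01]. Qed.

Lemma avg_sum m (H : 'I_m -> R -> R) : (forall j, continuous (H j)) ->
  avg (fun t => \sum_j H j t) = \sum_j avg (H j).
Proof.
elim: m H => [|m IHm] H cH.
  rewrite big_ord0 -[RHS](avg_cst 0); congr avg.
  by apply/funext => t; rewrite big_ord0.
rewrite big_ord_recl -IHm; last by move=> j; exact: cH.
rewrite -avgD; first by congr avg; apply/funext => t; rewrite big_ord_recl.
  exact: cH.
by move=> t; apply: (@cvg_sumr _ _ _ (nbhs t)) => j _; exact: cH.
Qed.

Lemma norm_avg_le h e : continuous h -> (forall t, 0 <= t <= 1 -> `|h t| <= e) ->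
  `|avg h| <= e.
Proof.
move=> ch he; have := @le_normr_Rintegral _ (measurableTypeR R) R mu I01 h
  measurable01 (integrable01 ch).
move=> /le_trans; apply; rewrite -[leRHS]avg_cst; apply: le_Rintegral.
- exact: measurable01.
- by apply: integrable01 => t; apply: cvg_norm; exact: ch.
- by apply: integrable01 => t; exact: cvg_cst.
- by move=> t; rewrite /= in_itv => /he.
Qed.

Lemma avg_derive (F f : R -> R) : continuous f ->
  (forall t : R, is_derive t 1 F (f t)) -> avg f = F 1 - F 0.
Proof.
move=> cf dF; rewrite /avg /Rintegral (@continuous_FTC2 R f F 0 1) //.
- exact: continuous_subspaceT.
- have cF t : {for t, continuous F}.
    by apply/differentiable_continuous/derivable1_diffP; have := dF t => -[].
  split.
  + by move=> t _; have := dF t => -[].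
  + by apply: cvg_at_right_filter; exact: cF.
  + by apply: cvg_at_left_filter; exact: cF.
- by move=> t _; rewrite derive1E; have := dF t => /@derive_val.
Qed.

Lemma avg_is_derive (f df : R -> R -> R) (C : R) :
  (forall s, continuous (f s)) ->
  (forall s t : R, 0 <= t <= 1 -> is_derive s 1 (f ^~ t) (df s t)) ->
  (forall s t, -1 < s < 1 -> 0 <= t <= 1 -> `|df s t| <= C) ->
  is_derive (0 : R) 1 (fun s => avg (f s)) (avg (df 0)).
Proof.
move=> cf dfP dfC.
have I0 : `]-1, 1[%classic (0 : R) by rewrite /= in_itv /= ltrN10 ltr01.
have D : forall s t, `]-1, 1[%classic s -> I01 t -> derivable (f ^~ t) s 1.
  by move=> s t _; rewrite /= in_itv => /(dfP s)[].
have ub : forall s t, `]-1, 1[%classic s -> I01 t ->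
    `|partial1of2 f s t| <= (cst `|C|) t.
  move=> s t; rewrite /= !in_itv /= => hs ht.
  rewrite partial1of2E; have := dfP s t ht => /@derive_val ->.
  by apply: le_trans (ler_norm _); exact: dfC.
have intC : mu.-integrable I01 (EFin \o (cst `|C|)).
  by apply: integrable01 => t; exact: cvg_cst.
have intf s : `]-1, 1[%classic s -> mu.-integrable I01 (EFin \o f s).
  by move=> _; apply: integrable01; exact: cf.
apply: DeriveDef.
  exact: (@derivable_under_integral R _ (measurableTypeR R) mu _ _ measurable01
    _ _ _ I0 intf D _ (fun _ => normr_ge0 C) intC ub).
rewrite -derive1E.
rewrite (@differentiation_under_integral R _ (measurableTypeR R) mu _ _ measurable01
    _ _ _ I0 intf D _ (fun _ => normr_ge0 C) intC ub) //.
apply: eq_Rintegral => t /set_mem; rewrite /= in_itv /= => ht.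
by rewrite partial1of2E; have := dfP 0 t ht => /@derive_val.
Qed.

End UnitIntegral.

(** * Hadamard's lemma and derivations on Euclidean space *)

Section Hadamard.
Context (R : realType) (n : nat) (a : 'rV[R]_n).
Implicit Types (H G : 'rV[R]_n -> R) (y : 'rV[R]_n).

Definition seg y (t : R) : 'rV[R]_n := a + t *: (y - a).

Lemma seg_cont2 (p : 'rV[R]_n * R) :
  {for p, continuous (fun p : 'rV[R]_n * R => seg p.1 p.2)}.
Proof.
apply: (@cvgD _ _ _ (nbhs p)); first exact: cvg_cst.
apply: (@cvgZ _ _ _ (nbhs p)); first exact: cvg_snd.
by apply: (@cvgB _ _ _ (nbhs p)); [exact: cvg_fst|exact: cvg_cst].
Qed.

Lemma seg_cont y : continuous (seg y).
Proof.
move=> t; apply: (@cvgD _ _ _ (nbhs t)); first exact: cvg_cst.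
by apply: (@cvgZ _ _ _ (nbhs t)); [exact: cvg_id|exact: cvg_cst].
Qed.

(** Each derivative in [y] under the integral produces a factor [t]; the exponent [m] records them,
    so that differentiation maps [seg_avg m H] to [seg_avg m.+1] of a partial derivative of [H]. *)
Definition seg_avg m H y := avg (fun t => t ^+ m * H (seg y t)).

Lemma seg_integrand_cont m H y : continuous H ->
  continuous (fun t : R => t ^+ m * H (seg y t)).
Proof.
move=> cH t; apply: (@cvgM _ _ (nbhs t)); first exact: exprn_continuous.
by apply: (@continuous_comp _ _ _ (seg y) H); [exact: seg_cont|exact: cH].
Qed.

(** Compactness of [[0, 1]] makes the continuity of the integrand in [y] uniform in [t]. *)
Lemma seg_avg_continuous m H : continuous H -> continuous (seg_avg m H).
Proof.
move=> cH y; apply/(@cvgrPdist_le _ _ _ (nbhs y)) => e e0.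
pose P (z : 'rV[R]_n) (t : R) := `|H (seg y t) - H (seg z t)| <= e.
have : \forall z \near y, `[0, 1]%classic `<=` P z.
  have /compact_near_coveringP K : compact (`[0, 1]%classic : set R) .
    exact: segment_compact.
  apply: (K _ (nbhs y)) => t _.
  have c : {for (y, t), continuous (fun p : 'rV[R]_n * R => H (seg p.1 p.2))}.
    apply: (@continuous_comp _ _ _ (fun p : 'rV[R]_n * R => seg p.1 p.2) H).
      exact: seg_cont2.
    exact: cH.
  have e2 : 0 < e / 2 by rewrite divr_gt0.
  have /cvgrPdist_le/(_ _ e2) [[A B] /= [Ay Bt] AB] := c.
  exists (B, A) => //= -[s z] [/= Bs Az].
  have h1 := AB (y, s) (conj (nbhs_singleton Ay) Bs).
  have h2 := AB (z, s) (conj Az Bs).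
  rewrite /P /= in h1 h2 *; rewrite -(subrKA (H (seg y t))).
  rewrite (le_trans (ler_normD _ _)) // [leRHS]splitr lerD //.
  by rewrite distrC.
apply: (@filterS _ (nbhs y)) => z Pz; rewrite /seg_avg -avgB; try exact: seg_integrand_cont.
apply: norm_avg_le => [t|t t01].
  by apply: (@cvgB _ _ _ (nbhs t)); exact: seg_integrand_cont.
rewrite -mulrBr normrM -[leRHS]mul1r; apply: ler_pM => //; last first.
  by apply: Pz; rewrite /= in_itv.
by case/andP: t01 => t0 t1; rewrite normrX ger0_norm // exprn_ile1.
Qed.

Lemma seg_avg_is_derive m H j y : continuous H ->
  (forall z, derivable H z (delta_mx 0 j)) ->
  continuous (fun z => 'D_(delta_mx 0 j) H z) ->
  is_derive y (delta_mx 0 j) (seg_avg m H)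
    (seg_avg m.+1 (fun z => 'D_(delta_mx 0 j) H z) y).
Proof.
move=> cH dH cdH; set v : 'rV[R]_n := delta_mx 0 j.
pose f (s t : R) := t ^+ m * H (seg (s *: v + y) t).
pose df (s t : R) := t ^+ m.+1 * 'D_v H (seg (s *: v + y) t).
have segE s t : seg (s *: v + y) t = seg y t + (t * s) *: v.
  by rewrite /seg -addrA scalerDr scalerA -addrA addrA addrC -!addrA [_ + (_ *: v)]addrC.
(* This closed ball contains all points [seg (s *: v + y) t] with [|s| < 1] and [0 <= t <= 1],
   because [|v| <= 1]. The maximum of the derivative on it is the integrable dominating constant. *)
have [C HC] : exists C, forall z, `|z| <= `|a| + (1 + `|y| + `|a|) -> `|'D_v H z| <= C.
  pose K := [set z : 'rV[R]_n | `|z| <= `|a| + (1 + `|y| + `|a|)].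
  have cK : compact K.
    apply: bounded_closed_compact.
      exists (`|a| + (1 + `|y| + `|a|)); split; first exact: num_real.
      by move=> M /ltW KM z /= /le_trans; apply.
    apply: (@preimage_closed _ _ (fun z : 'rV[R]_n => `|z|) [set x | x <= _]).
      by move=> z _; exact: norm_continuous.
    exact: closed_le.
  have /compact_bounded [M [_ HM]] : compact ((fun z => 'D_v H z) @` K).
    apply: continuous_compact => //; exact: continuous_subspaceT.
  exists (M + 1) => z Kz; apply: (HM (M + 1)); first by rewrite ltrDl.
  by exists z.
have dfP (s t : R) : is_derive s 1 (f ^~ t) (df s t).
  have -> : f ^~ t = (fun s : R => t ^+ m *: (H (seg y t + (t * s) *: v) : R)).
    by apply/funext => r; rewrite /f segE.
  rewrite /df exprSr -mulrA; apply: is_deriveZ.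
  have d1 : is_derive (t * s) 1 (fun r : R => H (seg y t + r *: v))
     ('D_v H (seg y t + (t * s) *: v)) by apply: is_derive_line; exact: dH.
  have d2 : is_derive s 1 (fun r : R => t * r) t.
    have := @is_deriveZ R R R id t s 1 1 (is_derive_id _ _).
    by rewrite -[t *: 1]/(t * 1) mulr1.
  rewrite segE; have := @is_derive1_comp _ _ _ s _ _ d1 d2.
  by rewrite mulrC.
have cf (s : R) : continuous (f s) by exact: seg_integrand_cont.
have dfC (s t : R) : -1 < s < 1 -> 0 <= t <= 1 -> `|df s t| <= C.
  move=> s1 /andP[t0 t1]; rewrite normrM -[leRHS]mul1r; apply: ler_pM => //.
    by rewrite normrX ger0_norm // exprn_ile1.
  apply: HC; rewrite /seg (le_trans (ler_normD _ _)) // lerD2l normrZ.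
  rewrite (ger0_norm t0) -[leRHS]mul1r; apply: ler_pM => //.
  rewrite (le_trans (ler_normB _ _)) // lerD2r (le_trans (ler_normD _ _)) // lerD2r.
  rewrite normrZ -[leRHS]mul1r; apply: ler_pM => //.
    by rewrite ler_norml !ltW //; case/andP: s1.
  by apply: norm_leP => // i k; rewrite mxE; case: (_ && _); rewrite ?normr1 ?normr0.
have := avg_is_derive cf (fun s t _ => dfP s t) dfC.
have E0 : avg (df 0) = seg_avg m.+1 (fun z => 'D_v H z) y.
  by rewrite /df scale0r add0r.
rewrite E0 => -[d1 d2].
have fE : (fun s : R => avg (f s)) = (fun h : R => seg_avg m H (h *: v + y)) by [].
move: d1 d2; rewrite {}fE => d1 d2.
have d3 : derivable (seg_avg m H) y v := (derivable1P (seg_avg m H) y v).2 d1.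
apply: DeriveDef; first exact: d3.
exact: etrans (derive_line (seg_avg m H) y v) d2.
Qed.

Lemma seg_avg_Ck k m H : Ck k setT H -> Ck k setT (seg_avg m H).
Proof.
elim: k m H => [|k IHk] m H [cH dH].
  by split=> // y _; apply: seg_avg_continuous => z; exact: cH.
split=> [y _|j]; first by apply: seg_avg_continuous => z; exact: cH.
have [dHj CHj] := dH j.
have D y : is_derive y (delta_mx 0 j) (seg_avg m H)
    (seg_avg m.+1 (fun z => 'D_(delta_mx 0 j) H z) y).
  apply: seg_avg_is_derive => z; [exact: cH|exact: dHj|].
  exact: (Ck_cont CHj).
split=> [y _|]; first by have := D y => -[].
apply: Ck_ext (IHk m.+1 _ CHj) => [|y _]; first exact: openT.
by apply/esym; have := D y => -[].
Qed.

(** [Q k] is the average of the [k]-th partial derivative over the segment from [a] to [y]; the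
    expansion is the fundamental theorem of calculus on that segment. *)
Lemma hadamard G : smooth_euclid setT G -> exists Q : 'I_n -> 'rV[R]_n -> R,
  [/\ forall k, smooth_euclid setT (Q k),
      forall k, Q k a = 'D_(delta_mx 0 k) G a &
      forall y, G y = G a + \sum_k (y 0 k - a 0 k) * Q k y].
Proof.
move=> sG; have cD j : continuous (fun z => 'D_(delta_mx 0 j) G z).
  by move=> z; exact: (smooth_euclid_cont (smooth_euclid_derive j sG)).
exists (fun j => seg_avg 0 (fun z => 'D_(delta_mx 0 j) G z)); split.
- by move=> j k; apply: seg_avg_Ck; exact: smooth_euclid_derive.
- move=> j; rewrite /seg_avg -[RHS]avg_cst; congr avg; apply/funext => t.
  by rewrite /seg subrr scaler0 addr0 mul1r.
move=> y; rewrite (_ : \sum_k _ = G y - G a); first by rewrite addrC subrK.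
pose D j z := 'D_(delta_mx 0 j) G z.
transitivity (\sum_j avg (fun t : R =>
    (y 0 j - a 0 j) * (t ^+ 0 * D j (seg y t)))).
  apply: eq_bigr => j _; rewrite avgZ //.
  by apply: seg_integrand_cont; exact: cD.
rewrite -avg_sum; last first.
  move=> j t; apply: (@cvgM _ _ (nbhs t)); first exact: cvg_cst.
  by apply: seg_integrand_cont; exact: cD.
have cS : continuous (fun t : R => \sum_j (y 0 j - a 0 j) * (t ^+ 0 * D j (seg y t))).
  move=> t; apply: (@cvg_sumr _ _ _ (nbhs t)) => j _.
  apply: (@cvgM _ _ (nbhs t)); first exact: cvg_cst.
  by apply: seg_integrand_cont; exact: cD.
have dS (t : R) : is_derive t 1 (fun t => G (seg y t))
    (\sum_j (y 0 j - a 0 j) * (t ^+ 0 * D j (seg y t))).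
  have dG : differentiable G (seg y t).
    exact: (smooth_euclid_differentiable openT sG).
  have := @is_derive_line R n G a (y - a) t (diff_derivable dG).
  rewrite -/(seg y t) derive_partials // => h; apply: (is_derive_eq h).
  by apply: eq_bigr => j _; rewrite mul1r !mxE.
by rewrite (avg_derive cS dS) /seg scale1r scale0r addr0 [a + _]addrC subrK.
Qed.

(** The Leibniz rule applied to the Hadamard expansion at [a] leaves [Q k a], the partial
    derivatives. Only the algebraic laws on smooth functions are assumed, so that [v] may be a
    derivation on another space precomposed with [H |-> H (f_1, ..., f_m)]; this is the source of
    both chain rules below. *)
Lemma euclid_derivation (v : ('rV[R]_n -> R) -> R) :
  (forall b f g, smooth_euclid setT f -> smooth_euclid setT g ->
     v (fun x => b * f x + g x) = b * v f + v g) ->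
  (forall f g, smooth_euclid setT f -> smooth_euclid setT g ->
     v (fun x => f x * g x) = f a * v g + v f * g a) ->
  forall G, smooth_euclid setT G ->
  v G = \sum_k 'D_(delta_mx 0 k) G a * v (fun y => y 0 k).
Proof.
move=> vD vM G sG; have [Q [sQ Qa GQ]] := hadamard sG.
have s1 : smooth_euclid setT (fun _ : 'rV[R]_n => 1 : R) by exact: smooth_euclid_cst.
have v1 : v (fun=> 1) = 0.
  have E1 : (fun _ : 'rV[R]_n => 1 * 1 : R) = fun=> 1.
    by apply/funext=> x; rewrite mulr1.
  have := vM _ _ s1 s1; rewrite E1 mul1r mulr1 => /eqP.
  by rewrite addrC -subr_eq subrr eq_sym => /eqP.
have v0 : v (fun=> 0) = 0.
  have E0 : (fun _ : 'rV[R]_n => -1 * 1 + 1 : R) = fun=> 0.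
    by apply/funext=> x; rewrite mulr1 addNr.
  by have := vD (-1) _ _ s1 s1; rewrite E0 v1 mulr0 addr0.
have vS (r : seq 'I_n) (F : 'I_n -> 'rV[R]_n -> R) : (forall k, smooth_euclid setT (F k)) ->
    v (fun y => \sum_(k <- r) F k y) = \sum_(k <- r) v (F k).
  move=> sF; elim: r => [|k r IHr].
    rewrite big_nil -[RHS]v0; congr v.
    by apply/funext => y; rewrite big_nil.
  rewrite big_cons -IHr -[v (F k)]mul1r -vD //.
    by congr v; apply/funext => y; rewrite big_cons mul1r.
  by apply: smooth_euclid_sum => //; exact: openT.
have sL k : smooth_euclid setT (fun y : 'rV[R]_n => y 0 k - a 0 k).
  apply: smooth_euclidD; [exact: openT|exact: smooth_euclid_coord|].
  exact: smooth_euclid_cst.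
have GE : G = (fun y => G a * 1 + \sum_k (y 0 k - a 0 k) * Q k y).
  by apply/funext => y; rewrite mulr1.
have sLQ k : smooth_euclid setT (fun y : 'rV[R]_n => (y 0 k - a 0 k) * Q k y).
  by apply: smooth_euclidM => //; exact: openT.
rewrite {1}GE vD //; last by apply: smooth_euclid_sum => //; exact: openT.
rewrite v1 mulr0 add0r vS //; apply: eq_bigr => k _.
rewrite vM // subrr mul0r add0r Qa.
rewrite (_ : (fun y : 'rV[R]_n => y 0 k - a 0 k) = (fun y => - a 0 k * 1 + y 0 k)).
  rewrite vD //; last exact: smooth_euclid_coord.
  by rewrite v1 mulr0 add0r mulrC.
by apply/funext => y; rewrite mulr1 addrC.
Qed.

End Hadamard.

(** * Smooth functions on manifolds *)

Section EuclidLocal.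
Context (R : realType) (n : nat).
Implicit Types (U V : set 'rV[R]_n) (f : 'rV[R]_n -> R).

Lemma Ck_local k U f :
  (forall y, U y -> exists2 V, V y & Ck k V f) -> Ck k U f.
Proof.
elim: k f => [|k IHk] f h.
  by split=> // y /h[V Vy [cf _]]; exact: cf.
split=> [y /h[V Vy [cf _]]|j]; first exact: cf.
split=> [y /h[V Vy [_ /(_ j)[dfj _]]]|]; first exact: dfj.
by apply: IHk => y /h[V Vy [_ /(_ j)[_ Cfj]]]; exists V.
Qed.

Lemma smooth_euclid_local U f :
  (forall y, U y -> exists2 V, V y & smooth_euclid V f) -> smooth_euclid U f.
Proof. by move=> h k; apply: Ck_local => y /h[V Vy sV]; exists V. Qed.

End EuclidLocal.

Section Charts.
Context (R : realType) (n : nat) (M : topologicalType).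
Implicit Types (c d : chart R M n) (U V : set M) (p q : M).

Lemma open_continuous_at (T T' : topologicalType) (A : set T) (f : T -> T') x :
  open A -> {within A, continuous f} -> A x -> {for x, continuous f}.
Proof.
by move=> oA; rewrite continuous_open_subspace // => cf Ax; exact: cf (mem_set Ax).
Qed.

Lemma cmap_continuous c p : cdom c p -> {for p, continuous (cmap c)}.
Proof. exact: (open_continuous_at (@cdom_open _ _ _ c) (@cmap_cont _ _ _ c)). Qed.

Lemma cinv_continuous c y : (cmap c @` cdom c) y -> {for y, continuous (cinv c)}.
Proof. exact: (open_continuous_at (@cimg_open _ _ _ c) (@cinv_cont _ _ _ c)). Qed.

Lemma cinvK c y : (cmap c @` cdom c) y -> cmap c (cinv c y) = y.
Proof. by move=> [p cp <-]; rewrite cmapK. Qed.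

Lemma cinv_dom c y : (cmap c @` cdom c) y -> cdom c (cinv c y).
Proof. by move=> [p cp <-]; rewrite cmapK. Qed.

Lemma chart_imgP c U y : (cmap c @` (cdom c `&` U)) y <->
  (cmap c @` cdom c) y /\ U (cinv c y).
Proof.
split=> [[p [cp Up] <-]|[[p cp <-]]]; first by rewrite cmapK //; split=> //; exists p.
by rewrite cmapK // => Up; exists p.
Qed.

Lemma open_chart_img c U : open U -> open (cmap c @` (cdom c `&` U)).
Proof.
move=> oU; rewrite openE => y /chart_imgP[cy Uy]; apply: (@filterS _ (nbhs y) _
    ((cmap c @` cdom c) `&` (cinv c @^-1` U))).
  by move=> z [cz Uz]; apply/chart_imgP; split; [exact: cz|exact: Uz].
apply: filterI; first by apply: open_nbhs_nbhs; split=> //; exact: cimg_open.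
by apply: cinv_continuous => //; exact: open_nbhs_nbhs.
Qed.

End Charts.

Section SmoothOn.
Context (R : realType) (n : nat) (M : manifold R n).
Implicit Types (c d : chart R M n) (U V : set M) (f g : M -> R) (p q : M).

Lemma matlas_coordinates c : matlas M c -> coordinates c.
Proof. by move=> Mc d Md; split; apply: mcompat. Qed.

(** Composition with the transition map. It serves in both directions: from the atlas to other
    coordinates in [smooth_on_chart], and back in [chart_smooth_on]. *)
Lemma smooth_transport c d U f : smooth_change c d -> open U ->
  U `<=` cdom c -> smooth_euclid (cmap d @` (cdom d `&` U)) (fun y => f (cinv d y)) ->
  smooth_euclid (cmap c @` (cdom d `&` U)) (fun y => f (cinv c y)).
Proof.
move=> scd oU Uc sf.
have oc V : open V -> V `<=` cdom c -> open (cmap c @` V).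
  move=> oV Vc; rewrite (_ : V = cdom c `&` V); first exact: open_chart_img.
  by apply/esym/setIidr.
have odU : open (cdom d `&` U) by apply: openI => //; exact: cdom_open.
have odUc : cdom d `&` U `<=` cdom c by move=> q [_ /Uc].
have row q : \row_j cmap d q 0 j = cmap d q by apply/rowP => j; rewrite mxE.
apply: (@smooth_euclid_ext _ _ _ (fun y =>
    (fun z => f (cinv d z)) (\row_j cmap d (cinv c y) 0 j))).
- exact: oc.
- move=> _ [q [dq Uq] <-]; rewrite row !cmapK //; exact: Uc.
apply: (@smooth_euclid_comp _ _ _ _ (cmap d @` (cdom d `&` U))
  (fun z => f (cinv d z)) (fun j y => cmap d (cinv c y) 0 j)).
- exact: oc.
- exact: open_chart_img.
- move=> _ [q [dq Uq] <-]; rewrite row cmapK; last exact: Uc.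
  by exists q.
- exact: sf.
- move=> j; apply: smooth_euclid_sub (scd j); apply: image_subset => q [dq Uq].
  by split=> //; exact: Uc.
Qed.

Lemma smooth_on_local U f :
  (forall p, U p -> exists V, [/\ open V, V p & smooth_on V f]) -> smooth_on U f.
Proof.
move=> h c Mc; apply: smooth_euclid_local => _ [p [cp Up] <-].
have [V [oV Vp sV]] := h p Up.
exists (cmap c @` (cdom c `&` V)); [by exists p|exact: sV].
Qed.

Lemma smooth_on_sub U V f : V `<=` U -> smooth_on U f -> smooth_on V f.
Proof.
move=> VU sf c Mc; apply: smooth_euclid_sub (sf c Mc).
by apply: image_subset => q [cq /VU].
Qed.

Lemma smooth_on_ext U f g : open U -> (forall q, U q -> f q = g q) ->
  smooth_on U f -> smooth_on U g.
Proof.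
move=> oU fg sf c Mc; apply: smooth_euclid_ext (sf c Mc); first exact: open_chart_img.
by move=> _ [q [cq Uq] <-]; rewrite cmapK // fg.
Qed.

Lemma smooth_onD U f g : open U -> smooth_on U f -> smooth_on U g ->
  smooth_on U (fun q => f q + g q).
Proof.
move=> oU sf sg c Mc; apply: smooth_euclidD; [exact: open_chart_img|exact: sf|exact: sg].
Qed.

Lemma smooth_onM U f g : open U -> smooth_on U f -> smooth_on U g ->
  smooth_on U (fun q => f q * g q).
Proof.
move=> oU sf sg c Mc; apply: smooth_euclidM; [exact: open_chart_img|exact: sf|exact: sg].
Qed.

Lemma smooth_onX U f k : open U -> smooth_on U f -> smooth_on U (fun q => f q ^+ k).
Proof.
move=> oU sf; elim: k => [|k IHk].
  by apply: smooth_on_ext (smooth_on_cst U 1) => // q _; rewrite expr0.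
by apply: smooth_on_ext (smooth_onM oU sf IHk) => // q _; rewrite exprS.
Qed.

Lemma smooth_on_prod U I (r : seq I) (F : I -> M -> R) : open U ->
  (forall i, smooth_on U (F i)) -> smooth_on U (fun q => \prod_(i <- r) F i q).
Proof.
move=> oU sF; elim: r => [|i r IHr].
  by apply: smooth_on_ext (smooth_on_cst U 1) => // q _; rewrite big_nil.
by apply: smooth_on_ext (smooth_onM oU (sF i) IHr) => // q _; rewrite big_cons.
Qed.

Lemma smooth_on_comp U m (G : 'rV[R]_m -> R) (f : 'I_m -> M -> R) : open U ->
  smooth_euclid setT G -> (forall k, smooth_on U (f k)) ->
  smooth_on U (fun q => G (\row_k f k q)).
Proof.
move=> oU sG sf c Mc.
apply: (smooth_euclid_comp (g := fun k y => f k (cinv c y)) (V := setT)) => //.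
- exact: open_chart_img.
- exact: openT.
- by move=> k; exact: sf.
Qed.

Lemma smooth_on_chart c U f : coordinates c -> open U -> smooth_on U f ->
  smooth_euclid (cmap c @` (cdom c `&` U)) (fun y => f (cinv c y)).
Proof.
move=> Cc oU sf; apply: smooth_euclid_local => _ [p [cp Up] <-].
have [d Md dp] := mcover p.
exists (cmap c @` (cdom d `&` (cdom c `&` U))); first by exists p.
apply: (@smooth_transport c d).
- by have [] := Cc d Md.
- by apply: openI => //; exact: cdom_open.
- by move=> q [].
- apply: smooth_euclid_sub (sf d Md); apply: image_subset => q [dq [cq Uq]].
  by split.
Qed.

Lemma chart_smooth_on c U f : coordinates c -> open U -> U `<=` cdom c ->
  smooth_euclid (cmap c @` U) (fun y => f (cinv c y)) -> smooth_on U f.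
Proof.
move=> Cc oU Uc sf d Md.
rewrite (_ : cdom d `&` U = cdom c `&` (cdom d `&` U)); last first.
  by apply/esym/setIidr => q [_ /Uc].
apply: (@smooth_transport d c).
- by have [] := Cc d Md.
- by apply: openI => //; exact: cdom_open.
- by move=> q [].
- by apply: smooth_euclid_sub sf; apply: image_subset => q [_ []].
Qed.

Lemma smooth_on_cmap c a : coordinates c -> smooth_on (cdom c) (fun q => cmap c q 0 a).
Proof. by move=> Cc d Md; have [_] := Cc d Md; exact. Qed.

Lemma smooth_on_continuous U f p : open U -> smooth_on U f -> U p ->
  {for p, continuous f}.
Proof.
move=> oU sf Up; have [c Mc cp] := mcover p.
apply: (@near_eq_continuous _ _ (fun q => f (cinv c (cmap c q)))).
  have := open_nbhs_nbhs (conj (@cdom_open _ _ _ c) cp).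
  by apply: filterS => q cq; rewrite cmapK.
apply: (@continuous_comp _ _ _ (cmap c) (fun y => f (cinv c y))).
  exact: cmap_continuous.
by apply: (smooth_euclid_cont (sf c Mc)); exists p.
Qed.

Definition pderive c (a : 'I_n) f q : R :=
  'D_(delta_mx 0 a) (fun y => f (cinv c y)) (cmap c q).

Lemma smooth_on_pderive c a U f : coordinates c -> open U -> smooth_on U f ->
  smooth_on (cdom c `&` U) (pderive c a f).
Proof.
move=> Cc oU sf; have oc : open (cdom c `&` U).
  by apply: openI => //; exact: cdom_open.
apply: (@chart_smooth_on c) => //.
apply: (@smooth_euclid_ext _ _ _ (fun y => 'D_(delta_mx 0 a) (fun y => f (cinv c y)) y)).
- exact: open_chart_img.
- by move=> _ [q [cq Uq] <-]; rewrite /pderive cmapK.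
- by apply: smooth_euclid_derive; exact: smooth_on_chart.
Qed.

Lemma chart_derivable c a U f q : coordinates c -> open U -> smooth_on U f ->
  cdom c q -> U q -> derivable (fun y => f (cinv c y)) (cmap c q) (delta_mx 0 a).
Proof.
move=> Cc oU sf cq Uq; apply: (smooth_euclid_derivable (smooth_on_chart Cc oU sf)).
by exists q.
Qed.

Lemma pderiveD c a f g q b : coordinates c -> cdom c q -> smooth_on setT f ->
  smooth_on setT g ->
  pderive c a (fun x => b * f x + g x) q = b * pderive c a f q + pderive c a g q.
Proof.
move=> Cc cq sf sg.
have df := @chart_derivable _ a _ _ _ Cc openT sf cq I.
have dg := @chart_derivable _ a _ _ _ Cc openT sg cq I.
rewrite /pderive -[X in X + _](deriveZ b df) -deriveD //.
exact: derivableZ.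
Qed.

Lemma pderiveM c a U f g q : coordinates c -> open U -> U q -> cdom c q ->
  smooth_on U f -> smooth_on U g ->
  pderive c a (fun x => f x * g x) q = f q * pderive c a g q + pderive c a f q * g q.
Proof.
move=> Cc oU Uq cq sf sg.
have df := @chart_derivable _ a _ _ _ Cc oU sf cq Uq.
have dg := @chart_derivable _ a _ _ _ Cc oU sg cq Uq.
rewrite /pderive (deriveM df dg) /= cmapK // -![_ *: _]/(_ * _).
by congr (_ + _); rewrite mulrC.
Qed.

Lemma pderive_cmap c a b q : cdom c q ->
  pderive c a (fun x => cmap c x 0 b) q = (a == b)%:R.
Proof.
move=> cq; rewrite /pderive.
rewrite (@near_eq_derive _ _ _ _ (fun y : 'rV[R]_n => y 0 b)).
  by rewrite derive_coord mxE eqxx eq_sym.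
have : nbhs (cmap c q) (cmap c @` cdom c).
  by apply: open_nbhs_nbhs; split; [exact: cimg_open|exists q].
by apply: filterS => y /cinvK ->.
Qed.

(** A Euclidean bump transported through a chart. The closed set [K] is part of the conclusion
    because extensions by zero are checked on two open sets, [U] and the complement of [K]. *)
Lemma bump_fun U p : open U -> U p -> exists (chi : M -> R) (V K : set M),
  [/\ smooth_on setT chi, [/\ open V, V p & V `<=` U],
      closed K /\ K `<=` U, forall q, V q -> chi q = 1 &
      forall q, ~ K q -> chi q = 0].
Proof.
move=> oU Up; have [c Mc cp] := mcover p; have Cc := matlas_coordinates Mc.
set z := cmap c p; have oI : open (cmap c @` (cdom c `&` U)) by exact: open_chart_img.
have zI : nbhs z (cmap c @` (cdom c `&` U)) by apply: open_nbhs_nbhs; split => //; exists p.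
have [e /= e0 eI] := (nbhs_ballP _ _).1 zI.
have d0 : 0 < e / 2 by rewrite divr_gt0.
have [b [sb b1 bd]] := bump_euclid z d0.
pose B := [set y : 'rV[R]_n | `|y - z| <= e / 2].
have BI : B `<=` cmap c @` (cdom c `&` U).
  move=> y By; apply: eI; rewrite -ball_normE /= distrC.
  by apply: le_lt_trans By _; rewrite ltr_pdivrMr // ltr_pMr // ltr1n.
have cB : compact B.
  apply: bounded_closed_compact.
    exists (`|z| + e / 2); split; first exact: num_real.
    move=> N hN y By; rewrite /= -[in leLHS](subrK z y) (le_trans (ler_normD _ _)) //.
    by rewrite addrC (le_trans _ (ltW hN)) // lerD2l.
  apply: (@preimage_closed _ _ (fun y : 'rV[R]_n => `|y - z|) [set x | x <= e / 2]).
    move=> y _; apply: (@continuous_comp _ _ _ (fun y : 'rV[R]_n => y - z)).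
      by apply: (@cvgB _ _ _ (nbhs y)); [exact: cvg_id|exact: cvg_cst].
    exact: norm_continuous.
  exact: closed_le.
pose K := cinv c @` B.
have cK : compact K.
  apply: continuous_compact => //; apply: continuous_in_subspaceT => y /set_mem /BI.
  by move=> /chart_imgP[? _]; exact: cinv_continuous.
have KU q : K q -> cdom c q /\ U q.
  by move=> [y /BI /chart_imgP[cy Uy] <-]; split=> //; exact: cinv_dom.
(* The map [cmap c] is total with arbitrary values off [cdom c], so the value 0 is imposed there. *)
pose chi q := if pselect (cdom c q) then b (cmap c q) else 0.
have chiE q : cdom c q -> chi q = b (cmap c q) by rewrite /chi; case: pselect.
have chi0 q : ~ K q -> chi q = 0.
  rewrite /chi; case: pselect => // cq nK; apply/eqP/negPn/negP => /bd h; apply: nK.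
  by exists (cmap c q); [exact: h|rewrite cmapK].
(* The Hausdorff axiom enters here: [K] is the image of a closed ball, hence compact, hence
   closed. *)
have clK : closed K by apply: compact_closed => //; exact: mhausdorff.
exists chi, (interior [set q | (cdom c `&` U) q /\ chi q = 1]), K; split.
- apply: smooth_on_local => q _; have [cq|ncq] := pselect (cdom c q).
    exists (cdom c); split=> //; first exact: cdom_open.
    apply: (@chart_smooth_on c) => //; first exact: cdom_open.
    apply: smooth_euclid_ext (smooth_euclid_sub _ sb) => //; first exact: cimg_open.
    by move=> _ [x cx <-]; rewrite cmapK // chiE.
  exists (~` K); split; [by rewrite openC|by move=> /KU[]|].
  apply: smooth_on_ext (smooth_on_cst _ 0); first by rewrite openC.
  by move=> x nK; rewrite chi0.
- split; first exact: open_interior.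
    have nc : nbhs p (cdom c `&` U).
      by apply: open_nbhs_nbhs; split=> //; apply: openI => //; exact: cdom_open.
    apply: (@filterS _ (nbhs p)) (filterI nc (cmap_continuous cp b1)).
    by move=> q [[cq Uq] bq]; split=> //; rewrite chiE.
  by move=> q /interior_subset[[]].
- by split=> // q /KU[].
- by move=> q /interior_subset[].
- exact: chi0.
Qed.

Lemma smooth_extend U (K : set M) chi h : open U -> closed K -> K `<=` U ->
  smooth_on setT chi -> (forall q, ~ K q -> chi q = 0) -> smooth_on U h ->
  smooth_on setT (fun q => chi q * h q).
Proof.
move=> oU clK KU schi chi0 sh; apply: smooth_on_local => q _.
have [Uq|nUq] := pselect (U q).
  exists U; split=> //; apply: smooth_onM => //.
  exact: smooth_on_sub schi.
have oK : open (~` K) by rewrite openC.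
exists (~` K); split=> //; first by move=> /KU.
by apply: smooth_on_ext (smooth_on_cst _ 0) => // x nK; rewrite chi0 // mul0r.
Qed.

End SmoothOn.

(** * The filtration and its symbols *)

Section Graded.
Context (R : realType) (n r : nat) (P : weighted_pair R n r).
Let M : manifold R n := wM P.
Let N : set M := wN P.
Implicit Types (f g h : M -> R) (p : N) (phi : nuW P).

Lemma filtT_smooth i f : f \in smem (filtT P i) -> smoothM P f.
Proof. by move=> hf; apply/filtT0; apply: filtT_le hf. Qed.

Lemma filtT_lin i (a : R) f g : f \in smem (filtT P i) -> g \in smem (filtT P i) ->
  (fun x => a * f x + g x) \in smem (filtT P i).
Proof.
move=> /filtTP hf /filtTP hg; apply/filtTP.
apply: (@filt_add _ _ _ _ (wW P) i setT (fun q => a * f q)) => //; first exact: openT.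
by apply: filt_mul => //; [exact: openT|exact: smooth_on_cst].
Qed.

Lemma filtT_zero i : (fun _ : M => 0 : R) \in smem (filtT P i).
Proof. by apply/filtTP; apply: filt_zero; exact: openT. Qed.

Lemma filt_sum i (U : set M) m (F : 'I_m -> M -> R) : open U ->
  (forall k, filt (wW P) i U (F k)) -> filt (wW P) i U (fun q => \sum_k F k q).
Proof.
move=> oU; elim: m F => [|m IHm] F hF.
  by apply: filt_ext (filt_zero _ _ oU) => // q _; rewrite big_ord0.
apply: filt_ext (filt_add oU (hF ord0) (IHm (fun k => F (lift ord0 k)) _)) => //.
by move=> q _; rewrite big_ord_recl.
Qed.

Lemma filt_le i j (U : set M) f : open U -> (i <= j)%N -> filt (wW P) j U f ->
  filt (wW P) i U f.
Proof.
move=> oU; elim: j => [|j IHj]; first by rewrite leqn0 => /eqP ->.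
rewrite leq_eqVlt => /predU1P[-> //|ij] hf; apply: IHj => //.
exact: filt_decr.
Qed.

Lemma val_insubd_filtT i f : f \in smem (filtT P i) ->
  val (insubd (0 : sub_of (filtT P i)) f) = f.
Proof. by move=> hf; rewrite insubdK. Qed.

Lemma symb_lin i a f g : f \in smem (filtT P i) -> g \in smem (filtT P i) ->
  symb i (fun x => a * f x + g x) = a *: symb i f + symb i g.
Proof.
move=> hf hg; rewrite /symb -clsZD; congr (cls _ _); apply: val_inj.
rewrite [LHS]val_insubd_filtT ?filtT_lin // linearP.
by congr (a *: _ + _); apply/esym; exact: val_insubd_filtT.
Qed.

Lemma symb_eq0 i f : f \in smem (filtT P i.+1) -> symb i f = 0.
Proof.
move=> hf; apply/clsP; rewrite subr0.
have : val (insubd (0 : sub_of (filtT P i)) f) \in smem (filtT P i.+1).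
  by rewrite val_insubd_filtT //; exact: filtT_le (leqnSn i) hf.
by [].
Qed.

Lemma homog_lin i a f g phi : f \in smem (filtT P i) -> g \in smem (filtT P i) ->
  homog i (fun x => a * f x + g x) phi = a * homog i f phi + homog i g phi.
Proof. by move=> hf hg; rewrite /homog symb_lin // wchar_linear. Qed.

Lemma wchar0 phi i : wchar phi (0 : gr P i) = 0.
Proof.
have := @wchar_linear _ _ _ _ phi i (-1) 0 0.
by rewrite scaler0 addr0 mulN1r addNr.
Qed.

Lemma homog_eq0 i f phi : f \in smem (filtT P i.+1) -> homog i f phi = 0.
Proof. by move=> hf; rewrite /homog symb_eq0 // wchar0. Qed.

Lemma homogM i j f g phi : f \in smem (filtT P i) -> g \in smem (filtT P j) ->
  homog (i + j) (fun x => f x * g x) phi = homog i f phi * homog j g phi.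
Proof. exact: wchar_mul. Qed.

Lemma homog_kappa t i f phi : homog i f (kappa t phi) = t ^+ i * homog i f phi.
Proof. by []. Qed.

Lemma homog_zero_sec i f p : f \in smem (filtT P i) ->
  homog i f (zero_sec p) = f (val p).
Proof.
case: i => [|i] hf; first exact: zero_symb.
by rewrite /homog /= (filtT_vanish hf (set_valP p)).
Qed.

Lemma smoothW_comp m (d : 'I_m -> nat) (f : 'I_m -> M -> R) (G : 'rV[R]_m -> R) :
  (forall k, f k \in smem (filtT P (d k))) -> smooth_euclid setT G ->
  smoothW P (fun phi => G (\row_k homog (d k) (f k) phi)).
Proof. by move=> hf sG phi; exists m, d, f, G, 1. Qed.

Lemma smoothW_homog i f : f \in smem (filtT P i) -> smoothW P (homog i f).
Proof.
move=> hf; have := @smoothW_comp 1 (fun=> i) (fun=> f) (fun y => y 0 0).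
rewrite (_ : (fun phi => _) = homog i f); last by apply/funext => phi; rewrite mxE.
by apply=> //; exact: smooth_euclid_coord.
Qed.

(** The two local presentations are put over the disjoint union ['I_(m1 + m2)] of their index sets,
    each outer function reading its own block of coordinates. *)
Lemma smoothW_op (op : R -> R -> R) (g1 g2 : nuW P -> R) :
  (forall m (G1 G2 : 'rV[R]_m -> R), smooth_euclid setT G1 -> smooth_euclid setT G2 ->
     smooth_euclid setT (fun y => op (G1 y) (G2 y))) ->
  smoothW P g1 -> smoothW P g2 -> smoothW P (fun phi => op (g1 phi) (g2 phi)).
Proof.
move=> sop s1 s2 phi.
have [m1 [d1 [f1 [G1 [e1 [hf1 sG1 e10 E1]]]]]] := s1 phi.
have [m2 [d2 [f2 [G2 [e2 [hf2 sG2 e20 E2]]]]]] := s2 phi.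
pose d (k : 'I_(m1 + m2)) := match fintype.split k with inl i => d1 i | inr j => d2 j end.
pose f (k : 'I_(m1 + m2)) := match fintype.split k with inl i => f1 i | inr j => f2 j end.
have sl i : fintype.split (lshift m2 i) = inl i := unsplitK (inl i).
have sr j : fintype.split (rshift m1 j) = inr j := unsplitK (inr j).
have dl i : d (lshift m2 i) = d1 i by rewrite /d sl.
have dr j : d (rshift m1 j) = d2 j by rewrite /d sr.
have fl i : f (lshift m2 i) = f1 i by rewrite /f sl.
have fr j : f (rshift m1 j) = f2 j by rewrite /f sr.
exists (m1 + m2)%N, d, f, (fun y => op (G1 (\row_i y 0 (lshift m2 i)))
  (G2 (\row_j y 0 (rshift m1 j)))), (Num.min e1 e2); split.
- by move=> k; rewrite /f /d; case: (fintype.split k) => i.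
- apply: sop.
    apply: (smooth_euclid_comp (g := fun i y => y 0 (lshift m2 i)) openT openT) => //.
    by move=> i; exact: smooth_euclid_coord.
  apply: (smooth_euclid_comp (g := fun j y => y 0 (rshift m1 j)) openT openT) => //.
  by move=> j; exact: smooth_euclid_coord.
- by rewrite lt_min e10.
move=> psi h; rewrite E1; last first.
  by move=> i; have := h (lshift m2 i); rewrite lt_min fl dl => /andP[].
rewrite E2; last first.
  by move=> j; have := h (rshift m1 j); rewrite lt_min fr dr => /andP[].
congr (op (G1 _) (G2 _)); apply/rowP => i; rewrite !mxE.
  by rewrite fl dl.
by rewrite fr dr.
Qed.

Lemma smoothW_lin a (g1 g2 : nuW P -> R) : smoothW P g1 -> smoothW P g2 ->
  smoothW P (fun phi => a * g1 phi + g2 phi).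
Proof.
apply: (@smoothW_op (fun x z => a * x + z)) => m G1 G2 sG1 sG2.
apply: smooth_euclidD => //; first exact: openT.
by apply: smooth_euclidM => //; [exact: openT|exact: smooth_euclid_cst].
Qed.

Lemma smoothWM (g1 g2 : nuW P -> R) : smoothW P g1 -> smoothW P g2 ->
  smoothW P (fun phi => g1 phi * g2 phi).
Proof.
apply: smoothW_op => m G1 G2 sG1 sG2.
by apply: smooth_euclidM => //; exact: openT.
Qed.

Lemma nuW_eq phi psi : (forall i (x : gr P i), wchar phi x = wchar psi x) -> phi = psi.
Proof.
case: phi psi => [w1 l1 m1 o1] [w2 l2 m2 o2] /= w12.
have E : w1 = w2.
  apply: functional_extensionality_dep => i; apply/funext => x; exact: w12.
case: _ / E in l2 m2 o2 *.
by rewrite (Prop_irrelevance l1 l2) (Prop_irrelevance m1 m2) (Prop_irrelevance o1 o2).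
Qed.

Lemma kappa_zero_sec t p : kappa t (zero_sec p) = zero_sec p.
Proof.
apply: nuW_eq => -[|i] x; rewrite /= /kappa_char /=.
  by rewrite expr0 mul1r.
by rewrite mulr0.
Qed.

Lemma baseW_zero_sec p : baseW (zero_sec p).
Proof. by exists (zero_sec p) => //; exact: kappa_zero_sec. Qed.

Lemma homog_baseW i f phi : baseW phi -> homog i.+1 f phi = 0.
Proof. by move=> [psi _ <-]; rewrite homog_kappa expr0n mul0r. Qed.

(** The properties shared by the restrictions to [C^oo(M)_(i)] of the tangent
    vectors of [M] at [q] and by the differentials of symbols of degree [i]. *)
Definition symbol_form (i : nat) (q : M) (D : (M -> R) -> R) :=
  [/\ forall a f g, f \in smem (filtT P i) -> g \in smem (filtT P i) ->
        D (fun x => a * f x + g x) = a * D f + D g,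
      forall h f, smoothM P h -> f \in smem (filtT P i) ->
        D (fun x => h x * f x) = h q * D f &
      forall j k f g, (0 < j)%N -> (0 < k)%N -> (j + k = i)%N ->
        f \in smem (filtT P j) -> g \in smem (filtT P k) ->
        D (fun x => f x * g x) = 0].

Lemma filtT_vanish_pos i f q : (0 < i)%N -> f \in smem (filtT P i) -> N q -> f q = 0.
Proof. by case: i => // i _ hf Nq; exact: (filtT_vanish hf Nq). Qed.

(** Functions of positive degree vanish on [N], so the Leibniz rule loses one term for [h * f] and
    both terms for a product of two functions of positive degrees. *)
Lemma symbol_form_tangent i q u : (0 < i)%N -> N q ->
  is_derivation (smoothM P) q u -> symbol_form i q u.
Proof.
move=> i0 Nq [_ uD uM]; split.
- by move=> a f g /filtT_smooth sf /filtT_smooth sg; exact: uD.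
- move=> h f sh hf; rewrite uM //; last exact: filtT_smooth hf.
  by rewrite (filtT_vanish_pos i0 hf) // mulr0 addr0.
- move=> j k f g j0 k0 _ hf hg.
  rewrite uM; [|exact: filtT_smooth hf|exact: filtT_smooth hg].
  by rewrite (filtT_vanish_pos j0 hf) // (filtT_vanish_pos k0 hg) // mul0r mulr0 addr0.
Qed.

Lemma symbol_form_homog i p v : (0 < i)%N ->
  is_derivation (smoothW P) (zero_sec p) v ->
  symbol_form i (val p) (fun f => v (homog i f)).
Proof.
move=> i0 [_ vD vM]; have Np := set_valP p; split.
- move=> a f g hf hg; rewrite -vD; [|exact: smoothW_homog..].
  by congr v; apply/funext => phi; rewrite homog_lin.
- move=> h f sh hf; have h0 : h \in smem (filtT P 0) by apply/filtT0.
  rewrite (_ : homog i _ = fun phi => homog 0 h phi * homog i f phi); last first.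
    by apply/funext => phi; rewrite -(homogM phi h0 hf).
  rewrite vM; [|exact: smoothW_homog..].
  rewrite !homog_zero_sec // (filtT_vanish_pos i0 hf) // mulr0 addr0 //.
- move=> j k f g j0 k0 <- hf hg.
  rewrite (_ : homog _ _ = fun phi => homog j f phi * homog k g phi); last first.
    by apply/funext => phi; rewrite homogM.
  rewrite vM; [|exact: smoothW_homog..].
  rewrite !homog_zero_sec // (filtT_vanish_pos j0 hf) // (filtT_vanish_pos k0 hg) //.
  by rewrite mul0r mulr0 addr0.
Qed.

Lemma symbol_formB i q D E : symbol_form i q D -> symbol_form i q E ->
  symbol_form i q (fun f => D f - E f).
Proof.
move=> [Da Dm Dz] [Ea Em Ez]; split.
- by move=> a f g hf hg; rewrite Da // Ea // mulrBr opprD addrACA.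
- by move=> h f sh hf; rewrite Dm // Em // mulrBr.
- by move=> j k f g j0 k0 jk hf hg; rewrite (Dz j k) // (Ez j k) // subr0.
Qed.

Lemma symbol_form_sum i q D m (F : 'I_m -> M -> R) : symbol_form i q D ->
  (forall k, F k \in smem (filtT P i)) ->
  D (fun x => \sum_k F k x) = \sum_k D (F k).
Proof.
move=> [Da _ _]; have D0 : D (fun=> 0) = 0.
  have := Da (-1) _ _ (filtT_zero i) (filtT_zero i).
  rewrite (_ : (fun x => _) = fun=> 0); last by apply/funext => x; rewrite mulr0 addr0.
  by rewrite mulN1r addNr.
elim: m F => [|m IHm] F hF.
  by rewrite big_ord0 -[RHS]D0; congr D; apply/funext => x; rewrite big_ord0.
rewrite big_ord_recl -IHm // -[D (F ord0)]mul1r -Da //.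
  by congr D; apply/funext => x; rewrite big_ord_recl mul1r.
by apply/filtTP/filt_sum => [|k]; [exact: openT|exact/filtTP].
Qed.

End Graded.

(** * Weighted charts and forms determined by coordinates *)

Section WeightedChart.
Context (R : realType) (n r : nat) (P : weighted_pair R n r).
Let M : manifold R n := wM P.
Let N : set M := wN P.
Implicit Types (f g h : M -> R) (q : M).

Definition weighted_chart (c : chart R M n) (w : 'I_n -> nat) :=
  [/\ coordinates c, forall a, (w a <= r)%N &
      forall i f, filt (wW P) i (cdom c) f <-> local_model c w i f].

Lemma weighted_chart_at q : exists c w, weighted_chart c w /\ cdom c q.
Proof.
have [c [w [Cc cq [_ wr] hf]]] := filt_local (wW P) q.
by exists c, w; split=> //; split.
Qed.

Context (c : chart R M n) (w : 'I_n -> nat) (Wc : weighted_chart c w).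

Lemma weighted_coordinates : coordinates c. Proof. by case: Wc. Qed.

Let Cc := weighted_coordinates.
Let oc : open (cdom c) := @cdom_open _ _ _ c.

Lemma filt_monomial i (s : 'I_n -> nat) h : (i <= \sum_a s a * w a)%N ->
  smooth_on (cdom c) h -> filt (wW P) i (cdom c) (fun q => h q * monomial c s q).
Proof.
move=> wis sh; have [_ _ hf] := Wc; apply/hf.
exists 1%N, (fun=> s), (fun=> h); split=> // q _.
by rewrite big_ord1.
Qed.

Lemma monomial_delta a q :
  monomial c (fun b => (b == a)%N) q = cmap c q 0 a.
Proof.
rewrite /monomial (bigD1 a) //= eqxx expr1 big1 ?mulr1 // => b /negbTE ->.
by rewrite expr0.
Qed.

Lemma sum_delta_weight a : (\sum_b (b == a) * w b = w a)%N.
Proof.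
rewrite (bigD1 a) //= eqxx mul1n big1 ?addn0 // => b /negbTE ->.
by rewrite mul0n.
Qed.

Lemma filt_cmap a h : smooth_on (cdom c) h ->
  filt (wW P) (w a) (cdom c) (fun q => h q * cmap c q 0 a).
Proof.
move=> sh.
apply: (@filt_ext _ _ _ _ (wW P) (w a) _
  (fun q => h q * monomial c (fun b => (b == a)%N) q)) => //.
  by move=> q _; rewrite monomial_delta.
by apply: filt_monomial => //; rewrite sum_delta_weight.
Qed.

(** Such a coordinate has degree at least 1, and the ideal of degree 1 is the vanishing ideal of
    [N]. *)
Lemma cmap_vanish a q : (0 < w a)%N -> N q -> cdom c q -> cmap c q 0 a = 0.
Proof.
move=> wa Nq cq; have := filt_cmap a (smooth_on_cst (cdom c) 1).
move=> /(filt_le oc wa)/(wN_ideal _ oc)[_ /(_ q cq Nq)].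
by rewrite mul1r.
Qed.

Section Cutoff.
Context (chi : M -> R) (K : set M).
Context (schi : smooth_on setT chi) (clK : closed K) (Kc : K `<=` cdom c).
Context (chi0 : forall q, ~ K q -> chi q = 0).

Lemma smooth_cut h : smooth_on (cdom c) h -> smoothM P (fun q => chi q * h q).
Proof. exact: smooth_extend chi0. Qed.

(** This passes from the local filtration, which the model describes, to the global one, from which
    [gr] is made: membership is glued from [cdom c] and the complement of [K], where the product is
    0. *)
Lemma filtT_cut i h : filt (wW P) i (cdom c) h ->
  (fun q => chi q * h q) \in smem (filtT P i).
Proof.
move=> hh; apply/filtTP; apply: filt_glue; first exact: openT.
move=> q _; have [cq|ncq] := pselect (cdom c q).
  exists (cdom c); split=> //; apply: filt_mul => //.
  exact: smooth_on_sub schi.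
have oK : open (~` K) by rewrite openC.
exists (~` K); split=> //; first by move=> /Kc.
by apply: filt_ext (filt_zero _ _ oK) => // x nK; rewrite chi0 // mul0r.
Qed.

Definition cut_coord (a : 'I_n) q : R := chi q * cmap c q 0 a.

Lemma cut_coord_filtT a : cut_coord a \in smem (filtT P (w a)).
Proof.
apply: filtT_cut; have := filt_cmap a (smooth_on_cst (cdom c) 1).
by apply: filt_ext => // q _; rewrite mul1r.
Qed.

Lemma monomial_split s a q : (0 < s a)%N ->
  monomial c s q = monomial c (fun b => s b - (b == a))%N q * cmap c q 0 a.
Proof.
move=> sa; rewrite /monomial (bigD1 a) //= [in RHS](bigD1 a) //= eqxx subn1.
rewrite -[in LHS](prednK sa) exprSr [RHS]mulrAC; congr (_ * _).
by apply: eq_bigr => b /negbTE ->; rewrite subn0.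
Qed.

Lemma weight_split s a : (0 < s a)%N ->
  (\sum_b s b * w b = \sum_b (s b - (b == a)) * w b + w a)%N.
Proof.
move=> sa; rewrite (bigD1 a) //= [in RHS](bigD1 a) //= eqxx subn1.
rewrite -[in LHS](prednK sa) mulSnr -!addnA; congr (_ + _)%N; rewrite addnC; congr (_ + _)%N.
by apply: eq_bigr => b /negbTE ->; rewrite subn0.
Qed.

Lemma smooth_monomial s : smooth_on (cdom c) (monomial c s).
Proof.
apply: smooth_on_prod => // a; apply: smooth_onX => //.
exact: smooth_on_cmap.
Qed.

(* Locally [f] is a sum of terms [h x^s] of weight at least [i]; splitting off a
   factor [x_a] of positive weight, such a term is either a multiple of some
   [x_a] with [w a >= i] or a product of two functions of positive degrees with
   sum [i]. *)
Lemma symbol_form_eq0 i q D : (0 < i)%N -> chi q = 1 -> symbol_form i q D ->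
  (forall a, (i <= w a)%N -> D (cut_coord a) = 0) ->
  forall f, f \in smem (filtT P i) -> D f = 0.
Proof.
move=> i0 chiq sD Da f hf; have [Dl Dm Dz] := sD; have [_ _ hc] := Wc.
have /hc [m [s [h [wis sh fE]]]] : filt (wW P) i (cdom c) f.
  by move/filtTP: hf; apply: filt_restrict => //; exact: openT.
have pickP k : exists a, (0 < s k a)%N && (0 < w a)%N.
  apply/existsP; apply: contraTT (leq_trans i0 (wis k)) => /existsPn no.
  rewrite -eqn0Ngt sum_nat_eq0; apply/forallP => a /=.
  by have := no a; rewrite -muln_gt0 lt0n negbK.
have [a aP] := choice pickP.
(* Two cut-offs, harmless since [chi q = 1]: one globalizes the coefficient of each term, the other
   its coordinate factor. *)
have -> : D f = D (fun x => (chi x * chi x) * f x).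
  rewrite Dm //; first by rewrite chiq !mul1r.
  by apply: smooth_onM => //; exact: openT.
pose s' k b := (s k b - (b == a k))%N.
have -> : (fun x => chi x * chi x * f x) = (fun x => \sum_k
    (chi x * (h k x * monomial c (s' k) x)) * cut_coord (a k) x).
  apply/funext => x; have [cx|ncx] := pselect (cdom c x); last first.
    have c0 : chi x = 0 by rewrite chi0 // => /Kc.
    by rewrite c0 !mul0r big1 // => k _; rewrite !mul0r.
  rewrite fE // mulr_sumr; apply: eq_bigr => k _; have /andP[sa _] := aP k.
  by rewrite (monomial_split _ sa) /cut_coord; ring.
have mem k : (fun x => (chi x * (h k x * monomial c (s' k) x)) * cut_coord (a k) x)
    \in smem (filtT P i).
  rewrite (_ : (fun x => _) = fun x => chi x * ((chi x * h k x) * monomial c (s k) x)).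
    apply/filtT_cut/filt_monomial => //; apply: smooth_onM => //.
    exact: smooth_on_sub schi.
  apply/funext => x; have /andP[sa _] := aP k.
  by rewrite (monomial_split _ sa) /cut_coord /s'; ring.
rewrite (symbol_form_sum sD) // big1 // => k _; have /andP[sa wa] := aP k.
have A_smooth : smooth_on (cdom c) (fun x => h k x * monomial c (s' k) x).
  by apply: smooth_onM => //; exact: smooth_monomial.
have [iw|wi] := leqP i (w (a k)).
  rewrite Dm; [|exact: smooth_cut|]; first by rewrite Da // mulr0.
  exact: filtT_le (cut_coord_filtT (a k)).
apply: (Dz (i - w (a k)) (w (a k)))%N => //; first by rewrite subn_gt0.
- by rewrite subnK // ltnW.
- apply/filtT_cut/filt_monomial => //.
  by rewrite leq_subLR addnC -weight_split.
- exact: cut_coord_filtT.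
Qed.

End Cutoff.

End WeightedChart.

Section FiltrationProduct.
Context (R : realType) (n r : nat) (P : weighted_pair R n r).
Implicit Types (f g : wM P -> R).

(** The fields of [weighting] give only ideals; multiplicativity of the filtration comes from the
    local model, where exponents of monomials add. *)
Lemma filtTM i j f g : f \in smem (filtT P i) -> g \in smem (filtT P j) ->
  (fun q => f q * g q) \in smem (filtT P (i + j)).
Proof.
move=> /filtTP hf /filtTP hg; apply/filtTP/filt_glue => [|q _]; first exact: openT.
have [c [w [Wc cq]]] := weighted_chart_at q.
have oc : open (cdom c) by exact: cdom_open.
exists (cdom c); split=> //; have [Cc _ hc] := Wc.
have /hc [m [s [h [ws sh fE]]]] := filt_restrict openT oc (@subsetT _ _) hf.
have /hc [m' [s' [h' [ws' sh' gE]]]] := filt_restrict openT oc (@subsetT _ _) hg.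
apply: (@filt_ext _ _ _ _ (wW P) _ _ (fun q => \sum_k \sum_k'
    (h k q * h' k' q) * monomial c (fun a => s k a + s' k' a)%N q)) => //.
  move=> x cx; rewrite fE // gE // mulr_suml; apply: eq_bigr => k _.
  rewrite mulr_sumr; apply: eq_bigr => k' _; rewrite mulrACA; congr (_ * _).
  by rewrite /monomial -big_split; apply: eq_bigr => a _; rewrite exprD.
apply: filt_sum => // k; apply: filt_sum => // k'.
apply: (filt_monomial Wc); last exact: smooth_onM.
under eq_bigr => a _ do rewrite mulnDl.
by rewrite big_split leq_add.
Qed.

End FiltrationProduct.

(** * Points of the weighted normal bundle *)

Section WeightedCharacters.
Context (R : realType) (n r : nat) (P : weighted_pair R n r).
Let M : manifold R n := wM P.
Let N : set M := wN P.
Context (c : chart R M n) (w : 'I_n -> nat) (Wc : weighted_chart c w).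
Context (p : N) (cp : cdom c (val p)).
Implicit Types (f g h : M -> R) (y : 'I_n -> R).

Let Cc := weighted_coordinates Wc.
Let Np : N (val p) := set_valP p.

(** The weighted dilation by [t] of the vector [y], over the point [p]. *)
Definition wdil y (t : R) : 'rV[R]_n :=
  \row_a (if w a == 0%N then cmap c (val p) 0 a else t ^+ w a * y a).

(** At [t = 0] the coordinates of positive weight become 0, which are their values at [val p]
    because this point lies on [N]. *)
Lemma wdil_cvg y : wdil y t @[t --> 0^'+] --> cmap c (val p).
Proof.
have -> : cmap c (val p) = wdil y 0.
  apply/rowP => a; rewrite mxE; have [//|w0] := eqVneq (w a) 0%N.
  rewrite expr0n (negbTE w0) mul0r.
  by apply: (cmap_vanish Wc) => //; rewrite lt0n.
apply: cvg_at_right_filter; apply: row_continuous => a.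
have [_|_] := eqVneq (w a) 0%N; first exact: cvg_cst.
by apply: (@cvgM _ _ (nbhs (0 : R))); [exact: exprn_continuous|exact: cvg_cst].
Qed.

Lemma near_wdil_dom y : \forall t \near 0^'+, (cmap c @` cdom c) (wdil y t).
Proof.
have := @wdil_cvg y => /(_ (cmap c @` cdom c)); apply.
apply: open_nbhs_nbhs; split; first exact: cimg_open.
by exists (val p).
Qed.

Lemma smooth_wdil_cvg f y : smooth_on (cdom c) f ->
  f (cinv c (wdil y t)) @[t --> 0^'+] --> f (val p).
Proof.
move=> sf; have oc : open (cdom c) by exact: cdom_open.
have cf : {for cmap c (val p), continuous (fun z => f (cinv c z))}.
  apply: (smooth_euclid_cont (smooth_on_chart Cc oc sf)).
  by exists (val p).
have := cvg_comp _ _ (wdil_cvg y) cf.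
by rewrite /= cmapK.
Qed.

Lemma wdil_monomial y s t :
  \prod_a wdil y t 0 a ^+ s a =
  t ^+ (\sum_a s a * w a) * \prod_a wdil y 1 0 a ^+ s a.
Proof.
rewrite -prodrXr -big_split /=; apply: eq_bigr => a _; rewrite !mxE.
have [-> |w0] := eqVneq (w a) 0%N; first by rewrite muln0 expr0 mul1r.
by rewrite expr1n mul1r exprMn -exprM mulnC.
Qed.

(** For [f] of degree [i] this is the leading coefficient of [f] along the dilation orbit of [y],
    that is, the value of the symbol of [f] at the point with coordinates [y]. *)
Definition wlim i f y : R := lim (t ^- i * f (cinv c (wdil y t)) @[t --> 0^'+]).

(** A monomial at [wdil y t] is [t] to its weight times the monomial at [wdil y 1]. The power of 0
    is 1 for weight exactly [i] and 0 for larger weight, so the limit keeps the part of weight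
    [i]. *)
Lemma wlim_model i f y m (s : 'I_m -> 'I_n -> nat) (h : 'I_m -> M -> R) :
  (forall k, (i <= \sum_a s k a * w a)%N) ->
  (forall k, smooth_on (cdom c) (h k)) ->
  (forall q, cdom c q -> f q = \sum_k h k q * monomial c (s k) q) ->
  t ^- i * f (cinv c (wdil y t)) @[t --> 0^'+] -->
  \sum_k h k (val p) * (0 ^+ (\sum_a s k a * w a - i) *
    \prod_a wdil y 1 0 a ^+ s k a).
Proof.
move=> wis sh fE.
apply: (@cvg_trans _ ((fun t => \sum_k h k (cinv c (wdil y t)) *
    (t ^+ (\sum_a s k a * w a - i) * \prod_a wdil y 1 0 a ^+ s k a)) @ 0^'+)).
  apply: near_eq_cvg; near=> t.
  have ct : (cmap c @` cdom c) (wdil y t) by near: t; exact: near_wdil_dom.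
  have t0 : t != 0 by rewrite gt_eqF //; near: t; exact: nbhs_right_gt.
  rewrite fE; last exact: cinv_dom.
  rewrite mulr_sumr; apply/esym; apply: eq_bigr => k _; rewrite mulrCA; congr (_ * _).
  rewrite /monomial cinvK // wdil_monomial mulrA; congr (_ * _).
  by rewrite -[in X in _ * X](subnK (wis k)) exprD mulrCA mulVf ?mulr1 // expf_neq0.
apply: (@cvg_sumr _ _ _ (0^'+)) => k _; apply: cvgM.
  exact: smooth_wdil_cvg.
apply: cvgM; last exact: cvg_cst.
by apply: cvg_at_right_filter; exact: exprn_continuous.
Unshelve. all: by end_near. Qed.

Lemma filtT_model i f : f \in smem (filtT P i) -> local_model c w i f.
Proof.
have [_ _ hc] := Wc; move=> /filtTP hf; apply/hc.
by apply: filt_restrict hf => //; [exact: openT|exact: cdom_open].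
Qed.

Lemma wlim_cvg i f y : f \in smem (filtT P i) ->
  t ^- i * f (cinv c (wdil y t)) @[t --> 0^'+] --> wlim i f y.
Proof.
move=> /filtT_model [m [s [h [wis sh fE]]]].
by apply/cvg_ex; eexists; exact: (wlim_model wis sh fE).
Qed.

Lemma wlimE i f y l : t ^- i * f (cinv c (wdil y t)) @[t --> 0^'+] --> l ->
  wlim i f y = l.
Proof. by move=> /cvg_lim; apply. Qed.

Lemma wlim_lin i a f g y : f \in smem (filtT P i) -> g \in smem (filtT P i) ->
  wlim i (fun x => a * f x + g x) y = a * wlim i f y + wlim i g y.
Proof.
move=> hf hg; apply: wlimE.
rewrite (_ : (fun t => _) = (fun t => a * (t ^- i * f (cinv c (wdil y t))) +
   t ^- i * g (cinv c (wdil y t)))); last first.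
  by apply/funext => t; rewrite mulrDr mulrCA.
apply: cvgD; last exact: wlim_cvg.
by apply: cvgM; [exact: cvg_cst|exact: wlim_cvg].
Qed.

Lemma wlim_eq0 i f y : f \in smem (filtT P i.+1) -> wlim i f y = 0.
Proof.
move=> hf; apply: wlimE.
suff : t ^- i * f (cinv c (wdil y t)) @[t --> 0^'+] --> 0 * wlim i.+1 f y.
  by rewrite mul0r.
apply: (@cvg_trans _ ((fun t => t * (t ^- i.+1 * f (cinv c (wdil y t)))) @ 0^'+)).
  apply: near_eq_cvg; near=> t.
  have t0 : t != 0 by rewrite gt_eqF //; near: t; exact: nbhs_right_gt.
  by rewrite mulrA exprS invfM mulrA divff // mul1r.
apply: cvgM; last exact: wlim_cvg.
by apply: cvg_at_right_filter; exact: cvg_id.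
Unshelve. all: by end_near. Qed.

Lemma wlimM i j f g y : f \in smem (filtT P i) -> g \in smem (filtT P j) ->
  wlim (i + j) (fun x => f x * g x) y = wlim i f y * wlim j g y.
Proof.
move=> hf hg; apply: wlimE.
rewrite (_ : (fun t => _) = (fun t => (t ^- i * f (cinv c (wdil y t))) *
   (t ^- j * g (cinv c (wdil y t))))); last first.
  by apply/funext => t; rewrite exprD invfM mulrACA.
by apply: cvgM; exact: wlim_cvg.
Qed.

Lemma wlim0 f y : smoothM P f -> wlim 0 f y = f (val p).
Proof.
move=> sf; apply: wlimE; rewrite (_ : (fun t => _) = (fun t => f (cinv c (wdil y t)))).
  by apply: smooth_wdil_cvg; exact: smooth_on_sub sf.
by apply/funext => t; rewrite expr0 invr1 mul1r.
Qed.

Lemma wlim_repr i y (u : sub_of (filtT P i)) :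
  wlim i (val (repr (cls (restr (filtT P i) (filtT P i.+1)) u))) y = wlim i (val u) y.
Proof.
set v := repr _.
have : val (v - u) \in smem (filtT P i.+1) .
  exact: (repr_cls (restr (filtT P i) (filtT P i.+1)) u).
rewrite raddfB /= => /(wlim_eq0 y) h.
have -> : val v = (fun x => 1 * (val v - val u) x + val u x).
  by apply/funext => x; rewrite mul1r -[(_ - _) x]/(val v x - val u x) subrK.
rewrite wlim_lin ?mulr1 ?h ?mulr0 ?add0r //; last exact: valP.
by rewrite rpredB //; exact: valP.
Qed.

Section Char.
Context (y : 'I_n -> R).

Definition wchar_fun i (x : gr P i) : R := wlim i (val (repr x)) y.

Lemma wchar_fun_linear i a (x z : gr P i) :
  wchar_fun (a *: x + z) = a * wchar_fun x + wchar_fun z.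
Proof.
rewrite -(cls_repr x) -(cls_repr z) -clsZD /wchar_fun !wlim_repr.
have := @wlim_lin i a (val (repr x)) (val (repr z)) y (valP _) (valP _).
by move=> <-; rewrite linearP.
Qed.

Lemma wchar_fun_symb i f : f \in smem (filtT P i) -> wchar_fun (symb i f) = wlim i f y.
Proof. by move=> hf; rewrite /wchar_fun wlim_repr val_insubd_filtT. Qed.

Lemma wchar_fun_mul i j f g : f \in smem (filtT P i) -> g \in smem (filtT P j) ->
  wchar_fun (symb (i + j) (fun q => f q * g q)) =
  wchar_fun (symb i f) * wchar_fun (symb j g).
Proof.
move=> hf hg; have hfg : (fun q => f q * g q) \in smem (filtT P (i + j)).
  exact: filtTM.
by rewrite !wchar_fun_symb // wlimM.
Qed.

Lemma wchar_fun_one : wchar_fun (symb 0 (fun=> 1)) = 1.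
Proof.
have s1 : smoothM P (fun=> 1) by exact: smooth_on_cst.
by rewrite wchar_fun_symb ?wlim0 //; apply/filtT0.
Qed.

(** The point of the weighted normal bundle over [p] with weighted coordinates
    [y]. *)
Definition weighted_char : nuW P :=
  NuW wchar_fun_linear wchar_fun_mul wchar_fun_one.

Lemma homog_weighted_char i f : f \in smem (filtT P i) ->
  homog i f weighted_char = wlim i f y.
Proof. exact: wchar_fun_symb. Qed.

End Char.

(** For [y = 0] the dilated point is [val p] for every [t], and functions of positive degree vanish
    there. *)
Lemma weighted_char0 y : (forall a, y a = 0) -> weighted_char y = zero_sec p.
Proof.
move=> y0; apply: nuW_eq => i x; rewrite -(cls_repr x) /= /wchar_fun wlim_repr.
set f := val (repr x); have hf : f \in smem (filtT P i) := valP _.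
case: i x @f hf => [|i] x f hf.
  rewrite zero_cls wlim0 //; exact: filtT_smooth hf.
rewrite /= /wlim (_ : (fun t => _) = fun=> 0); first by rewrite lim_cst.
apply/funext => t; rewrite (_ : wdil y t = cmap c (val p)).
  by rewrite cmapK // (filtT_vanish hf Np) mulr0.
apply/rowP => a; rewrite mxE; have [//|w0] := eqVneq (w a) 0%N.
by rewrite y0 mulr0 (cmap_vanish Wc) // lt0n.
Qed.

Lemma derivable_expr (F : R -> R) k e :
  derivable F e 1 -> derivable (fun x => F x ^+ k) e 1.
Proof.
move=> dF; elim: k => [|k IHk].
  have -> : (fun x => F x ^+ 0) = cst 1 by apply/funext => x; rewrite expr0.
  exact: derivable_cst.
have -> : (fun x => F x ^+ k.+1) = F * (fun x => F x ^+ k).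
  by apply/funext => x; rewrite exprS.
exact: derivableM dF IHk.
Qed.

Lemma derivable_prod (F : 'I_n -> R -> R) e :
  (forall a, derivable (F a) e 1) -> derivable (fun x => \prod_a F a x) e 1.
Proof.
move=> dF; elim: (index_enum _) => [|a s IHs].
  have -> : (fun x => \prod_(b <- [::]) F b x) = cst 1.
    by apply/funext => x; rewrite big_nil.
  exact: derivable_cst.
have -> : (fun x => \prod_(b <- a :: s) F b x) = F a * (fun x => \prod_(b <- s) F b x).
  by apply/funext => x; rewrite big_cons.
exact: derivableM (dF a) IHs.
Qed.

(** By [wlim_model] the value is a polynomial in [e]. *)
Lemma derivable_homog_char i f y : f \in smem (filtT P i) ->
  derivable (fun e : R => homog i f (weighted_char (fun a => e * y a))) 0 1.
Proof.
move=> hf; have [m [s [h [wis sh fE]]]] := filtT_model hf.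
rewrite (_ : (fun e => _) = (fun e => \sum_(k < m) h k (val p) *
    (0 ^+ (\sum_a s k a * w a - i) *
    \prod_a wdil (fun a => e * y a) 1 0 a ^+ s k a))); last first.
  apply/funext => e; rewrite homog_weighted_char //; apply: wlimE.
  exact: wlim_model.
rewrite (_ : (fun e => _) = \sum_(k < m) (fun e => h k (val p) *
    (0 ^+ (\sum_a s k a * w a - i) *
    \prod_a wdil (fun a => e * y a) 1 0 a ^+ s k a))); last first.
  by apply/funext => e; rewrite fct_sumE.
apply: derivable_sum => k.
apply: (@derivableM _ _ (fun=> _) (fun e : R => _)); first exact: derivable_cst.
apply: (@derivableM _ _ (fun=> _) (fun e : R => _)); first exact: derivable_cst.
apply: (@derivable_prod (fun a e => wdil (fun a => e * y a) 1 0 a ^+ s k a)) => a.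
apply: derivable_expr.
rewrite (_ : (fun e : R => _) = fun e => if w a == 0%N then cmap c (val p) 0 a else e * y a).
  case: eqP => _; first exact: derivable_cst.
  apply: (@derivableM _ _ id (fun=> y a)); [exact: derivable_id|exact: derivable_cst].
by apply/funext => e; rewrite mxE expr1n mul1r.
Qed.

(** Near the zero section [g] is a smooth function of finitely many symbols, and by continuity of
    these along the curve the presentation holds for small [e]. This makes the derivative in
    [char_vec] a genuine one. *)
Lemma derivable_char (g : nuW P -> R) y : smoothW P g ->
  derivable (fun e : R => g (weighted_char (fun a => e * y a))) 0 1.
Proof.
move=> sg; set C := fun e : R => weighted_char (fun a => e * y a).
have C0 : C 0 = zero_sec p by apply: weighted_char0 => a; rewrite mul0r.
have [m [d [f [G [e [hf sG e0 gE]]]]]] := sg (zero_sec p).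
have dh k : derivable (fun e => homog (d k) (f k) (C e)) 0 1.
  exact: derivable_homog_char.
apply: (@near_eq_derivable _ _ _ (fun e => G (\row_k homog (d k) (f k) (C e)))).
  near=> x; apply/esym/gE => k; rewrite -C0; move: k; near: x.
  apply: (@filter_forall _ 'I_m (fun k x =>
    `|homog (d k) (f k) (C x) - homog (d k) (f k) (C 0)| < e) (nbhs (0 : R))) => k.
  have /derivable1_diffP/differentiable_continuous := dh k.
  move=> /cvgrPdist_lt/(_ _ e0); apply: filterS => x.
  by rewrite distrC.
have dG : differentiable G (\row_k homog (d k) (f k) (C 0)).
  exact: (smooth_euclid_differentiable openT sG).
by have := @derive_comp_row _ _ _ G (fun k e => homog (d k) (f k) (C e)) 0 1 dG dh => -[].
Unshelve. all: by end_near. Qed.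

(** The value 0 off smooth functions is the convention of [is_derivation]. *)
Definition char_vec y (g : nuW P -> R) : R :=
  if `[< smoothW P g >] then
    'D_1 (fun e : R => g (weighted_char (fun a => e * y a))) 0
  else 0.

Lemma char_vecE y (g : nuW P -> R) : smoothW P g ->
  char_vec y g = 'D_1 (fun e : R => g (weighted_char (fun a => e * y a))) 0.
Proof. by rewrite /char_vec => /asboolP ->. Qed.

End WeightedCharacters.

Section CharVec.
Context (R : realType) (n r : nat) (P : weighted_pair R n r).
Let M : manifold R n := wM P.
Let N : set M := wN P.
Context (c : chart R M n) (w : 'I_n -> nat) (Wc : weighted_chart c w).
Context (p : N) (cp : cdom c (val p)).
Implicit Types (f h : M -> R) (y : 'I_n -> R) (g : nuW P -> R).

Let char_curve y (e : R) := weighted_char Wc cp (fun a => e * y a).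

Lemma char_curve0 y : char_curve y 0 = zero_sec p.
Proof. by apply: weighted_char0 => a; rewrite mul0r. Qed.

Lemma char_vec_derivation y :
  is_derivation (smoothW P) (zero_sec p) (char_vec Wc cp y).
Proof.
split.
- by move=> g ng; rewrite /char_vec; case: asboolP.
- move=> a g1 g2 s1 s2.
  have d1 : derivable (fun e => g1 (char_curve y e)) 0 1 := derivable_char s1.
  have d2 : derivable (fun e => g2 (char_curve y e)) 0 1 := derivable_char s2.
  rewrite !char_vecE //; last exact: smoothW_lin.
  rewrite -[X in X + _](deriveZ a d1) -deriveD //.
  exact: derivableZ.
- move=> g1 g2 s1 s2.
  have d1 : derivable (fun e => g1 (char_curve y e)) 0 1 := derivable_char s1.
  have d2 : derivable (fun e => g2 (char_curve y e)) 0 1 := derivable_char s2.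
  rewrite !char_vecE //; last exact: smoothWM.
  rewrite (deriveM d1 d2) -![_ *: _]/(_ * _) -/(char_curve y 0) char_curve0.
  by congr (_ + _); rewrite mulrC.
Qed.

Lemma char_vec_homog0 y f : smoothM P f -> char_vec Wc cp y (homog 0 f) = 0.
Proof.
move=> sf; have hf : f \in smem (filtT P 0) by apply/filtT0.
rewrite char_vecE; last exact: smoothW_homog.
rewrite (_ : (fun e => _) = cst (f (val p))); first by rewrite derive_cst.
by apply/funext => e; rewrite homog_weighted_char // wlim0.
Qed.

Lemma char_vec0 y g : (forall a, y a = 0) -> char_vec Wc cp y g = 0.
Proof.
move=> y0; have [sg|ng] := pselect (smoothW P g); last first.
  by rewrite /char_vec; case: asboolP.
rewrite char_vecE // (_ : (fun e => _) = cst (g (zero_sec p))).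
  by rewrite derive_cst.
by apply/funext => e; rewrite weighted_char0 // => a; rewrite y0 mulr0.
Qed.

(** The cut-off coordinate is [chi] times a single monomial of weight exactly [w a], so its symbol
    along the curve is [e * y a]. *)
Lemma char_vec_cut (chi : M -> R) (K : set M) y a : smooth_on setT chi ->
  closed K -> K `<=` cdom c -> (forall q, ~ K q -> chi q = 0) ->
  chi (val p) = 1 -> (0 < w a)%N ->
  char_vec Wc cp y (homog (w a) (cut_coord c chi a)) = y a.
Proof.
move=> schi clK Kc chi0 chi1 wa.
have hx := cut_coord_filtT Wc schi clK Kc chi0 a.
rewrite char_vecE; last exact: smoothW_homog.
rewrite (_ : (fun e => _) = (fun e : R => e * y a)).
  rewrite (@deriveM _ _ id (fun=> y a)); [|exact: derivable_id|exact: derivable_cst].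
  by rewrite derive_cst derive_id scaler0 add0r [_ *: 1]mulr1.
apply/funext => e; rewrite homog_weighted_char //; apply: wlimE.
have := @wlim_model _ _ _ _ _ _ Wc _ cp (w a) (cut_coord c chi a) (fun a => e * y a)
  1 (fun _ b => (b == a)%N) (fun=> chi).
rewrite big_ord1 sum_delta_weight subnn expr0 mul1r chi1 mul1r.
rewrite (bigD1 a) //= eqxx expr1 big1 ?mulr1; last first.
  by move=> b /negbTE ->; rewrite expr0.
rewrite mxE expr1n mul1r (gtn_eqF wa); apply => //.
- by move=> _; exact: smooth_on_sub schi.
- by move=> q cq; rewrite big_ord1 monomial_delta.
Qed.

End CharVec.

(** * Derivations on the weighted normal bundle *)

Section Derivations.
Context (R : realType) (n r : nat) (P : weighted_pair R n r).
Let M : manifold R n := wM P.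
Let N : set M := wN P.
Implicit Types (f h : M -> R) (g : nuW P -> R) (p : N).

Lemma derivation0 X (C : set (X -> R)) x v : C (fun=> 0) -> is_derivation C x v ->
  v (fun=> 0) = 0.
Proof.
move=> C0 [_ vD _]; have := vD (-1) _ _ C0 C0.
rewrite (_ : (fun x => _) = fun=> 0); last by apply/funext => z; rewrite mulr0 addr0.
by rewrite mulN1r addNr.
Qed.

Lemma smoothW0 : smoothW P (fun=> 0).
Proof.
have := @smoothW_comp _ _ _ P 0 (fun=> 0%N) (fun _ _ => 0) (fun=> 0).
by apply => [[]//|]; exact: smooth_euclid_cst.
Qed.

Lemma derivation_homog0 p v i f : is_derivation (smoothW P) (zero_sec p) v ->
  f \in smem (filtT P i.+1) -> v (homog i f) = 0.
Proof.
move=> dv hf; rewrite (_ : homog i f = fun=> 0).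
  by apply: derivation0 dv; exact: smoothW0.
by apply/funext => phi; rewrite homog_eq0.
Qed.

Section Chain.
Context (p : N) (v : (nuW P -> R) -> R).
Context (dv : is_derivation (smoothW P) (zero_sec p) v).
Context (m : nat) (d : 'I_m -> nat) (f : 'I_m -> M -> R) (G : 'rV[R]_m -> R).
Context (hf : forall k, f k \in smem (filtT P (d k))) (sG : smooth_euclid setT G).

Let hom psi : 'rV[R]_m := \row_k homog (d k) (f k) psi.
Let a0 := hom (zero_sec p).

(** Composition with [hom] makes [v] a derivation at [a0] on smooth functions of Euclidean space. *)
Lemma derivation_comp : v (fun psi => G (hom psi)) =
  \sum_k 'D_(delta_mx 0 k) G a0 * v (homog (d k) (f k)).
Proof.
have [_ vD vM] := dv.
have vc k : v (homog (d k) (f k)) = v (fun psi => (fun y : 'rV[R]_m => y 0 k) (hom psi)).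
  by congr v; apply/funext => psi; rewrite mxE.
under eq_bigr => k _ do rewrite vc.
apply: (euclid_derivation (v := fun H => v (fun psi => H (hom psi)))) => //.
- by move=> b G1 G2 s1 s2; rewrite -vD //; exact: smoothW_comp.
- by move=> G1 G2 s1 s2; rewrite -/a0 vM //; exact: smoothW_comp.
Qed.

(* [g] and [G (hom _)] agree near [zero_sec p], hence everywhere after
   multiplication by a bump function of [hom]. *)
Lemma derivation_local g phi (e : R) : smoothW P g ->
  (forall psi, (forall k, `|homog (d k) (f k) psi - homog (d k) (f k) phi| < e) ->
     g psi = G (hom psi)) ->
  (forall k, `|homog (d k) (f k) (zero_sec p) - homog (d k) (f k) phi| < e) ->
  v g = \sum_k 'D_(delta_mx 0 k) G a0 * v (homog (d k) (f k)).
Proof.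
move=> sg gG ze; rewrite -derivation_comp; have [_ _ vM] := dv.
pose box (y : 'rV[R]_m) := forall k, `|y 0 k - homog (d k) (f k) phi| < e.
have nbox : nbhs a0 box.
  apply: (@filter_forall _ 'I_m (fun k y => `|y 0 k - homog (d k) (f k) phi| < e)
    (nbhs a0)) => k.
  have c : {for a0, continuous (fun y : 'rV[R]_m => `|y 0 k - homog (d k) (f k) phi|)}.
    apply: (@cvg_norm _ _ _ (nbhs a0)).
    by apply: (@cvgB _ _ _ (nbhs a0)); [exact: coord_continuous|exact: cvg_cst].
  by apply: (cvgr_lt _ c); rewrite mxE; exact: ze.
have [t /= t0 tbox] := (nbhs_ballP _ _).1 nbox.
have t20 : 0 < t / 2 by rewrite divr_gt0.
have [b [sb /nbhs_singleton b1 bd]] := bump_euclid a0 t20.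
pose B psi := b (hom psi).
have sB : smoothW P B by exact: smoothW_comp.
have sGh : smoothW P (fun psi => G (hom psi)) by exact: smoothW_comp.
have E : (fun psi => B psi * g psi) = (fun psi => B psi * G (hom psi)).
  apply/funext => psi; have [->|Bn0] := eqVneq (B psi) 0; first by rewrite !mul0r.
  congr (_ * _); apply: gG => k.
  have : box (hom psi).
    apply: tbox; rewrite -ball_normE /= distrC (le_lt_trans (bd _ Bn0)) //.
    by rewrite ltr_pdivrMr // ltr_pMr // ltr1n.
  by move/(_ k); rewrite mxE.
(* Equal values at the base point make the two terms containing [v B] in the Leibniz expansions
   cancel. *)
have g0 : g (zero_sec p) = G a0 by apply: gG.
have := congr1 v E; rewrite !vM // g0 /B -/a0 b1 !mul1r.
by move/addIr.
Qed.

End Chain.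

(** A chain rule inside the symbol: [G] is applied to functions on [M], not to their symbols. It
    rests on [homog 0] being multiplicative and on its values at the zero section, and so never
    compares [homog 0] of a composition with the composition of the symbols at an arbitrary
    character. *)
Lemma derivation_smoothM p v m (f : 'I_m -> M -> R) (G : 'rV[R]_m -> R) :
  is_derivation (smoothW P) (zero_sec p) v ->
  (forall k, smoothM P (f k)) -> smooth_euclid setT G ->
  v (homog 0 (fun q => G (\row_k f k q))) =
  \sum_k 'D_(delta_mx 0 k) G (\row_k f k (val p)) * v (homog 0 (f k)).
Proof.
move=> [_ vD vM] sf sG.
have h0 (H : 'rV[R]_m -> R) : smooth_euclid setT H ->
    (fun q => H (\row_k f k q)) \in smem (filtT P 0).
  by move=> sH; apply/filtT0; apply: smooth_on_comp => //; exact: openT.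
have vc k : v (homog 0 (f k)) =
    v (homog 0 (fun q => (fun y : 'rV[R]_m => y 0 k) (\row_k f k q))).
  by congr (v (homog _ _)); apply/funext => q; rewrite mxE.
under eq_bigr => k _ do rewrite vc.
apply: (euclid_derivation (v := fun H => v (homog 0 (fun q => H (\row_k f k q))))) => //.
- move=> b G1 G2 s1 s2; rewrite -vD; [|exact: smoothW_homog (h0 _ _)..].
  by congr v; apply/funext => psi; rewrite -homog_lin //; exact: h0.
- move=> G1 G2 s1 s2.
  rewrite -(homog_zero_sec p (h0 _ s1)) -(homog_zero_sec p (h0 _ s2)).
  rewrite -vM; [|exact: smoothW_homog (h0 _ _)..].
  congr v; apply/funext => psi.
  by rewrite -(homogM psi (h0 _ s1) (h0 _ s2)).
Qed.

Lemma vanishN_filtT1 h : smoothM P h -> (forall q, N q -> h q = 0) ->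
  h \in smem (filtT P 1).
Proof.
move=> sh h0; apply/filtTP; apply: (wN_ideal h openT).2; split=> // q _.
exact: h0.
Qed.

Lemma smoothM_continuous f q : smoothM P f -> {for q, continuous f}.
Proof. by move=> sf; exact: smooth_on_continuous openT sf I. Qed.

(** The chain rule for [g] retains only symbols of degree 0. Their contribution is [v (homog 0 h)]
    for a function [h] on [M] that restricts to [g] on [N] near [p], hence vanishes there. *)
Lemma derivation_vanish p v g : is_derivation (smoothW P) (zero_sec p) v ->
  (forall (i : 'I_r) f, f \in smem (filtT P i.+1) -> v (homog i.+1 f) = 0) ->
  smoothW P g -> (forall phi, baseW phi -> g phi = 0) -> v g = 0.
Proof.
move=> dv v0 sg g0; have [_ _ vM] := dv; have Np := set_valP p.
(* In degrees above [r] the vanishing is automatic: there is no coordinate of such a weight to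
   test. *)
have v0' i f : f \in smem (filtT P i.+1) -> v (homog i.+1 f) = 0.
  move=> hf; have [ir|ri] := ltnP i r; first exact: (v0 (Ordinal ir)).
  have [c [w [Wc cp]]] := weighted_chart_at (val p).
  have [chi [V [K [schi [oV Vp _] [clK Kc] chi1 chi0]]]] := bump_fun (@cdom_open _ _ _ c) cp.
  have [_ wr _] := Wc.
  apply: (symbol_form_eq0 Wc schi clK Kc chi0 _ (chi1 _ Vp) (symbol_form_homog _ dv)) hf => //.
  by move=> a /leq_trans /(_ (wr a)); rewrite ltnNge ri.
have [m [d [f [G [e [hf sG e0 gE]]]]]] := sg (zero_sec p).
rewrite (derivation_local dv hf sG sg gE); last first.
  by move=> k; rewrite subrr normr0.
(* On [N], [f' k] is the restriction of the [k]-th symbol to the zero section, where symbols of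
   positive degree vanish. *)
pose f' k q : R := if d k == 0%N then f k q else 0.
have sf' k : smoothM P (f' k).
  rewrite /f'; case: eqP => _; last exact: smooth_on_cst.
  exact: filtT_smooth (hf k).
have f'N k (q : N) : f' k (val q) = homog (d k) (f k) (zero_sec q).
  rewrite homog_zero_sec // /f'; case: eqP => // /eqP; rewrite -lt0n => dk.
  by rewrite (filtT_vanish_pos dk (hf k)) //; exact: set_valP.
pose h q := G (\row_k f' k q).
have sh : smoothM P h by apply: smooth_on_comp => //; exact: openT.
have fE q : (\row_k f' k (val q)) = (\row_k homog (d k) (f k) (zero_sec q)) :> 'rV[R]_m.
  by apply/rowP => k; rewrite !mxE f'N.
have -> : \sum_k 'D_(delta_mx 0 k) G (\row_k homog (d k) (f k) (zero_sec p)) *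
    v (homog (d k) (f k)) = v (homog 0 h).
  rewrite /h (derivation_smoothM dv) // fE; apply: eq_bigr => k _; congr (_ * _).
  rewrite /f'; move: (hf k); case: (d k) => [|i] hk /=; first by [].
  by rewrite v0' // (derivation_homog0 dv) //; exact: filtT_zero.
pose box q := forall k, `|f' k q - f' k (val p)| < e.
have nbox : nbhs (val p) box.
  apply: (@filter_forall _ 'I_m (fun k q => `|f' k q - f' k (val p)| < e) (nbhs (val p))) => k.
  have /cvgrPdist_lt/(_ _ e0) := smoothM_continuous (q := val p) (sf' k).
  by apply: filterS => q; rewrite distrC.
have hbox q : N q -> box q -> h q = 0.
  move=> Nq bq; pose q' : N := SigSub (mem_set Nq).
  have -> : h q = g (zero_sec q').
    rewrite gE /h; first by rewrite -fE.
    by move=> k; rewrite -!f'N; exact: bq.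
  by apply: g0; exact: baseW_zero_sec.
have [chi [V [K [schi [oV Vp VU] [clK KU] chi1 chi0]]]] :=
  bump_fun (@open_interior _ box) nbox.
(* Having degree 1, this product has zero symbol in degree 0. The Leibniz rule with [chi = 1] and
   [h = 0] at [p] then leaves [v (homog 0 h)] alone. *)
have hchi : (fun q => chi q * h q) \in smem (filtT P 1).
  apply: vanishN_filtT1; first by apply: smooth_onM => //; exact: openT.
  move=> q Nq; have [Kq|nK] := pselect (K q); last by rewrite chi0 // mul0r.
  by rewrite hbox ?mulr0 //; apply: interior_subset; exact: KU.
have chiT : chi \in smem (filtT P 0) by apply/filtT0.
have hT : h \in smem (filtT P 0) by apply/filtT0.
have := derivation_homog0 dv hchi.
rewrite (_ : homog 0 _ = fun psi => homog 0 chi psi * homog 0 h psi); last first.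
  by apply/funext => psi; rewrite -(homogM psi chiT hT).
rewrite vM; [|exact: smoothW_homog..].
rewrite !homog_zero_sec // chi1 // mul1r hbox ?mulr0 ?addr0 //.
exact: nbhs_singleton nbox.
Qed.

End Derivations.

(** * The linear approximation *)

Section CutCharts.
Context (R : realType) (n r : nat) (P : weighted_pair R n r).
Let M : manifold R n := wM P.
Let N : set M := wN P.
Implicit Types (f h : M -> R) (g : nuW P -> R) (p : N) (q : M).

Record cut_chart := CutChart {
  cchart : chart R M n;
  cweight : 'I_n -> nat;
  cbump : M -> R;
  cplateau : set M;
  csupp : set M;
  cchartP : @weighted_chart R n r P cchart cweight;
  cbump_smooth : smooth_on setT cbump;
  cplateau_open : open cplateau;
  cplateau_dom : cplateau `<=` cdom cchart;
  csupp_closed : closed csupp;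
  csupp_dom : csupp `<=` cdom cchart;
  cbump1 : forall q, cplateau q -> cbump q = 1;
  cbump0 : forall q, ~ csupp q -> cbump q = 0 }.

Lemma cut_chart_at q : exists X : cut_chart, cplateau X q.
Proof.
have [c [w [Wc cq]]] := @weighted_chart_at R n r P q.
have [chi [V [K [schi [oV Vp Vc] [clK Kc] chi1 chi0]]]] := bump_fun (@cdom_open _ _ _ c) cq.
by exists (CutChart Wc schi oV Vc clK Kc chi1 chi0).
Qed.

Context (X : cut_chart).
Let c := cchart X.
Let w := cweight X.
Let Cc : coordinates c := weighted_coordinates (cchartP X).

Definition ccoord a : M -> R := cut_coord c (cbump X) a.

Lemma ccoord_filtT a : ccoord a \in smem (filtT P (w a)).
Proof.
exact: (cut_coord_filtT (cchartP X) (cbump_smooth X) (@csupp_closed X)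
  (@csupp_dom X) (@cbump0 X)).
Qed.

Lemma ccoord_filtT_le i a : (i <= w a)%N -> ccoord a \in smem (filtT P i).
Proof. by move=> iw; apply: filtT_le iw (ccoord_filtT a). Qed.

Lemma ccoord_form_eq0 i q D : (0 < i)%N -> cplateau X q -> symbol_form i q D ->
  (forall a, (i <= w a)%N -> D (ccoord a) = 0) ->
  forall f, f \in smem (filtT P i) -> D f = 0.
Proof.
move=> i0 Xq; apply: (symbol_form_eq0 (cchartP X) (cbump_smooth X) (@csupp_closed X)
  (@csupp_dom X) (@cbump0 X)) => //; exact: cbump1.
Qed.

Definition coord_vec (e : 'I_n -> R) q (f : M -> R) : R :=
  if `[< smoothM P f >] then \sum_a e a * pderive c a f q else 0.

Lemma coord_vecE e q f : smoothM P f -> coord_vec e q f = \sum_a e a * pderive c a f q.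
Proof. by rewrite /coord_vec => /asboolP ->. Qed.

(** The alternative of zero coefficients covers points outside the chart, so that a field cut off by
    the bump is a derivation at every point of [N]. *)
Lemma coord_vec_derivation e q : (cdom c q \/ forall a, e a = 0) ->
  is_derivation (smoothM P) q (coord_vec e q).
Proof.
move=> [cq|e0]; last first.
  have -> : coord_vec e q = fun=> 0.
    apply/funext => f; rewrite /coord_vec; case: ifP => // _.
    by rewrite big1 // => a _; rewrite e0 mul0r.
  by split=> // *; rewrite !mulr0 ?mul0r addr0.
split.
- by move=> f nf; rewrite /coord_vec; case: asboolP.
- move=> b f h sf sh; rewrite !coord_vecE //; last first.
    by apply: smooth_onD; [exact: openT| |]; first by
      apply: smooth_onM => //; [exact: openT|exact: smooth_on_cst].
  rewrite mulr_sumr -big_split /=; apply: eq_bigr => a _.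
  by rewrite pderiveD // mulrDr !mulrA (mulrC b).
- move=> f h sf sh; rewrite !coord_vecE //; last by apply: smooth_onM => //; exact: openT.
  rewrite mulr_sumr mulr_suml -big_split /=; apply: eq_bigr => a _.
  by rewrite (pderiveM a Cc openT I cq) // mulrDr !mulrA (mulrC (f q)).
Qed.

(** The derivative of the bump does not contribute, as it is multiplied by a coordinate that
    vanishes on [N]. *)
Lemma coord_vec_ccoord e q a : cplateau X q -> N q -> (0 < w a)%N ->
  coord_vec e q (ccoord a) = e a.
Proof.
move=> Xq Nq wa; have cq := cplateau_dom Xq.
rewrite coord_vecE; last exact: filtT_smooth (ccoord_filtT a).
rewrite (bigD1 a) //= big1 ?addr0 => [|b ba].
  rewrite /ccoord /cut_coord (@pderiveM _ _ _ c _ (cdom c)) //; first last.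
  - exact: smooth_on_cmap.
  - exact: smooth_on_sub (cbump_smooth X).
  - exact: cdom_open.
  rewrite pderive_cmap // eqxx (cmap_vanish (cchartP X)) // mulr0 addr0 mulr1.
  by rewrite cbump1 // mulr1.
rewrite /ccoord /cut_coord (@pderiveM _ _ _ c _ (cdom c)) //; first last.
- exact: smooth_on_cmap.
- exact: smooth_on_sub (cbump_smooth X).
- exact: cdom_open.
by rewrite pderive_cmap // (negbTE ba) (cmap_vanish (cchartP X)) // !mulr0 addr0 mulr0.
Qed.

Lemma coord_vec_filtT i q e f : cplateau X q -> N q ->
  (forall a, (i < w a)%N -> e a = 0) ->
  f \in smem (filtT P i.+1) -> coord_vec e q f = 0.
Proof.
move=> Xq Nq e0; apply: (@ccoord_form_eq0 i.+1 q (coord_vec e q)) => //.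
  apply: symbol_form_tangent => //; apply: coord_vec_derivation; left.
  exact: cplateau_dom.
by move=> a ia; rewrite coord_vec_ccoord ?e0 // (leq_trans _ ia).
Qed.

(** Both sides are symbol forms, compared on coordinates of weight at least [i.+1]. In weight [i.+1]
    they agree by the choice of [e]; in larger weight both vanish, the symbol of degree [i.+1] being
    zero. *)
Lemma coord_vec_homog i p v f
    (e := fun a => if w a == i.+1 then v (homog i.+1 (ccoord a)) else 0) :
  cplateau X (val p) -> is_derivation (smoothW P) (zero_sec p) v ->
  f \in smem (filtT P i.+1) -> coord_vec e (val p) f = v (homog i.+1 f).
Proof.
move=> Xp dv hf; apply/esym/eqP; rewrite -subr_eq0; apply/eqP; move: f hf.
have Np : N (val p) := set_valP p.
apply: (@ccoord_form_eq0 i.+1 (val p)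
  (fun f => v (homog i.+1 f) - coord_vec e (val p) f)) => //.
  apply: symbol_formB; first exact: symbol_form_homog.
  by apply: symbol_form_tangent => //; apply: coord_vec_derivation; left; exact: cplateau_dom.
move=> a iw; rewrite coord_vec_ccoord // ?(leq_trans _ iw) // /e.
have [wE|wn] := eqVneq (w a) i.+1; first by rewrite subrr.
rewrite (derivation_homog0 dv) ?subrr //; apply: ccoord_filtT_le.
by rewrite ltn_neqAle eq_sym wn.
Qed.

Section CharVec.
Context (p : N) (Xp : cplateau X (val p)) (y : 'I_n -> R).

Definition cchar_vec : (nuW P -> R) -> R := char_vec (cchartP X) (cplateau_dom Xp) y.

Lemma cchar_vec_derivation : is_derivation (smoothW P) (zero_sec p) cchar_vec.
Proof. exact: char_vec_derivation. Qed.

Lemma cchar_vec_ccoord a : (0 < w a)%N -> cchar_vec (homog (w a) (ccoord a)) = y a.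
Proof.
exact: (char_vec_cut (cchartP X) (cplateau_dom Xp) y (cbump_smooth X)
  (@csupp_closed X) (@csupp_dom X) (@cbump0 X) (cbump1 Xp)).
Qed.

Lemma cchar_vec_homog i u f : is_derivation (smoothM P) (val p) u ->
  (forall a, w a = i.+1 -> u (ccoord a) = y a) ->
  (forall a, (i.+1 < w a)%N -> u (ccoord a) = 0) ->
  f \in smem (filtT P i.+1) -> cchar_vec (homog i.+1 f) = u f.
Proof.
move=> du uy u0 hf; apply/eqP; rewrite -subr_eq0; apply/eqP; move: f hf.
have Np : N (val p) := set_valP p.
apply: (@ccoord_form_eq0 i.+1 (val p)
  (fun f => cchar_vec (homog i.+1 f) - u f)) => //.
  apply: symbol_formB; last exact: symbol_form_tangent.
  by apply: symbol_form_homog => //; exact: cchar_vec_derivation.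
move=> a iw; have [wE|wn] := eqVneq (w a) i.+1.
  by rewrite uy // -wE cchar_vec_ccoord ?subrr // wE.
have iw' : (i.+1 < w a)%N by rewrite ltn_neqAle eq_sym wn.
rewrite (derivation_homog0 cchar_vec_derivation) ?u0 ?subrr //.
exact: ccoord_filtT_le.
Qed.

End CharVec.

End CutCharts.

(** * The pairings with functions and the canonical map *)

Section Pairing.
Context (R : realType) (n r : nat) (P : weighted_pair R n r).
Let M : manifold R n := wM P.
Let N : set M := wN P.
Implicit Types (f h : M -> R) (g : nuW P -> R) (p : N).

Lemma tangentP (X : Type) (C : set (X -> R)) x (u : sub_of (tangent C x)) :
  is_derivation C x (val u).
Proof. by have := valP u; rewrite inE. Qed.

Lemma mem_tangent (X : Type) (C : set (X -> R)) x v : is_derivation C x v ->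
  v \in smem (tangent C x).
Proof. by rewrite inE. Qed.

Definition mk_tangent (X : Type) (C : set (X -> R)) x v (dv : is_derivation C x v) :
  sub_of (tangent C x) := Sub v (mem_tangent dv).

Definition mk_nuM p v (dv : is_derivation (smoothM P) (val p) v) : nuM p :=
  cls (tangent_sub (smoothM P) N (val p)) (mk_tangent dv).

Definition mk_nuE p v (dv : is_derivation (smoothW P) (zero_sec p) v) : nuE p :=
  cls (tangent_sub (smoothW P) (@baseW _ _ _ P) (zero_sec p)) (mk_tangent dv).

Lemma conormalM_cls i p f (u : sub_of (tangent (smoothM P) (val p))) :
  f \in smem (filtT P i.+1) ->
  conormal f (cls (tangent_sub (smoothM P) N (val p)) u) = val u f.
Proof.
by move=> hf; apply: conormalE; [exact: filtT_smooth hf|exact: filtT_vanish hf].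
Qed.

Lemma conormalE_cls i p f (v : sub_of (tangent (smoothW P) (zero_sec p))) :
  f \in smem (filtT P i.+1) ->
  conormal (homog i.+1 f) (cls (tangent_sub (smoothW P) (@baseW _ _ _ P) (zero_sec p)) v) =
  val v (homog i.+1 f).
Proof.
move=> hf; apply: conormalE; first exact: smoothW_homog.
by move=> phi; exact: homog_baseW.
Qed.

Lemma conormalM_lin i p f : f \in smem (filtT P i.+1) -> forall a (x y : nuM p),
  conormal f (a *: x + y) = a * conormal f x + conormal f y.
Proof.
by move=> hf; apply: conormal_linear; [exact: filtT_smooth hf|exact: filtT_vanish hf].
Qed.

Lemma conormalE_lin i p f : f \in smem (filtT P i.+1) -> forall a (x y : nuE p),
  conormal (homog i.+1 f) (a *: x + y) =
  a * conormal (homog i.+1 f) x + conormal (homog i.+1 f) y.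
Proof.
move=> hf; apply: conormal_linear; first exact: smoothW_homog.
by move=> phi; exact: homog_baseW.
Qed.

Lemma FnuP j p (x : nuM p) : x \in smem (Fnu j p) <->
  forall f, f \in smem (filtT P j.+1) -> conormal f x = 0.
Proof. by rewrite inE. Qed.

Lemma grF_pair_cls i p f (z : sub_of (Fnu i.+1 p)) : f \in smem (filtT P i.+1) ->
  grF_pair f (cls (restr (Fnu i.+1 p) (Fnu i p)) z) = conormal f (val z).
Proof.
move=> hf; rewrite /grF_pair; set z' := repr _.
have : val (z' - z) \in smem (Fnu i p).
  exact: (repr_cls (restr (Fnu i.+1 p) (Fnu i p)) z).
move=> /FnuP/(_ f hf); rewrite raddfB -scaleN1r addrC (conormalM_lin hf) mulN1r.
by move=> /eqP; rewrite addrC subr_eq0 => /eqP.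
Qed.

Lemma grF_pair_lin i p f : f \in smem (filtT P i.+1) -> forall a (x y : grF i p),
  grF_pair f (a *: x + y) = a * grF_pair f x + grF_pair f y.
Proof.
move=> hf a x y; rewrite -(cls_repr x) -(cls_repr y) -clsZD !grF_pair_cls //.
by rewrite linearP (conormalM_lin hf).
Qed.

(** [Fnu i] is by definition the annihilator of the functions of degree [i.+1]. *)
Lemma grF_pair_inj i p (x y : grF i p) :
  (forall f, f \in smem (filtT P i.+1) -> grF_pair f x = grF_pair f y) -> x = y.
Proof.
rewrite -(cls_repr x) -(cls_repr y) => h; apply/clsP.
suff : val (repr x - repr y) \in smem (Fnu i p) by [].
apply/FnuP => f hf; rewrite raddfB -scaleN1r addrC (conormalM_lin hf) mulN1r.
by have := h f hf; rewrite !grF_pair_cls // => ->; rewrite addNr.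
Qed.

Lemma grF_lift i p u (du : is_derivation (smoothM P) (val p) u) :
  (forall f, f \in smem (filtT P i.+2) -> u f = 0) ->
  exists z : sub_of (Fnu i.+1 p), val z = mk_nuM du.
Proof.
move=> u0; have h : mk_nuM du \in smem (Fnu i.+1 p).
  by apply/FnuP => f hf; rewrite (conormalM_cls _ hf) /= u0.
by exists (exist _ (mk_nuM du) h).
Qed.

Lemma grF_vec i p (y : grF i p) : exists u : sub_of (tangent (smoothM P) (val p)),
  (forall f, f \in smem (filtT P i.+2) -> val u f = 0) /\
  (forall f, f \in smem (filtT P i.+1) -> grF_pair f y = val u f).
Proof.
rewrite -(cls_repr y); set z := repr y; have := valP z; set x := val z.
move=> hx; exists (repr x); split=> f hf.
  have /FnuP/(_ f hf) := hx.
  by rewrite -{1}(cls_repr x) (conormalM_cls _ hf).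
by rewrite grF_pair_cls // -/x -{1}(cls_repr x) (conormalM_cls _ hf).
Qed.

(** The witness is a combination of the partial derivatives along coordinates of weight exactly
    [i.+1], with the values of [x] on their symbols as coefficients. It kills functions of degree
    [i.+2], hence lies in [Fnu i.+1]. *)
Lemma lin_map_exists p (x : nuE p) i : exists y : grF i p,
  forall f, f \in smem (filtT P i.+1) -> grF_pair f y = conormal (homog i.+1 f) x.
Proof.
rewrite -(cls_repr x); set v := repr x; have dv := tangentP v.
have [X Xp] := @cut_chart_at R n r P (val p).
pose e a := if cweight X a == i.+1 then val v (homog i.+1 (ccoord X a)) else 0.
have du : is_derivation (smoothM P) (val p) (coord_vec X e (val p)).
  by apply: coord_vec_derivation; left; exact: cplateau_dom.
have [|z zE] := grF_lift (i := i) du.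
  move=> f; apply: coord_vec_filtT => //; first exact: set_valP.
  by move=> a; rewrite /e; case: eqP => // ->; rewrite ltnn.
exists (cls _ z) => f hf.
rewrite grF_pair_cls // zE (conormalM_cls _ hf) (conormalE_cls _ hf) /=.
exact: coord_vec_homog.
Qed.

(** The chosen value does not depend on the chart or on the choice, by [grF_pair_inj]. *)
Definition lin_map p (x : nuE p) : dprod (fun i : 'I_r => grF i p) :=
  fun i => projT1 (cid (lin_map_exists x i)).

Lemma lin_map_pair p (x : nuE p) (i : 'I_r) f : f \in smem (filtT P i.+1) ->
  grF_pair f (lin_map x i) = conormal (homog i.+1 f) x.
Proof. by move=> hf; rewrite /lin_map; case: cid => /= y; apply. Qed.

Lemma dprod_ext (I : Type) (V : I -> lmodType R) (x y : dprod V) :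
  (forall i, x i = y i) -> x = y.
Proof. by move=> h; apply: functional_extensionality_dep. Qed.

Lemma lin_map_unique p (x : nuE p) (y : dprod (fun i : 'I_r => grF i p)) :
  (forall (i : 'I_r) f, f \in smem (filtT P i.+1) ->
     grF_pair f (y i) = conormal (homog i.+1 f) x) -> y = lin_map x.
Proof.
move=> h; apply: dprod_ext => i; apply: grF_pair_inj => f hf.
by rewrite h // lin_map_pair.
Qed.

Lemma lin_map_linear p a (x y : nuE p) :
  lin_map (a *: x + y) = a *: lin_map x + lin_map y.
Proof.
apply/esym/lin_map_unique => i f hf.
rewrite (conormalE_lin hf) -!lin_map_pair //.
exact: grF_pair_lin.
Qed.

Lemma nuE_eq0 p (x : nuE p) :
  (forall (i : 'I_r) f, f \in smem (filtT P i.+1) -> conormal (homog i.+1 f) x = 0) ->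
  x = 0.
Proof.
rewrite -(cls_repr x); set v := repr x => h; apply/clsP; rewrite subr0 inE => g sg g0.
apply: (derivation_vanish (tangentP v)) => // i f hf.
by have := h i f hf; rewrite conormalE_cls.
Qed.

Lemma lin_map_inj p : injective (@lin_map p).
Proof.
move=> x y xy; apply/eqP; rewrite -subr_eq0; apply/eqP/nuE_eq0 => i f hf.
rewrite -scaleN1r addrC (conormalE_lin hf) -!lin_map_pair // xy.
by rewrite mulN1r addNr.
Qed.

(** At most one term is nonzero: the one with [i.+1] the weight of [a]. *)
Definition char_coord (X : cut_chart P) (u : 'I_r -> (M -> R) -> R) (a : 'I_n) : R :=
  \sum_(i < r) if cweight X a == i.+1 then u i (ccoord X a) else 0.

Lemma char_coordE X u a (i : 'I_r) : cweight X a = i.+1 ->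
  char_coord X u a = u i (ccoord X a).
Proof.
move=> wE; rewrite /char_coord (bigD1 i) //= wE eqxx big1 ?addr0 // => j ji.
by case: eqP => // -[ij]; case/eqP: ji; apply: val_inj.
Qed.

Lemma char_coord_homog X p (Xp : cplateau X (val p)) u (i : 'I_r) f :
  (forall i, is_derivation (smoothM P) (val p) (u i)) ->
  (forall (i : 'I_r) f, f \in smem (filtT P i.+2) -> u i f = 0) ->
  f \in smem (filtT P i.+1) ->
  cchar_vec Xp (char_coord X u) (homog i.+1 f) = u i f.
Proof.
move=> du u0; apply: cchar_vec_homog => // a wa; first by rewrite (char_coordE u wa).
by rewrite u0 //; exact: ccoord_filtT_le.
Qed.

(** Each component of [y] is lifted to a derivation on [M]. A coordinate of weight [i.+1] receives
    as velocity its value under the [i]-th lift, so a single curve of characters realizes all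
    degrees at once. *)
Lemma lin_map_surj p (y : dprod (fun i : 'I_r => grF i p)) :
  exists x : nuE p, lin_map x = y.
Proof.
have [u uP] := choice (fun i => grF_vec (y i)).
have [X Xp] := @cut_chart_at R n r P (val p).
pose e := char_coord X (fun i => val (u i)).
exists (mk_nuE (cchar_vec_derivation Xp e)); apply/esym/lin_map_unique => i f hf.
have [_ /(_ f hf) ->] := uP i; rewrite (conormalE_cls _ hf) /=.
apply/esym/char_coord_homog => //; first by move=> j; exact: tangentP.
by move=> j h hh; have [/(_ h hh)] := uP j.
Qed.

Lemma lin_map_bij p : bijective (@lin_map p).
Proof.
have [k kP] := choice (@lin_map_surj p); exists k => // x.
by apply: lin_map_inj; rewrite kP.
Qed.

End Pairing.

(** * Compatibility with the gradings *)

Section Degrees.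
Context (R : realType) (n r : nat) (P : weighted_pair R n r).
Let M : manifold R n := wM P.
Let N : set M := wN P.
Implicit Types (f h : M -> R) (g : nuW P -> R) (p : N).

Lemma nuE_ext p (x y : nuE p) :
  (forall (i : 'I_r) f, f \in smem (filtT P i.+1) ->
     conormal (homog i.+1 f) x = conormal (homog i.+1 f) y) -> x = y.
Proof.
by move=> h; apply: lin_map_inj; apply: lin_map_unique => i f hf; rewrite lin_map_pair // h.
Qed.

Lemma conormalE_scale p (x : nuE p) i f a : f \in smem (filtT P i.+1) ->
  conormal (homog i.+1 f) (a *: x) = a * conormal (homog i.+1 f) x.
Proof.
move=> hf; have := conormalE_lin hf a x 0; rewrite addr0 => ->.
have := conormalE_lin hf (-1) (0 : nuE p) 0.
by rewrite scaler0 addr0 mulN1r addNr => ->; rewrite addr0.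
Qed.

Lemma smoothW_kappa t g : smoothW P g -> smoothW P (fun phi => g (kappa t phi)).
Proof.
move=> sg phi; have [m [d [f [G [e [hf sG e0 gE]]]]]] := sg (kappa t phi).
(* Composition with [kappa t] scales the [k]-th symbol by [t ^+ d k], and [S] exceeds all these
   factors in absolute value; radius [e / S] at [phi] therefore gives radius [e] at
   [kappa t phi]. *)
pose S := 1 + \sum_(k < m) `|t| ^+ d k.
have t_ge0 j : 0 <= `|t| ^+ d j by exact: exprn_ge0.
have S0 : 0 < S.
  by apply: ltr_pwDl => //; apply: sumr_ge0 => j _; exact: t_ge0.
have S_ge k : `|t| ^+ d k < S.
  rewrite /S (bigD1 k) //= addrCA ltrDl; apply: ltr_pwDl => //.
  by apply: sumr_ge0 => j _; exact: t_ge0.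
exists m, d, f, (fun y => G (\row_k (t ^+ d k * y 0 k))), (e / S); split=> //.
- apply: (smooth_euclid_comp (g := fun k y => t ^+ d k * y 0 k) openT openT) => // k.
  apply: smooth_euclidM; [exact: openT|exact: smooth_euclid_cst|].
  exact: smooth_euclid_coord.
- by rewrite divr_gt0.
move=> psi h; rewrite gE => [|k].
  by congr G; apply/rowP => k; rewrite !mxE.
rewrite !homog_kappa -mulrBr normrM normrX.
have [->|t0] := eqVneq (`|t| ^+ d k) 0; first by rewrite mul0r.
have tk : 0 < `|t| ^+ d k by rewrite lt_neqAle eq_sym t0 exprn_ge0.
apply: (@lt_trans _ _ (`|t| ^+ d k * (e / S))); first by rewrite ltr_pM2l.
by rewrite mulrCA gtr_pMr // ltr_pdivrMr // mul1r.
Qed.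

Lemma homog_kappa_fun t i f :
  (fun phi : nuW P => homog i f (kappa t phi)) = (fun phi => t ^+ i * homog i f phi).
Proof. by []. Qed.

Lemma derivation_scale (X : Type) (C : set (X -> R)) x v a (F : X -> R) :
  C (fun=> 0) -> is_derivation C x v -> C F -> v (fun z => a * F z) = a * v F.
Proof.
move=> C0 dv CF; have [_ vD _] := dv.
have := vD a F _ CF C0; rewrite (derivation0 C0 dv) addr0 => <-.
by congr v; apply/funext => z; rewrite addr0.
Qed.

(** The pushforward under [kappa t] stays at the same point because the zero section is fixed. *)
Lemma kappa_derivation p t v : is_derivation (smoothW P) (zero_sec p) v ->
  is_derivation (smoothW P) (zero_sec p)
    (fun g => if `[< smoothW P g >] then v (fun phi => g (kappa t phi)) else 0).
Proof.
move=> [_ vD vM]; split.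
- by move=> g ng; case: asboolP.
- move=> a g1 g2 s1 s2; rewrite !asboolT //; last exact: smoothW_lin.
  by rewrite vD //; exact: smoothW_kappa.
- move=> g1 g2 s1 s2; rewrite !asboolT //; last exact: smoothWM.
  by rewrite vM ?kappa_zero_sec //; exact: smoothW_kappa.
Qed.

Lemma exp2_inj (i k : nat) : (2 : R) ^+ i = 2 ^+ k -> i = k.
Proof.
rewrite -!natrX => /eqP; rewrite eqr_nat => /eqP; exact: expnI.
Qed.

Lemma lin_map_deg k p (x : nuE p) :
  (forall t : R, nu_map (kappa t) x (t ^+ k *: x)) <->
  (forall i : 'I_r, i.+1 != k -> lin_map x i = 0).
Proof.
split=> [hx i ik|x0 t].
  apply: grF_pair_inj => f hf; rewrite lin_map_pair //.
  have -> : grF_pair f (0 : grF i p) = 0.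
    have := grF_pair_lin hf (-1) (0 : grF i p) 0.
    by rewrite scaler0 addr0 mulN1r addNr.
  (* One value of [t] separates the degrees if its powers are distinct, as for 2. *)
  have [u [v [ux vx uv]]] := hx 2.
  have E : 2 ^+ k * conormal (homog i.+1 f) x = 2 ^+ i.+1 * conormal (homog i.+1 f) x.
    rewrite -conormalE_scale // -vx conormalE_cls // uv; last exact: smoothW_homog.
    rewrite homog_kappa_fun -ux conormalE_cls // (derivation_scale _ _ (tangentP u)) //.
      exact: smoothW0.
    exact: smoothW_homog.
  apply/eqP/negPn/negP => c0; case/eqP: ik; apply: exp2_inj.
  exact: (mulIf c0 (esym E)).
rewrite -{1}(cls_repr x); set u := repr x.
(* The pushforward of [u] represents [t ^+ k *: x], as pairings in degrees other than [k] vanish by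
   assumption and those in degree [k] scale by [t ^+ k]. *)
pose dv := kappa_derivation t (tangentP u).
exists u, (mk_tangent dv); split=> //; last first.
  by move=> g sg; rewrite /= asboolT.
apply: nuE_ext => i f hf; rewrite conormalE_cls // conormalE_scale //= asboolT; last first.
  exact: smoothW_homog.
rewrite homog_kappa_fun (derivation_scale _ _ (tangentP u)); first last.
- exact: smoothW_homog.
- exact: smoothW0.
rewrite -conormalE_cls // cls_repr; have [->//|ik] := eqVneq i.+1 k.
rewrite -lin_map_pair // x0 //.
have -> : grF_pair f (0 : grF i p) = 0.
  have := grF_pair_lin hf (-1) (0 : grF i p) 0.
  by rewrite scaler0 addr0 mulN1r addNr.
by rewrite !mulr0.
Qed.

End Degrees.

(** * Smooth sections *)

Section SmoothSections.
Context (R : realType) (n r : nat) (P : weighted_pair R n r).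
Let M : manifold R n := wM P.
Let N : set M := wN P.
Implicit Types (f : M -> R) (g : nuW P -> R) (p q : N) (h : N -> R).

(** The condition that [smoothN] imposes at each point, isolated so that formulas valid near one
    point can be used. *)
Definition smoothN_at h p := exists f (U : set M),
  [/\ smoothM P f, open U, U (val p) & forall q : N, U (val q) -> h q = f (val q)].

Lemma smoothN_at_smooth f p : smoothM P f -> smoothN_at (fun q => f (val q)) p.
Proof. by move=> sf; exists f, setT; split=> //; exact: openT. Qed.

Lemma smoothN_at_cst a p : smoothN_at (fun=> a) p.
Proof. exact: (smoothN_at_smooth p (smooth_on_cst _ a)). Qed.

Lemma smoothN_at_ext h h' p (U : set M) : open U -> U (val p) ->
  (forall q : N, U (val q) -> h q = h' q) -> smoothN_at h' p -> smoothN_at h p.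
Proof.
move=> oU Up hh' [f [V [sf oV Vp h'f]]]; exists f, (U `&` V); split=> //.
- exact: openI.
- by move=> q [Uq Vq]; rewrite hh' // h'f.
Qed.

Lemma smoothN_atD h h' p : smoothN_at h p -> smoothN_at h' p ->
  smoothN_at (fun q => h q + h' q) p.
Proof.
move=> [f [U [sf oU Up hf]]] [f' [V [sf' oV Vp hf']]].
exists (fun x => f x + f' x), (U `&` V); split=> //.
- by apply: smooth_onD => //; exact: openT.
- exact: openI.
- by move=> q [Uq Vq]; rewrite hf // hf'.
Qed.

Lemma smoothN_atM h h' p : smoothN_at h p -> smoothN_at h' p ->
  smoothN_at (fun q => h q * h' q) p.
Proof.
move=> [f [U [sf oU Up hf]]] [f' [V [sf' oV Vp hf']]].
exists (fun x => f x * f' x), (U `&` V); split=> //.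
- by apply: smooth_onM => //; exact: openT.
- exact: openI.
- by move=> q [Uq Vq]; rewrite hf // hf'.
Qed.

Lemma smoothN_at_sum m (F : 'I_m -> N -> R) p : (forall k, smoothN_at (F k) p) ->
  smoothN_at (fun q => \sum_k F k q) p.
Proof.
elim: m F => [|m IHm] F sF.
  apply: (smoothN_at_ext openT I _ (smoothN_at_cst 0 p)) => q _.
  by rewrite big_ord0.
apply: (smoothN_at_ext openT I _ (smoothN_atD (sF ord0)
  (IHm (fun k => F (lift ord0 k)) (fun k => sF _)))) => q _.
by rewrite big_ord_recl.
Qed.

Lemma smoothN_at_on f (U : set M) p : open U -> U (val p) -> smooth_on U f ->
  smoothN_at (fun q => f (val q)) p.
Proof.
move=> oU Up sf.
have [chi [V [K [schi [oV Vp _] [clK KU] chi1 chi0]]]] := bump_fun oU Up.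
exists (fun x => chi x * f x), V; split=> //.
  exact: (smooth_extend oU clK KU schi chi0 sf).
by move=> q Vq; rewrite chi1 // mul1r.
Qed.

(** Near each point the formula of [lin_map_exists] is used in one fixed chart, so its coefficients
    are values of a smooth lift of [s] on fixed symbols. *)
Lemma lin_map_sec (s : forall p, nuE p) : nuE_sec s ->
  forall i : 'I_r, grF_sec (fun p => lin_map (s p) i).
Proof.
move=> ss i p; have [U [t [oU Up st ts]]] := ss p.
have [X Xp] := @cut_chart_at R n r P (val p).
pose co a (q : N) := if cweight X a == i.+1 then val (t q) (homog i.+1 (ccoord X a)) else 0.
(* The bump makes the field vanish outside the chart, since a lift must be given on all of [N]. *)
pose e (q : N) a := cbump X (val q) * co a q.
have de (q : N) : is_derivation (smoothM P) (val q) (coord_vec X (e q) (val q)).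
  apply: coord_vec_derivation; have [cq|ncq] := pselect (cdom (cchart X) (val q)).
    by left.
  by right=> a; rewrite /e cbump0 ?mul0r // => /csupp_dom.
exists (U `&` cplateau X), (fun q => mk_nuM (de q)); split=> //.
- by apply: openI => //; exact: cplateau_open.
- move=> p0; exists setT, (fun q => mk_tangent (de q)); split=> //; first exact: openT.
  (* The bump is grouped with the partial derivative: the latter is smooth only on the chart domain,
     while their product extends smoothly by zero. *)
  move=> f sf p1; apply: (smoothN_at_ext openT I (h' := fun q => \sum_a
      (cbump X (val q) * pderive (cchart X) a f (val q)) * co a q)).
    move=> q _; rewrite /= coord_vecE //; apply: eq_bigr => a _.
    by rewrite /e mulrAC.
  apply: smoothN_at_sum => a; apply: smoothN_atM.
    apply: (smoothN_at_smooth (f := fun x => cbump X x * pderive (cchart X) a f x)).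
    apply: (smooth_cut (cbump_smooth X) (@csupp_closed _ _ _ _ X) (@csupp_dom _ _ _ _ X)
      (@cbump0 _ _ _ _ X)).
    have := smooth_on_pderive a (weighted_coordinates (cchartP X)) openT sf.
    by rewrite setIT.
  rewrite /co; case: eqP => wa; last exact: smoothN_at_cst.
  by apply: st; apply: smoothW_homog; apply: ccoord_filtT_le; rewrite wa.
move=> q [Uq Xq]; have Nq : N (val q) := set_valP q.
have eE : e q = fun a => if cweight X a == i.+1 then
    val (t q) (homog i.+1 (ccoord X a)) else 0.
  by apply/funext => a; rewrite /e cbump1 // mul1r.
have [|z zE] := grF_lift (i := i) (de q).
  move=> f; apply: coord_vec_filtT => // a.
  by rewrite eE; case: eqP => // ->; rewrite ltnn.
exists z; split=> //; apply: grF_pair_inj => f hf.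
rewrite grF_pair_cls // zE (conormalM_cls _ hf) lin_map_pair // -(ts q Uq).
rewrite conormalE_cls //= eE.
exact: (coord_vec_homog Xq (tangentP (t q)) hf).
Qed.

(** One presentation of [g] by symbols serves all [q] near [p0], and the chain rule expresses
    [T q g] by derivatives of [G] on the zero section and values on these symbols. [T] is a total
    family because [cchar_vec] requires a proof that its point lies in the plateau. *)
Lemma smoothN_at_cchar (X : cut_chart P) p0 (Xp : cplateau X (val p0))
    (T : N -> (nuW P -> R) -> R)
    (y : N -> 'I_n -> R) g :
  (forall q (Xq : cplateau X (val q)), T q = cchar_vec Xq (y q)) ->
  (forall a, smoothN_at (y ^~ a) p0) -> smoothW P g ->
  smoothN_at (fun q => T q g) p0.
Proof.
move=> TE sy sg; have [m [d [f [G [e [hf sG e0 gE]]]]]] := sg (zero_sec p0).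
pose f' k x : R := if d k == 0%N then f k x else 0.
have sf' k : smoothM P (f' k).
  rewrite /f'; case: eqP => _; last exact: smooth_on_cst.
  exact: filtT_smooth (hf k).
have f'N k (q : N) : f' k (val q) = homog (d k) (f k) (zero_sec q).
  rewrite homog_zero_sec // /f'; case: eqP => // /eqP; rewrite -lt0n => dk.
  by rewrite (filtT_vanish_pos dk (hf k)) //; exact: set_valP.
pose box x := forall k, `|f' k x - f' k (val p0)| < e.
have nbox : nbhs (val p0) box.
  apply: (@filter_forall _ 'I_m (fun k (x : M) => `|f' k x - f' k (val p0)| < e)
    (nbhs (val p0))) => k.
  have /cvgrPdist_lt/(_ _ e0) := smoothM_continuous (q := val p0) (sf' k).
  by apply: filterS => q; rewrite distrC.
pose c := cchart X; pose w := cweight X.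
(* The value on the [k]-th symbol, computed on [M]: only coordinates of weight [d k] contribute, and
   degree 0 gives 0 because the curves of characters stay over their base point. *)
pose L k (q : N) := if d k == 0%N then 0 else
  \sum_a (if w a == d k then y q a else 0) * pderive c a (f k) (val q).
have TL k q : cplateau X (val q) -> T q (homog (d k) (f k)) = L k q.
  move=> Xq; rewrite TE /L; case: (d k) (hf k) => [|i] hk /=.
    by apply: char_vec_homog0; exact: filtT_smooth hk.
  pose u := coord_vec X (fun a => if w a == i.+1 then y q a else 0) (val q).
  have Nq : N (val q) := set_valP q.
  rewrite -[RHS](coord_vecE X _ (val q) (filtT_smooth hk)).
  apply: cchar_vec_homog => //.
  - by apply: coord_vec_derivation; left; exact: cplateau_dom.
  - by move=> a wa; rewrite coord_vec_ccoord // /w wa ?eqxx.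
  - move=> a wa; rewrite coord_vec_ccoord //; last exact: leq_trans wa.
    by rewrite /w (gtn_eqF wa).
have oU : open (interior box `&` cplateau X).
  by apply: openI; [exact: open_interior|exact: cplateau_open].
apply: (smoothN_at_ext oU (h' := fun q => \sum_k
    'D_(delta_mx 0 k) G (\row_k f' k (val q)) * L k q)) => //.
  move=> q [/interior_subset bq Xq].
  have dT : is_derivation (smoothW P) (zero_sec q) (T q).
    by rewrite (TE q Xq); exact: cchar_vec_derivation.
  (* The presentation is centred at [zero_sec p0] while the derivation sits at [zero_sec q], hence
     the separate centre [phi] in [derivation_local]. *)
  rewrite (derivation_local dT hf sG sg gE); last first.
    by move=> k; rewrite -!f'N; exact: bq.
  have -> : \row_k homog (d k) (f k) (zero_sec q) = \row_k f' k (val q).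
    by apply/rowP => j; rewrite !mxE f'N.
  by apply: eq_bigr => k _; rewrite (TL k q Xq).
apply: smoothN_at_sum => k; apply: smoothN_atM.
  apply: (smoothN_at_smooth (f := fun x => 'D_(delta_mx 0 k) G (\row_k f' k x))).
  apply: (smooth_on_comp (G := fun z => 'D_(delta_mx 0 k) G z)) => //; first exact: openT.
  exact: smooth_euclid_derive.
rewrite /L; case: eqP => _; first exact: smoothN_at_cst.
apply: smoothN_at_sum => a; apply: smoothN_atM.
  by case: eqP => _; [exact: sy|exact: smoothN_at_cst].
apply: (@smoothN_at_on (pderive c a (f k)) (cdom c)).
- exact: cdom_open.
- exact: cplateau_dom.
- have := smooth_on_pderive a (weighted_coordinates (cchartP X)) openT (filtT_smooth (hf k)).
  by rewrite setIT.
Qed.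

(** The construction of [lin_map_surj] is carried out in a fixed chart from smooth lifts of the [r]
    components, and then extended by zero. *)
Lemma lin_map_sec_inv (s : forall p, nuE p) :
  (forall i : 'I_r, grF_sec (fun p => lin_map (s p) i)) -> nuE_sec s.
Proof.
move=> ss p; have [X Xp] := @cut_chart_at R n r P (val p).
have lift (i : 'I_r) : exists Vu : set M * (forall q : N, sub_of (tangent (smoothM P) (val q))),
    [/\ open Vu.1, Vu.1 (val p),
        forall f, smoothM P f -> smoothN (fun q => val (Vu.2 q) f) &
        forall q, Vu.1 (val q) ->
          (forall f, f \in smem (filtT P i.+2) -> val (Vu.2 q) f = 0) /\
          (forall f, f \in smem (filtT P i.+1) ->
             val (Vu.2 q) f = grF_pair f (lin_map (s q) i))].
  (* Two lifts in succession: from the graded quotient to the normal bundle, then to derivations on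
     [M]. *)
  have [U [t [oU Up st tU]]] := ss i p.
  have [U' [u [oU' Up' su uU]]] := st p.
  exists (U `&` U', u); split=> //=; first exact: openI.
  move=> q [Uq U'q]; have [z [zt zs]] := tU q Uq.
  split=> f hf; have : val (u q) f = conormal f (val z).
  - by rewrite zt -(uU q U'q) (conormalM_cls _ hf).
  - by move=> ->; have /FnuP := valP z; apply.
  - by rewrite zt -(uU q U'q) (conormalM_cls _ hf).
  - by move=> ->; rewrite -zs grF_pair_cls.
have [Vu VuP] := choice lift.
pose u i := (Vu i).2; pose W := [set x : M | forall i, (Vu i).1 x].
have nW : nbhs (val p) W.
  apply: (@filter_forall _ 'I_r (fun i x => (Vu i).1 x) (nbhs (val p))) => i.
  by have [oV Vp _ _] := VuP i; exact: open_nbhs_nbhs.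
have [chi [V [K [schi [oV Vp VU] [clK KU] chi1 chi0]]]] :=
  bump_fun (@cplateau_open _ _ _ _ X) Xp.
(* Since [chi] vanishes off a closed subset of the plateau, the vectors vanish near the boundary of
   the plateau and match the value 0 given to [T] outside it. *)
pose y (q : N) a := chi (val q) * char_coord X (fun i => val (u i q)) a.
pose T (q : N) : (nuW P -> R) -> R := if pselect (cplateau X (val q)) is left Xq
  then cchar_vec Xq (y q) else fun=> 0.
have TE (q : N) (Xq : cplateau X (val q)) : T q = cchar_vec Xq (y q).
  by rewrite /T; case: pselect => // Xq'; rewrite (Prop_irrelevance Xq Xq').
have T0 (q : N) g : ~ K (val q) -> T q g = 0.
  move=> nK; rewrite /T; case: pselect => // Xq; apply: char_vec0 => a.
  by rewrite /y chi0 // mul0r.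
have dT (q : N) : is_derivation (smoothW P) (zero_sec q) (T q).
  rewrite /T; case: pselect => Xq; first exact: cchar_vec_derivation.
  by split=> // *; rewrite !mulr0 ?mul0r addr0.
exists (interior (V `&` W)), (fun q => mk_tangent (dT q)); split.
- exact: open_interior.
- by apply: filterI => //; apply: open_nbhs_nbhs.
- move=> g sg p0; have [Xp0|nX] := pselect (cplateau X (val p0)).
    apply: (smoothN_at_cchar Xp0 TE) => // a; apply: smoothN_atM.
      exact: smoothN_at_smooth schi.
    apply: smoothN_at_sum => i; case: eqP => wa; last exact: smoothN_at_cst.
    have [_ _ su _] := VuP i; apply: su.
    exact: filtT_smooth (ccoord_filtT X a).
  apply: (@smoothN_at_ext _ (fun=> 0) p0 (~` K)).
  + by rewrite openC.
  + by move=> /KU.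
  + by move=> q nK; rewrite /= T0.
  + exact: smoothN_at_cst.
move=> q /interior_subset[Vq Wq]; apply: nuE_ext => i f hf.
have Xq : cplateau X (val q) by exact: VU.
have uq (j : 'I_r) : (forall f, f \in smem (filtT P j.+2) -> val (u j q) f = 0) /\
    (forall f, f \in smem (filtT P j.+1) -> val (u j q) f = grF_pair f (lin_map (s q) j)).
  by have [_ _ _] := VuP j; apply; exact: Wq.
rewrite conormalE_cls //= TE.
have -> : y q = char_coord X (fun i => val (u i q)).
  by apply/funext => a; rewrite /y chi1 // mul1r.
rewrite (char_coord_homog Xq _ _ hf).
- by have [_ ->] := uq i; rewrite ?lin_map_pair.
- by move=> j; exact: tangentP.
- by move=> j h hh; have [/(_ h hh)] := uq j.
Qed.

End SmoothSections.

Theorem proposition4p4 (R : realType) (n r : nat) (P : weighted_pair R n r) :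
  exists Phi : forall p : wN P, gfib (nuW_lin P) p -> gfib (gr_nu P) p,
    [/\ gr_iso Phi,
        canonical_map Phi &
        forall Psi : forall p : wN P, gfib (nuW_lin P) p -> gfib (gr_nu P) p,
          canonical_map Psi -> Psi = Phi].
Proof.
exists (@lin_map R n r P); split.
- split.
  + exact: lin_map_linear.
  + exact: lin_map_bij.
  + exact: lin_map_deg.
  + by move=> s; split; [exact: lin_map_sec|exact: lin_map_sec_inv].
- by move=> p x i f hf; exact: lin_map_pair.
- move=> Psi hPsi; apply: functional_extensionality_dep => p; apply/funext => x.
  by apply: lin_map_unique => i f hf; exact: hPsi.
Qed.
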